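(* Let $s_1,s_2,0,1,\infty$ be five distinct points on the Riemann sphere $\mathbb{P}^1(\mathbb{C})$. For each choice of the sign $\pm$: (1) The monodromy group of the following logarithmic connection on $\mathcal{O}^{\oplus3}_{\mathbb{P}^1}$ is (up to conjugacy in $\mathrm{GL}_3(\mathbb{C})$) the primitive complex reflection group of order $648$: $$Z\mapsto dZ\pm\left(\begin{pmatrix}1/3&0&0\\1/6&0&0\\1/6&0&0\end{pmatrix}\frac{dx}{x-s_1}+\begin{pmatrix}0&1/6&0\\0&1/3&0\\0&1/6&0\end{pmatrix}\frac{dx}{x}+\begin{pmatrix}0&0&1/6\\0&0&1/6\\0&0&1/3\end{pmatrix}\frac{dx}{x-1}\right)\cdot Z.$$ (2) The monodromy group of the following logarithmic connection on $\mathcal{O}^{\oplus4}_{\mathbb{P}^1}$ is (up to conjugacy in $\mathrm{GL}_4(\mathbb{C})$) the primitive complex reflection group of order $155520$: $$Z\mapsto dZ\pm\left(\begin{pmatrix}1/3&0&0&0\\1/6&0&0&0\\1/6&0&0&0\\1/6&0&0&0\end{pmatrix}\frac{dx}{x-s_1}+\begin{pmatrix}0&1/6&0&0\\0&1/3&0&0\\0&1/6&0&0\\0&1/6&0&0\end{pmatrix}\frac{dx}{x-s_2}+\begin{pmatrix}0&0&1/6&0\\0&0&1/6&0\\0&0&1/3&0\\0&0&1/6&0\end{pmatrix}\frac{dx}{x}+\begin{pmatrix}0&0&0&1/6\\0&0&0&1/6\\0&0&0&1/6\\0&0&0&1/3\end{pmatrix}\frac{dx}{x-1}\right)\cdot 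Z.$$
   Context: Let $\omega=e^{2i\pi/3}$. The primitive complex reflection group of order 648 is the Shephard-Todd group $G_{25}\subset\mathrm{GL}_3(\mathbb{C})$ generated by $\mathrm{diag}(1,1,\omega^2)$, $\frac{\omega^2-\omega}{3}\begin{pmatrix}\omega&\omega^2&\omega^2\\\omega^2&\omega&\omega^2\\\omega^2&\omega^2&\omega\end{pmatrix}$, $\mathrm{diag}(1,\omega^2,1)$. The primitive complex reflection group of order 155520 is the Shephard-Todd group $G_{32}\subset\mathrm{GL}_4(\mathbb{C})$ generated by $\mathrm{diag}(1,1,\omega^2,1)$, $\mathrm{diag}(1,\omega^2,1,1)$, $$\tfrac{\omega^2-\omega}{3}\begin{pmatrix}\omega&\omega^2&\omega^2&0\\\omega^2&\omega&\omega^2&0\\\omega^2&\omega^2&\omega&0\\0&0&0&\omega-\omega^2\end{pmatrix},\quad \tfrac{\omega^2-\omega}{3}\begin{pmatrix}\omega&-\omega^2&0&-\omega^2\\-\omega^2&\omega&0&\omega^2\\0&0&\omega-\omega^2&0\\-\omega^2&\omega^2&0&\omega\end{pmatrix}.$$ The monodromy group of a connection is the group obtained by analytic continuation of its horizontal sections along loops in the complement of its poles; it is defined up to conjugacy. Primitive means irreducible and not permuting the summands of a nontrivial direct sum decomposition. *)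

(* Defs.v *)
(* MathComp-Analysis, over the complex numbers R[i] for R : realType. *)
From HB Require Import structures.
From mathcomp Require Import all_boot all_order all_algebra.
From mathcomp Require Import all_classical all_reals all_analysis.
From mathcomp Require Import complex.

Set Implicit Arguments.
Unset Strict Implicit.
Unset Printing Implicit Defensive.

Import Order.TTheory GRing.Theory Num.Theory.
Import numFieldNormedType.Exports.

Local Open Scope classical_set_scope.
Local Open Scope complex_scope.
Local Open Scope ring_scope.

(* Typing complex numbers through this alias gives them the norm topology that
   every numClosedFieldType carries; R[i] itself has no canonical topology. *)
Definition CC (R : realType) : numClosedFieldType := R[i].

Definition omega (R : realType) : CC R :=
  cos (2 * pi / 3) +i* sin (2 * pi / 3).

Definition mx_of_rows (K : nzRingType) (n : nat) (rows : seq (seq K)) :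
    'M[K]_n :=
  \matrix_(i, j) nth 0 (nth [::] rows i) j.

Definition diag_of_seq (K : nzRingType) (n : nat) (d : seq K) : 'M[K]_n :=
  diag_mx (\row_i nth 0 d i).

Section MatrixGroups.
Context {K : fieldType} {n : nat}.

Inductive generated (S : set 'M[K]_n) : 'M[K]_n -> Prop :=
| generated_gen A : S A -> generated S A
| generated_one : generated S 1%:M
| generated_mul A B : generated S A -> generated S B -> generated S (A *m B)
| generated_inv A : generated S A -> generated S (invmx A).

Definition GL_conjugate (H G : set 'M[K]_n) : Prop :=
  exists2 P : 'M[K]_n, P \in unitmx
    & H = [set P *m g *m invmx P | g in G].

End MatrixGroups.

(* The connection Z |-> dZ + Om(x) dx . Z on the trivial bundle of rank n over
   the complement of a finite set S of poles in the affine line. *)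
Section Monodromy.
Context {R : realType} {n : nat}.
Variables (S : seq (CC R)) (Om : CC R -> 'M[CC R]_n).

(* is_derive is taken over the scalar field CC R, so this is the complex
   derivative: Z'(x) = - Om(x) Z(x). *)
Definition horizontal_at (Z : CC R -> 'cV[CC R]_n) (x : CC R) : Prop :=
  forall i : 'I_n,
    is_derive x (1 : CC R) (fun y : CC R => Z y i 0) (- (Om x *m Z x) i 0).

Definition loop_at (b : CC R) (gamma : R -> CC R) : Prop :=
  [/\ {within `[0, 1], continuous gamma},
      gamma 0 = b, gamma 1 = b
    & forall t : R, 0 <= t <= 1 -> gamma t \notin S].

(* Z t represents a germ at gamma t of a horizontal section, and the germs at
   neighbouring parameters are restrictions of one another. *)
Definition continuation (gamma : R -> CC R) (Z : R -> CC R -> 'cV[CC R]_n) :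
    Prop :=
  (forall t : R, 0 <= t <= 1 -> \forall x \near gamma t, horizontal_at (Z t) x)
  /\
  (forall t : R, 0 <= t <= 1 ->
     \forall u \near t, 0 <= u <= 1 ->
       \forall x \near gamma u, Z u x = Z t x).

(* Germs at b of horizontal sections are identified with their values at b, so
   that continuation along a loop becomes a linear map of the fibre over b,
   acting on column vectors. *)
Definition monodromy_along (b : CC R) (gamma : R -> CC R) (M : 'M[CC R]_n) :
    Prop :=
  forall v : 'cV[CC R]_n, exists Z : R -> CC R -> 'cV[CC R]_n,
    [/\ continuation gamma Z, Z 0 b = v & Z 1 b = M *m v].

Definition monodromy_group (b : CC R) : set 'M[CC R]_n :=
  [set M | exists2 gamma, loop_at b gamma & monodromy_along b gamma M].

End Monodromy.

Section ReflectionGroups.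
Variable R : realType.
Let w : CC R := omega R.

Definition G25 : set 'M[CC R]_3 :=
  generated [set A | A \in [::
    diag_of_seq 3 [:: 1; 1; w ^+ 2];
    ((w ^+ 2 - w) / 3) *: mx_of_rows 3
      [:: [:: w;      w ^+ 2; w ^+ 2];
          [:: w ^+ 2; w;      w ^+ 2];
          [:: w ^+ 2; w ^+ 2; w     ]];
    diag_of_seq 3 [:: 1; w ^+ 2; 1]]].

Definition G32 : set 'M[CC R]_4 :=
  generated [set A | A \in [::
    diag_of_seq 4 [:: 1; 1; w ^+ 2; 1];
    diag_of_seq 4 [:: 1; w ^+ 2; 1; 1];
    ((w ^+ 2 - w) / 3) *: mx_of_rows 4
      [:: [:: w;      w ^+ 2; w ^+ 2; 0         ];
          [:: w ^+ 2; w;      w ^+ 2; 0         ];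
          [:: w ^+ 2; w ^+ 2; w;      0         ];
          [:: 0;      0;      0;      w - w ^+ 2]];
    ((w ^+ 2 - w) / 3) *: mx_of_rows 4
      [:: [:: w;          - w ^+ 2; 0;          - w ^+ 2];
          [:: - w ^+ 2;   w;        0;          w ^+ 2  ];
          [:: 0;          0;        w - w ^+ 2; 0       ];
          [:: - w ^+ 2;   w ^+ 2;   0;          w       ]]]].

End ReflectionGroups.

(* The coefficient of dx in the two connection forms, without the sign.  All
   residues at infinity (minus the sum of the displayed ones) are nonzero, so
   infinity is a pole too, and the complement of the poles in the Riemann
   sphere is the affine line minus the finite poles. *)
Section Connections.
Variable R : realType.

Definition form3 (s1 : CC R) (x : CC R) : 'M[CC R]_3 :=
  (x - s1)^-1 *: mx_of_rows 3
    [:: [:: 1/3; 0; 0];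
        [:: 1/6; 0; 0];
        [:: 1/6; 0; 0]]
  + x^-1 *: mx_of_rows 3
    [:: [:: 0; 1/6; 0];
        [:: 0; 1/3; 0];
        [:: 0; 1/6; 0]]
  + (x - 1)^-1 *: mx_of_rows 3
    [:: [:: 0; 0; 1/6];
        [:: 0; 0; 1/6];
        [:: 0; 0; 1/3]].

Definition form4 (s1 s2 : CC R) (x : CC R) : 'M[CC R]_4 :=
  (x - s1)^-1 *: mx_of_rows 4
    [:: [:: 1/3; 0; 0; 0];
        [:: 1/6; 0; 0; 0];
        [:: 1/6; 0; 0; 0];
        [:: 1/6; 0; 0; 0]]
  + (x - s2)^-1 *: mx_of_rows 4
    [:: [:: 0; 1/6; 0; 0];
        [:: 0; 1/3; 0; 0];
        [:: 0; 1/6; 0; 0];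
        [:: 0; 1/6; 0; 0]]
  + x^-1 *: mx_of_rows 4
    [:: [:: 0; 0; 1/6; 0];
        [:: 0; 0; 1/6; 0];
        [:: 0; 0; 1/3; 0];
        [:: 0; 0; 1/6; 0]]
  + (x - 1)^-1 *: mx_of_rows 4
    [:: [:: 0; 0; 0; 1/6];
        [:: 0; 0; 0; 1/6];
        [:: 0; 0; 0; 1/6];
        [:: 0; 0; 0; 1/3]].

End Connections.

(* Main.v *)
(* Both systems read Z' = - B D(x) Z with D(x) = diag(1/(x - s_j)) and
   B = k (J + 1), where J is the all-one matrix and k = 1/6 or -1/6.  They are
   rigid, so their monodromy is determined by local data.  Choose a base point c
   below the poles and cut the plane along the rays from the poles away from c;
   the monodromy group is generated by the jumps M_i of a fundamental solution
   across the cuts.  Frobenius solutions at s_i show that M_i is a reflection with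
   eigenvalue zeta^2, and those at infinity that the product of the M_i differs
   from zeta by a matrix of rank at most one, where zeta is a primitive sixth root
   of unity, the jump of (x - s_i)^k.  Linear algebra shows that these conditions
   determine the tuple (M_i) up to simultaneous conjugation.  A Hurwitz transform
   of the generating reflections of G25 or G32 satisfies the same conditions.  The
   generators for the conjugate cube root of unity generate the same group, so it
   does not matter which zeta occurs. *)
Require Import Defs.
From HB Require Import structures.
From mathcomp Require Import all_boot all_order all_algebra.
From mathcomp Require Import all_classical all_reals all_analysis.
From mathcomp Require Import perm complex.
From mathcomp Require Import ring lra zify.

Set Implicit Arguments.
Unset Strict Implicit.
Unset Printing Implicit Defensive.

Import Order.TTheory GRing.Theory Num.Theory.
Import numFieldNormedType.Exports.

Local Open Scope classical_set_scope.
Local Open Scope ring_scope.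

(** * Rigidity of tuples of reflections *)

Section Rigidity.
Context {K : fieldType}.

(** Homotopy classes of loops and logarithms never appear. A fundamental matrix [F] is carried
    together with its inverse [G], which solves the dual system, and the constancy of such pairings
    along segments is the only uniqueness principle. The complement of the poles is covered by
    star-shaped charts: the plane cut along all rays, and for each pole a sector around its ray, cut
    along the complementary part. A loop is followed from chart to chart by induction on [[0, 1]],
    and a change of chart multiplies the reference germ by an element of the group generated by the
    jumps. The conditions on the jumps need no limit at a pole or at infinity: a section known up to
    a branch of a power has constant coordinates in [F] off the cuts, and these are eigenvectors of
    a jump, or of the product of all jumps. The value [1/6] enters twice. Neither [2 k] nor [n k]
    for [n <= 5] is a nonzero integer, so that the Frobenius recursions meet no zero divisor and
    produce no logarithms. Moreover the scalar jump must have order exactly six, which is what pins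
    down the normal form of the tuple. *)

Fixpoint pprod n (A : nat -> 'M[K]_n) k : 'M[K]_n :=
  if k is k'.+1 then A k' *m pprod A k' else 1%:M.

Lemma rank1_factor n (A : 'M[K]_n) (u : 'cV[K]_n) : (\rank A <= 1)%N -> u != 0 ->
  (u^T <= A^T)%MS -> exists f : 'rV[K]_n, A = u *m f.
Proof.
move=> A1 u0 uA; have ru : \rank u^T = 1%N.
  by rewrite mxrank_tr; apply/eqP; rewrite eqn_leq rank_leq_col lt0n mxrank_eq0.
have : (A^T <= u^T)%MS.
  by rewrite -(mxrank_leqif_sup uA).2 eqn_leq mxrankS//= mxrank_tr ru.
case/submxP => D AE; exists D^T; apply: trmx_inj.
by rewrite trmx_mul trmxK.
Qed.

(** The matrix [U] sends row vectors killed by [c + U Y] to row vectors killed by [c + Y U]. It does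
    so injectively, because a further multiplication by [Y] is then multiplication by [- c]. *)
Lemma rank_swap n (c : K) (U Y : 'M[K]_n) : c != 0 ->
  (\rank (c%:M + Y *m U)%R <= \rank (c%:M + U *m Y)%R)%N.
Proof.
move=> c0; set A := c%:M + U *m Y; set A' := c%:M + Y *m U.
have h1 : (kermx A *m U <= kermx A')%MS.
  apply/sub_kermxP; rewrite -mulmxA.
  have -> : U *m A' = A *m U.
    by rewrite /A /A' mulmxDr mulmxDl mul_scalar_mx mul_mx_scalar mulmxA.
  by rewrite mulmxA mulmx_ker mul0mx.
have h2 : kermx A *m U *m Y = (- c) *: kermx A.
  have := mulmx_ker A; rewrite /A mulmxDr mul_mx_scalar mulmxA => /eqP.
  by rewrite addrC addr_eq0 scaleNr => /eqP.
have h3 : (\rank (kermx A) <= \rank (kermx A'))%N.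
  apply: leq_trans (mxrankS h1); apply: leq_trans (mxrankM_maxl _ Y).
  by rewrite h2 mxrank_scale_nz// oppr_eq0.
move: h3; rewrite !mxrank_ker; have := rank_leq_row A; have := rank_leq_row A'; lia.
Qed.

Lemma delta_row n l (A : 'M[K]_(n, l)) i j w :
  (delta_mx i i *m A) j w = (j == i)%:R * A i w.
Proof.
rewrite mxE (bigD1 i)//= big1 ?addr0; last first.
  by move=> q qi; rewrite mxE (negbTE qi) andbF mul0r.
by rewrite mxE eqxx andbT.
Qed.

Section Tuple.
Variable m : nat.
Local Notation n := m.+1.
Variable zeta : K.
Hypothesis zeta6 : zeta ^+ 2 - zeta + 1 = 0.

(** The pairings [f i u j] of reflections [1 + u i f i] after a rescaling of the [u i]. The entry
    [zeta ^+ 2] below the diagonal is [- 1 / zeta], as [zeta ^+ 3 = -1]. In [std_tuple] the [u i]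
    are the standard basis. *)
Definition std_gram : 'M[K]_n :=
  \matrix_(i, j) if (i < j)%N then -1 else if i == j then zeta ^+ 2 - 1 else zeta ^+ 2.

Definition std_tuple (i : 'I_n) : 'M[K]_n := 1%:M + delta_mx i i *m std_gram.

Hypothesis zeta2 : zeta ^+ 2 != 1.
Hypothesis gram_unit : std_gram \in unitmx.

Definition reflection_tuple (M : 'I_n -> 'M[K]_n) :=
  [/\ forall i, (\rank (M i - 1%:M)%R <= 1)%N,
   forall i, exists2 k : 'cV[K]_n, k != 0 & M i *m k = zeta ^+ 2 *: k &
   (\rank (pprod (fun j => M (inord j)) n - zeta%:M)%R <= 1)%N].

(* With M_i = 1 + u_i f_i, the rank condition on the product becomes, by
   [rank_swap], a rank condition on a matrix built from the entries f_i u_j, which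
   determines them up to rescaling the u_i; invertibility makes (u_i) a basis. *)
Theorem reflection_tuple_std M : reflection_tuple M ->
  exists2 T, T \in unitmx & forall i, M i = T *m std_tuple i *m invmx T.
Proof.
move=> [M1 Mk Mz].
have z0 : zeta != 0.
  by apply/eqP => z; move: zeta6; rewrite z expr0n subrr add0r => /eqP; rewrite oner_eq0.
have zE : zeta ^+ 2 = zeta - 1.
  by apply/eqP; rewrite -subr_eq0 opprB addrA addrAC zeta6.
have z1 : 1 - zeta != 0.
  by rewrite -oppr_eq0 opprB -zE expf_neq0.
have q1 : zeta ^+ 2 - 1 != 0 by rewrite subr_eq0.
have /choice[u hu] i : exists k : 'cV[K]_n, k != 0 /\ M i *m k = zeta ^+ 2 *: k.
  by have [k k0 e] := Mk i; exists k.
have /choice[f hf] i : exists f : 'rV[K]_n, M i - 1%:M = u i *m f.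
  have [u0 e] := hu i; apply: rank1_factor => //.
  have e' : (M i - 1%:M) *m u i = (zeta ^+ 2 - 1) *: u i.
    by rewrite mulmxBl mul1mx e scalerBl scale1r.
  apply/submxP; exists ((zeta ^+ 2 - 1)^-1 *: (u i)^T).
  by rewrite -scalemxAl -trmx_mul e' linearZ /= scalerA mulVf// scale1r.
pose U : 'M[K]_n := \matrix_(a, j) u j a 0.
pose Fm : 'M[K]_n := \matrix_(i, b) f i 0 b.
have ME i : M i = 1%:M + U *m (delta_mx i i *m Fm).
  rewrite -[LHS](subrK 1%:M) hf addrC; congr (_ + _).
  apply/matrixP => a b; rewrite !mxE big_ord1 (bigD1 i)//= big1 ?addr0.
    by rewrite delta_row eqxx mul1r !mxE.
  by move=> j ji; rewrite delta_row (negbTE ji) mul0r mulr0.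
pose G := Fm *m U.
have Gii i : G i i = zeta ^+ 2 - 1.
  have [u0 e] := hu i.
  have : u i *m (f i *m u i) = (zeta ^+ 2 - 1) *: u i.
    by rewrite mulmxA -hf mulmxBl mul1mx e scalerBl scale1r.
  rewrite [f i *m u i]mx11_scalar mul_mx_scalar => /eqP.
  rewrite -subr_eq0 -scalerBl scaler_eq0 (negbTE u0) orbF subr_eq0 => /eqP <-.
  by rewrite !mxE; apply: eq_bigr => j _; rewrite !mxE.
pose L : 'M[K]_n := \matrix_(i, j) if (j < i)%N then G i j else 0.
(* When the product is multiplied out as [1 + U Y], row [i] of [Y] is [f i] times the product of the
   factors of index below [i]. Only the pairings [G i j] with [j < i] enter, hence the recursion
   through [L]. *)
have [Y [YP YL]] : exists Y, pprod (fun j => M (inord j)) n = 1%:M + U *m Y /\ Y = Fm + L *m Y.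
  pose Ys := fix Ys k : 'M[K]_n := if k is k'.+1 then
    Ys k' + delta_mx (inord k') (inord k') *m (Fm + G *m Ys k') else 0.
  have YsP k : pprod (fun j => M (inord j)) k = 1%:M + U *m Ys k.
    elim: k => [|k IH]; first by rewrite /= mulmx0 addr0.
    rewrite [LHS]/= [Ys _]/= ME IH mulmxDl mul1mx -addrA; congr (_ + _).
    rewrite [RHS]mulmxDr; congr (_ + _).
    by rewrite -!mulmxA mulmxDr mulmx1 [Fm *m (U *m _)]mulmxA.
  have Ysrow k (i : 'I_n) j : (k <= n)%N -> Ys k i j = if (i < k)%N then (Fm + G *m Ys i) i j else 0.
    elim: k => [|k IH] kn; first by rewrite /= mxE.
    rewrite [Ys k.+1]/= mxE IH ?(ltnW kn)// delta_row -val_eqE /= inordK// ltnS.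
    case: ltngtP => [ik|ki|ik]; rewrite ?mul0r ?addr0 ?mul1r ?add0r//.
    have -> : inord k = i by apply: val_inj; rewrite /= inordK.
    by rewrite -ik.
  exists (Ys n); split=> //.
  apply/matrixP => i j; rewrite Ysrow// ltn_ord !mxE; congr (_ + _).
  apply: eq_bigr => a _; rewrite Ysrow ?(ltnW (ltn_ord i))// Ysrow// ltn_ord [L i a]mxE.
  by case: ltnP => _; rewrite ?mulr0 ?mul0r.
have LG : (1%:M - L) *m (Y *m U) = G.
  by rewrite mulmxA mulmxBl mul1mx {1}YL addrK.
(* The factor [1 - L] eliminates [Y]: what remains is [(1 - zeta) (1 - L) + G], explicit in the
   pairings. Its diagonal is [zeta ^+ 2 - zeta = -1]. *)
pose X := (1%:M - L) *m ((1 - zeta)%:M + Y *m U).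
have X1 : (\rank X <= 1)%N.
  apply: leq_trans (mxrankM_maxr _ _) _; apply: leq_trans (rank_swap U Y z1) _.
  move: Mz; rewrite YP; congr (\rank _ <= 1)%N.
  by rewrite raddfB /= addrAC.
have XE i j : X i j = if (j < i)%N then zeta * G i j else if i == j then -1 else G i j.
  rewrite /X mulmxDr LG mul_mx_scalar mxE.
  have -> : ((1 - zeta) *: (1%:M - L)) i j =
      (1 - zeta) * ((i == j)%:R - (if (j < i)%N then G i j else 0)).
    by rewrite mxE; congr (_ * _); rewrite mxE [X in X + _]mxE [X in _ + X]mxE [L i j]mxE.
  rewrite -val_eqE /=.
  case: ltngtP => [ij|ij|ij]; rewrite /= ?mulr1n ?mulr0n; try by ring.
  have <- : i = j by apply: val_inj.
  by rewrite Gii zE; ring.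
have X0 : col ord0 X != 0.
  by apply/eqP => /matrixP/(_ ord0 ord0)/eqP; rewrite mxE [X in _ == X]mxE XE ltnn eqxx oppr_eq0 oner_eq0.
have [r Xr] : exists r, X = col ord0 X *m r.
  by apply: rank1_factor => //; rewrite tr_col row_sub.
pose x i := X i ord0.
have Xx i j : X i j = x i * r 0 j by rewrite {1}Xr mxE big_ord1 mxE.
have xr i : x i * r 0 i = -1 by rewrite -Xx XE ltnn eqxx.
have x0 i : x i != 0.
  by apply: contra_eq_neq (xr i) => ->; rewrite mul0r eq_sym oppr_eq0 oner_eq0.
have rE i : r 0 i = - (x i)^-1.
  by apply: (mulfI (x0 i)); rewrite xr mulrN mulfV.
(* Rank one and diagonal entries [-1] force [X i j = - x i / x j]. The [x i] are thus the only
   freedom left, and conjugation by [D] removes it. *)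
pose D := diag_mx (\row_i x i).
pose D' := diag_mx (\row_i (x i)^-1).
have DD' : D *m D' = 1%:M.
  rewrite mulmx_diag (_ : \row_j _ = const_mx 1) ?diag_const_mx//.
  by apply/rowP => j; rewrite !mxE mulfV.
have D'D := mulmx1C DD'.
have GD : G = D *m std_gram *m D'.
  apply/matrixP => i j.
  have -> : (D *m std_gram *m D') i j = x i * std_gram i j * (x j)^-1.
    by rewrite mul_mx_diag mxE mul_diag_mx !mxE.
  rewrite [std_gram i j]mxE -val_eqE.
  have := XE i j; rewrite Xx rE -val_eqE /=; case: ltngtP => [ij|ij|ij] /= e.
  - apply: (mulfI z0); rewrite -e.
    have -> : zeta * (x i * zeta ^+ 2 / x j) = zeta ^+ 3 * (x i / x j) by ring.
    have -> : zeta ^+ 3 = -1 by rewrite exprS zE mulrBr mulr1 -expr2 zE; ring.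
    by ring.
  - by rewrite -e; ring.
  - have <- : i = j by apply: val_inj; rewrite /= ij.
    by rewrite Gii; field; apply: x0.
have uD : D \in unitmx by case/mulmx1_unit: DD'.
have uD' : D' \in unitmx by case/mulmx1_unit: DD'.
have uG : G \in unitmx by rewrite GD !unitmx_mul uD gram_unit.
have uU : U \in unitmx by move: uG; rewrite unitmx_mul => /andP[].
exists (U *m D); first by rewrite unitmx_mul uU.
move=> i; apply: (canRL (mulmxK _)); first by rewrite unitmx_mul uU.
rewrite ME /std_tuple mulmxDl mulmxDr mul1mx mulmx1; congr (_ + _).
rewrite -!mulmxA; congr (_ *m _).
have -> : Fm *m (U *m D) = D *m std_gram by rewrite mulmxA -/G GD -!mulmxA D'D mulmx1.
rewrite !mulmxA; congr (_ *m _).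
apply/matrixP => a b; rewrite mul_mx_diag mul_diag_mx !mxE.
case: (eqVneq a i) => [->|]; rewrite ?mul0r ?mulr0//=.
by case: (eqVneq b i) => [->|]; rewrite ?mul0r ?mulr0// mulrC.
Qed.

End Tuple.
End Rigidity.

(** * Conjugacy of generated groups *)

Section Conjugation.
Context {K : fieldType} {n : nat}.
Implicit Types (S T : set 'M[K]_n) (A P : 'M[K]_n).

Lemma generated_sub S T : (forall A, S A -> generated T A) ->
  forall A, generated S A -> generated T A.
Proof.
move=> ST A; elim=> {A} [A /ST//| |A B _ ? _ ?|A _ ?].
- exact: generated_one.
- exact: generated_mul.
- exact: generated_inv.
Qed.

Lemma invmx_conj P A : P \in unitmx ->
  invmx (P *m A *m invmx P) = P *m invmx A *m invmx P.
Proof.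
(* Generators are not assumed invertible; [invmx] fixes singular matrices, so the formula survives
   in that case. *)
move=> uP; have [uA|nA] := boolP (A \in unitmx); last first.
  rewrite /invmx (negbTE nA) -/(invmx P) ifN//.
  by rewrite !unitmx_mul unitmx_inv uP andbT.
have e : P *m A *m invmx P *m (P *m invmx A *m invmx P) = 1%:M.
  by rewrite !mulmxA mulmxKV// -[_ *m A *m _]mulmxA mulmxV// mulmx1 mulmxV.
rewrite -[RHS]mul1mx -[in RHS](mulVmx (proj1 (mulmx1_unit e))) -[RHS]mulmxA e.
by rewrite mulmx1.
Qed.

Lemma generated_conj P S A : P \in unitmx -> generated S A ->
  generated [set P *m g *m invmx P | g in S] (P *m A *m invmx P).
Proof.
move=> uP; elim=> {A} [A SA| |A B _ hA _ hB|A _ hA].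
- by apply: generated_gen; exists A.
- by rewrite mulmx1 mulmxV//; exact: generated_one.
- have := generated_mul hA hB; congr (generated _ _).
  by rewrite !mulmxA mulmxKV.
- by rewrite -invmx_conj//; exact: generated_inv.
Qed.

Lemma GL_conjugate_generated P S : P \in unitmx ->
  GL_conjugate (generated [set P *m g *m invmx P | g in S]) (generated S).
Proof.
move=> uP; exists P => //; apply/seteqP; split=> A; last first.
  by move=> [g Sg <-]; exact: generated_conj.
have uP' : invmx P \in unitmx by rewrite unitmx_inv.
move=> /(generated_conj uP') h; exists (invmx P *m A *m P).
  move: h; rewrite invmxK; apply: generated_sub => B [_ [g Sg <-] <-].
  by rewrite !mulmxA mulVmx// mul1mx mulmxKV//; exact: generated_gen.
by rewrite !mulmxA mulmxV// mul1mx mulmxK.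
Qed.

Lemma GL_conjugate_trans S T U : GL_conjugate S T -> GL_conjugate T U -> GL_conjugate S U.
Proof.
move=> [P uP ->] [Q uQ ->]; exists (P *m Q); first by rewrite unitmx_mul uP.
have uPQ : P *m Q \in unitmx by rewrite unitmx_mul uP.
have e A : P *m (Q *m A *m invmx Q) *m invmx P = P *m Q *m A *m invmx (P *m Q).
  suff -> : invmx (P *m Q) = invmx Q *m invmx P by rewrite !mulmxA.
  by rewrite -[RHS]mul1mx -(mulVmx uPQ) -!mulmxA mulKVmx// mulmxV// mulmx1.
apply/seteqP; split=> A.
  by move=> [_ [g Ug <-] <-]; exists g.
by move=> [g Ug <-]; exists (Q *m g *m invmx Q) => //; exists g.
Qed.

End Conjugation.

(** * Tuples in groups generated by reflections of order 3 *)

Section ComplexReflections.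
Context {K : fieldType} {n : nat}.
Implicit Types (p : 'cV[K]_n) (ps : seq 'cV[K]_n).

(** The symmetric form [p^T *m p] stands in for the Hermitian one. The roots used below have entries
    0, 1 and -1, so the two agree on them, and everything makes sense over any field. *)
Definition crefl p (a : K) : 'M[K]_n :=
  1%:M + ((a - 1) / (p^T *m p) 0 0) *: (p *m p^T).

Definition anisotropic p := (p^T *m p) 0 0 != 0.

Lemma mx11E (A : 'M[K]_1) : A = (A 0 0)%:M.
Proof. by rewrite -mx11_scalar. Qed.

Lemma creflM p a b : anisotropic p -> crefl p a *m crefl p b = crefl p (a * b).
Proof.
move=> p0; rewrite /crefl mulmxDl mul1mx mulmxDr mulmx1 -scalemxAl -scalemxAr.
have -> : p *m p^T *m (p *m p^T) = (p^T *m p) 0 0 *: (p *m p^T).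
  by rewrite mulmxA -[_ *m p]mulmxA [p^T *m p in LHS]mx11E mul_mx_scalar -scalemxAl.
rewrite !scalerA -!addrA -!scalerDl; congr (_ + _ *: _).
by move: p0; rewrite /anisotropic; set q := (_ *m _) 0 0 => q0; field.
Qed.

Lemma crefl1 p : crefl p 1 = 1%:M.
Proof. by rewrite /crefl subrr mul0r scale0r addr0. Qed.

Definition is_reflection (a : K) (A : 'M[K]_n) :=
  (\rank (A - 1%:M)%R <= 1)%N /\ exists2 k : 'cV[K]_n, k != 0 & A *m k = a *: k.

Lemma crefl_reflection p a : anisotropic p -> is_reflection a (crefl p a).
Proof.
move=> p0; split.
  rewrite /crefl addrC addKr; apply: leq_trans (mxrank_scale _ _) _.
  by apply: leq_trans (mxrankM_maxl _ _) _; exact: rank_leq_col.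
exists p.
  by apply: contraNneq p0 => ->; rewrite mulmx0 mxE.
rewrite /crefl mulmxDl mul1mx -scalemxAl -mulmxA [p^T *m p]mx11E mul_mx_scalar.
rewrite scalerA -[X in X + _]scale1r -scalerDl [_%:M 0 0]mxE eqxx mulr1n divfK//.
by rewrite addrC subrK.
Qed.

Lemma reflection_conj a A L L' : L' *m L = 1%:M -> is_reflection a A ->
  is_reflection a (L *m A *m L').
Proof.
move=> LL [rA [k k0 Ak]]; have LL' := mulmx1C LL; split.
  have -> : L *m A *m L' - 1%:M = L *m (A - 1%:M) *m L'.
    by rewrite mulmxBr mulmxBl mulmx1 LL'.
  apply: leq_trans (mxrankM_maxl _ _) _; exact: leq_trans (mxrankM_maxr _ _) rA.
exists (L *m k).
  by apply: contraNneq k0 => Lk; rewrite -[k]mul1mx -LL -mulmxA Lk mulmx0.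
by rewrite -mulmxA [L' *m _]mulmxA LL mul1mx -mulmxA Ak scalemxAr.
Qed.

Variable w : K.
Hypothesis w3 : w ^+ 3 = 1.

(* For reflections L_p = crefl p (w^-1), written with w^-1 = w^2: each step
   conjugates the tail by L_p and puts L_p^-1 in front, so that the product of the
   tuple telescopes to [coxprod]. *)
Fixpoint chain ps : seq 'M[K]_n :=
  if ps is p :: ps' then
    crefl p w :: [seq crefl p (w ^+ 2) *m A *m crefl p w | A <- chain ps']
  else [::].

(** For [L_p = crefl p (w ^+ 2)] this is the palindrome [L_1 ... L_n L_n ... L_1], which can be
    computed from the inside out. *)
Definition coxprod ps : 'M[K]_n :=
  foldr (fun p P => crefl p (w ^+ 2) *m P *m crefl p (w ^+ 2)) 1%:M ps.

Lemma crefl_inv p : anisotropic p -> crefl p w *m crefl p (w ^+ 2) = 1%:M.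
Proof. by move=> p0; rewrite creflM// -exprS w3 crefl1. Qed.

Lemma size_chain ps : size (chain ps) = size ps.
Proof. by elim: ps => //= p ps IH; rewrite size_map IH. Qed.

Lemma chain_reflection ps : {in ps, forall p, anisotropic p} ->
  {in chain ps, forall A, is_reflection w A}.
Proof.
elim: ps => [//|p ps IH] h A /=; have p0 := h p (mem_head _ _).
rewrite inE => /predU1P[->|/mapP[A' A'c ->]]; first exact: crefl_reflection.
apply: reflection_conj; first exact: crefl_inv.
by apply: IH => // q qs; apply: h; rewrite inE qs orbT.
Qed.

Lemma pprodSr (A : nat -> 'M[K]_n) k :
  pprod A k.+1 = pprod (fun j => A j.+1) k *m A 0%N.
Proof.
elim: k => [|k IH]; first by rewrite /= mulmx1 mul1mx.
by rewrite -[LHS]/(A k.+1 *m pprod A k.+1) IH mulmxA.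
Qed.

Lemma eq_pprod (A B : nat -> 'M[K]_n) k : (forall j, (j < k)%N -> A j = B j) ->
  pprod A k = pprod B k.
Proof.
elim: k => //= k IH h; rewrite h// IH// => j jk; apply: h; exact: ltnW.
Qed.

Lemma pprod_conj (A : nat -> 'M[K]_n) (L L' : 'M[K]_n) k : L' *m L = 1%:M ->
  pprod (fun j => L *m A j *m L') k = L *m pprod A k *m L'.
Proof.
move=> LL; have LL' : L *m L' = 1%:M := mulmx1C LL; elim: k => /= [|k ->].
  by rewrite mulmx1 LL'.
by rewrite !mulmxA -[L *m A k *m L' *m L]mulmxA LL mulmx1.
Qed.

Lemma pprod_chain ps : {in ps, forall p, anisotropic p} ->
  pprod (nth 1%:M (chain ps)) (size ps) = coxprod ps.
Proof.
elim: ps => [//|p ps IH] h; have p0 := h p (mem_head _ _).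
rewrite [size _]/= pprodSr /= -IH; last by move=> q qs; apply: h; rewrite inE qs orbT.
rewrite (@eq_pprod _ (fun j => crefl p (w ^+ 2) *m nth 1%:M (chain ps) j *m crefl p w)).
  rewrite pprod_conj; last exact: crefl_inv.
  by rewrite -mulmxA creflM// -expr2.
by move=> j js; rewrite (nth_map 1%:M)// size_chain.
Qed.

(** Each step conjugates the tail by a reflection whose inverse has just been put into the list, so
    the conjugation can be undone inside the group, one root at a time. *)
Lemma generated_chain ps : {in ps, forall p, anisotropic p} ->
  generated [set A | A \in chain ps] = generated [set crefl p w | p in [set p | p \in ps]].
Proof.
move=> h; apply/seteqP; split; apply: generated_sub.
  elim: ps h => [//|p ps IH] h A /=.
  have IH' : forall A, A \in chain ps ->
      generated [set crefl p0 w | p0 in [set p0 | p0 \in p :: ps]] A.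
    have hps : {in ps, forall p, anisotropic p}.
      by move=> q qs; apply: h; rewrite inE qs orbT.
    move=> A' /(IH hps); apply: generated_sub => B [q /= qs <-].
    by apply: generated_gen; exists q => //=; rewrite inE qs orbT.
  have gp : generated [set crefl p0 w | p0 in [set p0 | p0 \in p :: ps]] (crefl p w).
    by apply: generated_gen; exists p => //=; rewrite mem_head.
  have p0 := h p (mem_head _ _).
  rewrite inE => /predU1P[->//|/mapP[A' /IH' gA' ->]].
  apply: generated_mul => //; apply: generated_mul => //.
  by rewrite expr2 -creflM//; exact: generated_mul.
move=> _ [p /= ps' <-]; elim: ps h ps' => [//|q ps IH] h; have q0 := h q (mem_head _ _).
have gq : generated [set A | A \in chain (q :: ps)] (crefl q w).
  by apply: generated_gen; rewrite /= mem_head.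
rewrite inE => /predU1P[->//|pps].
have {}IH := IH (fun r rs => h r (mem_behead (s := q :: ps) rs)) pps.
move: IH gq; set G := generated _; set G' := generated _.
move=> Gp gq; have gq2 : G' (crefl q (w ^+ 2)).
  by rewrite expr2 -creflM//; exact: generated_mul.
have invq := crefl_inv q0; have [uq uq'] := mulmx1_unit invq.
have invq' : invmx (crefl q (w ^+ 2)) = crefl q w.
  by rewrite -[LHS]mul1mx -invq mulmxK.
have key : G' (crefl q (w ^+ 2) *m crefl p w *m crefl q w).
  rewrite -[X in _ *m X]invq'; move: (generated_conj uq' Gp); apply: generated_sub => _ [A cA <-].
  by apply: generated_gen; rewrite /= inE invq'; apply/orP; right; exact: map_f.
have := generated_mul (generated_mul gq key) gq2.
rewrite !mulmxA crefl_inv// mul1mx -mulmxA crefl_inv// mulmx1; exact.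
Qed.

End ComplexReflections.

Lemma chain_reflection_tuple (K : fieldType) m (zeta : K) (ps : seq 'cV[K]_m.+1) :
  zeta ^+ 2 - zeta + 1 = 0 -> size ps = m.+1 -> {in ps, forall p, anisotropic p} ->
  (\rank (coxprod (zeta ^+ 2) ps - zeta%:M)%R <= 1)%N ->
  reflection_tuple zeta (fun i => nth 1%:M (chain (zeta ^+ 2) ps) i).
Proof.
move=> z6 sps h rk; have w3 : (zeta ^+ 2) ^+ 3 = 1.
  apply/eqP; rewrite -subr_eq0; apply/eqP.
  transitivity ((zeta ^+ 2 - zeta + 1) * ((zeta + 1) * (zeta ^+ 3 - 1))); [ring|by rewrite z6 mul0r].
have hr i : is_reflection (zeta ^+ 2) (nth 1%:M (chain (zeta ^+ 2) ps) i) \/ (size ps <= i)%N.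
  have [is'|is'] := ltnP i (size ps); last by right.
  by left; apply: (chain_reflection w3 h); rewrite mem_nth// size_chain.
have {}hr (i : 'I_m.+1) : is_reflection (zeta ^+ 2) (nth 1%:M (chain (zeta ^+ 2) ps) i).
  by case: (hr i) => //; rewrite sps leqNgt ltn_ord.
split=> [i|i|]; [by case: (hr i)|by case: (hr i)|].
move: rk; rewrite -(pprod_chain w3 h) sps => rk.
rewrite (@eq_pprod _ _ _ (nth 1%:M (chain (zeta ^+ 2) ps)))// => j jm.
by rewrite inordK.
Qed.

(** * The roots of G25 and G32 and explicit computations with their reflections *)

Section Roots.
Context {K : fieldType}.
Definition vec n (v : seq K) : 'cV[K]_n := \col_i nth 0 v i.
(** The roots of the generating reflections, here and in [roots4], are listed along the linear
    diagram of the group: two of them are non-orthogonal exactly when they are neighbours in the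
    list. It is in this order that the palindrome [coxprod] differs from a scalar by rank one. *)
Definition roots3 := [seq vec 3 v | v <- [:: [:: 0; 1; 0]; [:: 1; 1; 1]; [:: 0; 0; 1]]].
Definition roots4 := [seq vec 4 v | v <-
  [:: [:: 1; -1; 0; -1]; [:: 0; 1; 0; 0]; [:: 1; 1; 1; 0]; [:: 0; 0; 1; 0]]].

Hypothesis K3 : 3%:R != 0 :> K.
Lemma roots3_anisotropic : {in roots3, forall p, anisotropic p}.
Proof.
move=> p; rewrite !inE => /or3P[] /eqP ->; rewrite /anisotropic mxE !big_ord_recl big_ord0 !mxE /=;
  rewrite ?mulr0 ?mulr1 ?add0r ?addr0 ?oner_eq0//; by move: K3; congr (_ != _); ring.
Qed.

Lemma roots4_anisotropic : {in roots4, forall p, anisotropic p}.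
Proof.
move=> p; rewrite !inE => /or4P[] /eqP ->; rewrite /anisotropic mxE !big_ord_recl big_ord0 !mxE /=;
  rewrite ?mulr0 ?mulr1 ?add0r ?addr0 ?oner_eq0//; by move: K3; congr (_ != _); ring.
Qed.

Variable w : K.
Hypothesis ww : w ^+ 2 = - 1 - w.

Lemma crefl3E a :
  [/\ crefl (vec 3 [:: 0; 1; 0]) a = mx_of_rows 3 [:: [:: 1; 0; 0]; [:: 0; a; 0]; [:: 0; 0; 1]],
   crefl (vec 3 [:: 0; 0; 1]) a = mx_of_rows 3 [:: [:: 1; 0; 0]; [:: 0; 1; 0]; [:: 0; 0; a]] &
   crefl (vec 3 [:: 1; 1; 1]) a = mx_of_rows 3 [:: [:: (a + 2) / 3; (a - 1) / 3; (a - 1) / 3];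
     [:: (a - 1) / 3; (a + 2) / 3; (a - 1) / 3]; [:: (a - 1) / 3; (a - 1) / 3; (a + 2) / 3]]].
Proof.
split; apply/matrixP => i j; rewrite !mxE !big_ord_recl !big_ord0 !mxE;
  case: i => [[|[|[|//]]] hi]; case: j => [[|[|[|//]]] hj];
  by rewrite /= ?mulr1n ?mulr0n; field; rewrite ?oner_eq0 ?K3.
Qed.

Lemma crefl4E a : let b := (a + 2) / 3 in let d := (a - 1) / 3 in
  [/\ crefl (vec 4 [:: 0; 1; 0; 0]) a = mx_of_rows 4
        [:: [:: 1; 0; 0; 0]; [:: 0; a; 0; 0]; [:: 0; 0; 1; 0]; [:: 0; 0; 0; 1]],
   crefl (vec 4 [:: 0; 0; 1; 0]) a = mx_of_rows 4
        [:: [:: 1; 0; 0; 0]; [:: 0; 1; 0; 0]; [:: 0; 0; a; 0]; [:: 0; 0; 0; 1]],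
   crefl (vec 4 [:: 1; 1; 1; 0]) a = mx_of_rows 4
        [:: [:: b; d; d; 0]; [:: d; b; d; 0]; [:: d; d; b; 0]; [:: 0; 0; 0; 1]] &
   crefl (vec 4 [:: 1; -1; 0; -1]) a = mx_of_rows 4
        [:: [:: b; -d; 0; -d]; [:: -d; b; 0; d]; [:: 0; 0; 1; 0]; [:: -d; d; 0; b]]].
Proof.
move=> b d; split; apply/matrixP => i j; rewrite !mxE !big_ord_recl !big_ord0 !mxE;
  case: i => [[|[|[|[|//]]]] hi]; case: j => [[|[|[|[|//]]]] hj];
  by rewrite /= ?mulr1n ?mulr0n /b /d; field; rewrite ?oner_eq0 ?K3.
Qed.

(** For [w = zeta ^+ 2] the scalar [w + 1] is [zeta], so the right-hand side displays the rank
    condition at infinity as a column times a row. The palindrome is evaluated from the inside, and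
    each layer is replaced by a sparse matrix before the next one is multiplied on. *)
Lemma coxprod_roots3 : coxprod w roots3 - (w + 1)%:M =
  vec 3 [:: 1; -1; 0] *m (vec 3 [:: - (w + 1); w + 1; 0])^T.
Proof.
rewrite /coxprod /= mulmx1; have [-> -> ->] := crefl3E (w ^+ 2).
have -> : mx_of_rows 3 [:: [:: 1; 0; 0]; [:: 0; 1; 0]; [:: 0; 0; w ^+ 2]] *m
   mx_of_rows 3 [:: [:: 1; 0; 0]; [:: 0; 1; 0]; [:: 0; 0; w ^+ 2]] =
   mx_of_rows 3 [:: [:: 1; 0; 0]; [:: 0; 1; 0]; [:: 0; 0; w]].
  apply/matrixP => i j; rewrite !mxE !big_ord_recl !big_ord0 !mxE;
  case: i => [[|[|[|//]]] hi]; case: j => [[|[|[|//]]] hj]; by rewrite /=; ring: ww.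
set L1 := mx_of_rows _ [:: _; _; [:: (w^+ 2 - 1) / 3; _; _]].
have e : L1 *m mx_of_rows 3 [:: [:: 1; 0; 0]; [:: 0; 1; 0]; [:: 0; 0; w]] *m L1 =
   mx_of_rows 3 [:: [:: 0; -1; 0]; [:: -1; 0; 0]; [:: 0; 0; w + 1]].
  apply/matrixP => i j; rewrite !mxE !big_ord_recl !big_ord0 !mxE !big_ord_recl !big_ord0 !mxE.
  by case: i => [[|[|[|//]]] hi]; case: j => [[|[|[|//]]] hj]; rewrite /=; field: ww.
rewrite e; apply/matrixP => i j; rewrite !mxE !big_ord_recl !big_ord0 !mxE !big_ord_recl !big_ord0 !mxE.
by case: i => [[|[|[|//]]] hi]; case: j => [[|[|[|//]]] hj]; rewrite /= ?mulr1n ?mulr0n; ring: ww.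
Qed.
End Roots.

Section Roots.
Context {K : fieldType}.
Hypothesis K3 : 3%:R != 0 :> K.
Variable w : K.
Hypothesis ww : w ^+ 2 = - 1 - w.

Lemma coxprod_roots4 : coxprod w roots4 - (w + 1)%:M =
  vec 4 [:: 0; 0; 0; 1] *m (vec 4 [:: 0; 0; 0; - 1 - w *+ 2])^T.
Proof.
rewrite /coxprod /= mulmx1; have [-> -> -> ->] := crefl4E K3 (w ^+ 2).
have -> : mx_of_rows 4 [:: [:: 1; 0; 0; 0]; [:: 0; 1; 0; 0]; [:: 0; 0; w ^+ 2; 0]; [:: 0; 0; 0; 1]] *m
   mx_of_rows 4 [:: [:: 1; 0; 0; 0]; [:: 0; 1; 0; 0]; [:: 0; 0; w ^+ 2; 0]; [:: 0; 0; 0; 1]] =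
   mx_of_rows 4 [:: [:: 1; 0; 0; 0]; [:: 0; 1; 0; 0]; [:: 0; 0; w; 0]; [:: 0; 0; 0; 1]].
  apply/matrixP => i j; rewrite !mxE !big_ord_recl !big_ord0 !mxE;
  case: i => [[|[|[|[|//]]]] hi]; case: j => [[|[|[|[|//]]]] hj]; by rewrite /=; ring: ww.
set L1 := mx_of_rows _ [:: [:: _; _; (w ^+ 2 - 1) / 3; _]; _; _; _].
have -> : L1 *m mx_of_rows 4 [:: [:: 1; 0; 0; 0]; [:: 0; 1; 0; 0]; [:: 0; 0; w; 0]; [:: 0; 0; 0; 1]] *m L1 =
   mx_of_rows 4 [:: [:: 0; -1; 0; 0]; [:: -1; 0; 0; 0]; [:: 0; 0; w + 1; 0]; [:: 0; 0; 0; 1]].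
  apply/matrixP => i j; rewrite !mxE !big_ord_recl !big_ord0 !mxE !big_ord_recl !big_ord0 !mxE.
  by case: i => [[|[|[|[|//]]]] hi]; case: j => [[|[|[|[|//]]]] hj]; rewrite /=; field: ww.
set L2 := mx_of_rows _ [:: [:: 1; _; _; _]; _; _; _].
set X := _ *m mx_of_rows 4 [:: [:: 0; -1; 0; 0]; _; _; _] *m _.
have -> : X = mx_of_rows 4
  [:: [:: 0; w + 1; 0; 0]; [:: w + 1; 0; 0; 0]; [:: 0; 0; w + 1; 0]; [:: 0; 0; 0; 1]].
  apply/matrixP => i j; rewrite !mxE !big_ord_recl !big_ord0 !mxE !big_ord_recl !big_ord0 !mxE.
  by case: i => [[|[|[|[|//]]]] hi]; case: j => [[|[|[|[|//]]]] hj]; rewrite /=; ring: ww.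
apply/matrixP => i j; rewrite !mxE !big_ord_recl !big_ord0 !mxE !big_ord_recl !big_ord0 !mxE.
by case: i => [[|[|[|[|//]]]] hi]; case: j => [[|[|[|[|//]]]] hj]; rewrite /= ?mulr1n ?mulr0n; field: ww.
Qed.

Lemma std_gram3_unit zeta : zeta ^+ 2 = w -> std_gram 2 zeta \in unitmx.
Proof.
move=> zw; have e : std_gram 2 zeta *m (3^-1 *: mx_of_rows 3
   [:: [:: -4-2*w; 1+2*w; 2+w]; [:: 1-w; -4-2*w; 1+2*w]; [:: 2+w; 1-w; -4-2*w]]) = 1%:M.
  apply/matrixP => i j; rewrite /std_gram zw !mxE !big_ord_recl !big_ord0 !mxE.
  by case: i => [[|[|[|//]]] hi]; case: j => [[|[|[|//]]] hj]; rewrite /= ?mulr1n ?mulr0n; field: ww.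
by case: (mulmx1_unit e).
Qed.

Lemma std_gram4_unit zeta : zeta ^+ 2 = w -> std_gram 3 zeta \in unitmx.
Proof.
move=> zw; have e : std_gram 3 zeta *m mx_of_rows 4
   [:: [:: -2-w; w; 1+w; 1]; [:: -w; -2-w; w; 1+w]; [:: 1; -w; -2-w; w]; [:: 1+w; 1; -w; -2-w]] = 1%:M.
  apply/matrixP => i j; rewrite /std_gram zw !mxE !big_ord_recl !big_ord0 !mxE.
  by case: i => [[|[|[|[|//]]]] hi]; case: j => [[|[|[|[|//]]]] hj]; rewrite /= ?mulr1n ?mulr0n; ring: ww.
by case: (mulmx1_unit e).
Qed.
End Roots.

(** * Complex calculus *)

Section ComplexBasics.
Context {R : realType}.
Implicit Types (x y z : CC R) (a b r e : R).

Definition cre x : R := complex.Re x.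
Definition cim x : R := complex.Im x.
Definition cmod x : R := ComplexField.Normc.normc x.
Definition rc a : CC R := real_complex R a.
Definition mkc a b : CC R := Complex a b.

Lemma creD x y : cre (x + y) = cre x + cre y. Proof. by case: x; case: y. Qed.
Lemma cimD x y : cim (x + y) = cim x + cim y. Proof. by case: x; case: y. Qed.
Lemma creN x : cre (- x) = - cre x. Proof. by case: x. Qed.
Lemma cimN x : cim (- x) = - cim x. Proof. by case: x. Qed.
Lemma creB x y : cre (x - y) = cre x - cre y. Proof. by rewrite creD creN. Qed.
Lemma cimB x y : cim (x - y) = cim x - cim y. Proof. by rewrite cimD cimN. Qed.
Lemma creM x y : cre (x * y) = cre x * cre y - cim x * cim y.
Proof. by case: x; case: y. Qed.
Lemma cimM x y : cim (x * y) = cre x * cim y + cim x * cre y.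
Proof. by case: x; case: y. Qed.
Lemma cre_mk a b : cre (mkc a b) = a. Proof. by []. Qed.
Lemma cim_mk a b : cim (mkc a b) = b. Proof. by []. Qed.
Lemma cre_rc a : cre (rc a) = a. Proof. by []. Qed.
Lemma cim_rc a : cim (rc a) = 0. Proof. by []. Qed.
Lemma cre0 : cre 0 = 0. Proof. by []. Qed.
Lemma cim0 : cim 0 = 0. Proof. by []. Qed.
Lemma cre1 : cre 1 = 1. Proof. by []. Qed.
Lemma cim1 : cim 1 = 0. Proof. by []. Qed.
Definition creE := (creD, creN, creM, cre_mk, cre_rc, cre0, cre1,
                    cimD, cimN, cimM, cim_mk, cim_rc, cim0, cim1).

Lemma ceqP x y : x = y <-> cre x = cre y /\ cim x = cim y.
Proof. by split=> [->//|[]]; case: x; case: y => a b c d /= -> ->. Qed.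

Lemma rcD a b : rc (a + b) = rc a + rc b. Proof. exact: raddfD. Qed.
Lemma rcM a b : rc (a * b) = rc a * rc b. Proof. exact: rmorphM. Qed.
Lemma rcB a b : rc (a - b) = rc a - rc b. Proof. exact: raddfB. Qed.
Lemma rcN a : rc (- a) = - rc a. Proof. exact: raddfN. Qed.
Lemma rc0 : rc 0 = 0. Proof. by []. Qed.
Lemma rc1 : rc 1 = 1. Proof. by []. Qed.

Lemma normE x : `|x| = rc (cmod x). Proof. by []. Qed.
Lemma cmodE x : cmod x = Num.sqrt (cre x ^+ 2 + cim x ^+ 2). Proof. by case: x. Qed.
Lemma cmod_ge0 x : 0 <= cmod x. Proof. by rewrite cmodE sqrtr_ge0. Qed.
Lemma cmod_sqr x : cmod x ^+ 2 = cre x ^+ 2 + cim x ^+ 2.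
Proof. by rewrite cmodE sqr_sqrtr// addr_ge0// sqr_ge0. Qed.
Lemma cmodM x y : cmod (x * y) = cmod x * cmod y. Proof. exact: ComplexField.Normc.normcM. Qed.
Lemma cmod1 : cmod 1 = 1. Proof. exact: ComplexField.Normc.normc1. Qed.
Lemma cmod0 : cmod 0 = 0. Proof. exact: ComplexField.Normc.normc0. Qed.
Lemma cmodN x : cmod (- x) = cmod x. Proof. by rewrite !cmodE creN cimN !sqrrN. Qed.
Lemma cmod_eq0 x : (cmod x == 0) = (x == 0).
Proof. by apply/eqP/eqP => [/ComplexField.Normc.eq0_normc|->//]; rewrite ?cmod0. Qed.
Lemma cmod_gt0 x : (0 < cmod x) = (x != 0).
Proof. by rewrite lt_neqAle eq_sym cmod_eq0 cmod_ge0 andbT. Qed.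
Lemma cmodD x y : cmod (x + y) <= cmod x + cmod y. Proof. exact: le_normcD. Qed.
Lemma cmodB x y : cmod (x - y) = cmod (y - x). Proof. by rewrite -opprB cmodN. Qed.
Lemma cmod_tri x y z : cmod (x - z) <= cmod (x - y) + cmod (y - z).
Proof. by rewrite -[x in leLHS](subrK y) -addrA cmodD. Qed.
Lemma cmod_rc a : cmod (rc a) = `|a|.
Proof. by rewrite cmodE /= expr0n addr0 sqrtr_sqr. Qed.
Lemma cmodX x n : cmod (x ^+ n) = cmod x ^+ n.
Proof. by elim: n => [|n IH]; rewrite ?expr0 ?cmod1// !exprS cmodM IH. Qed.
Lemma cmodV x : cmod (x^-1) = (cmod x)^-1.
Proof. exact: ComplexField.Normc.normcV. Qed.
Lemma cre_le x : `|cre x| <= cmod x.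
Proof. by rewrite cmodE -sqrtr_sqr ler_wsqrtr// lerDl sqr_ge0. Qed.
Lemma cim_le x : `|cim x| <= cmod x.
Proof. by rewrite cmodE -sqrtr_sqr ler_wsqrtr// lerDr sqr_ge0. Qed.
Lemma cmod_le x : cmod x <= `|cre x| + `|cim x|.
Proof.
have [a0 b0] := (normr_ge0 (cre x), normr_ge0 (cim x)).
rewrite -(@ler_pXn2r _ 2)// ?nnegrE ?cmod_ge0 ?addr_ge0// cmod_sqr.
rewrite -(real_normK (num_real (cre x))) -(real_normK (num_real (cim x))).
nra.
Qed.
Lemma cmod_sum I (s : seq I) (P : pred I) (F : I -> CC R) :
  cmod (\sum_(i <- s | P i) F i) <= \sum_(i <- s | P i) cmod (F i).
Proof.
elim/big_rec2: _ => [|i u v _ h]; first by rewrite cmod0.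
exact: le_trans (cmodD _ _) (lerD (lexx _) h).
Qed.

Lemma cnearP (x : CC R) (P : CC R -> Prop) :
  (\forall y \near x, P y) <->
  exists2 r : R, 0 < r & forall y, cmod (y - x) < r -> P y.
Proof.
split.
  move=> /nbhs_ballP[e /= e0 h].
  (* The order on [CC R] compares only numbers with equal imaginary parts, so a positive radius is a
     real number. *)
  have eE : e = rc (cre e).
    by apply/ceqP; split=> //; rewrite cim_rc; exact: (ger0_Im (ltW e0)).
  exists (cre e); first by move: e0; rewrite eE [0]/(rc 0) ltcR.
  move=> y yx; apply: h; rewrite /ball /= /ball_ eE normE ltcR cmodB.
  by rewrite /= in yx *.
move=> [r r0 h]; apply/nbhs_ballP; exists (rc r) => /=; first by rewrite ltcR.
by move=> y; rewrite /ball /= normE ltcR cmodB; exact: h.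
Qed.

Lemma rnearP (t : R) (P : R -> Prop) :
  (\forall u \near t, P u) <->
  exists2 r : R, 0 < r & forall u, `|u - t| < r -> P u.
Proof.
split=> [/nbhs_ballP[e /= e0 h]|[r r0 h]].
  by exists e => // u ut; apply: h; rewrite /ball /= distrC.
by apply/nbhs_ballP; exists r => //= u; rewrite /ball /= distrC; exact: h.
Qed.

(* The difference quotient with its denominator cleared, which composes with
   moduli more easily than [is_derive]; [cderP] relates the two. *)
Definition cder (f : CC R -> CC R) x d := forall e, 0 < e ->
  exists2 r, 0 < r & forall y, cmod (y - x) < r ->
    cmod (f y - f x - d * (y - x)) <= e * cmod (y - x).

Lemma cderP (f : CC R -> CC R) x d :
  is_derive x (1 : CC R) f d <-> cder f x d.
Proof.
have scE (h : CC R) : h *: (1 : CC R) = h by rewrite /GRing.scale /= mulr1.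
have key : ((fun h : CC R => h^-1 *: ((f \o shift x) (h *: (1 : CC R)) - f x)) @
     0^' --> d) <-> cder f x d.
  split.
    move=> /cvgrPdist_le /= H e e0.
    have := H (rc e); rewrite ltcR => /(_ e0).
    rewrite /dnbhs near_withinE => /cnearP[r r0 h].
    exists r => // y yx.
    have [->|yNx] := eqVneq y x; first by rewrite !subrr mulr0 subrr cmod0 mulr0.
    have := h (y - x); rewrite subr0 => /(_ yx).
    rewrite /= subr_eq0 => /(_ yNx).
    rewrite scE subrK normE lecR => h1.
    have -> : f y - f x - d * (y - x) =
       - ((d - (y - x)^-1 *: (f y - f x)) * (y - x)).
      rewrite /GRing.scale /= mulrBl mulrAC mulVf ?subr_eq0// mul1r opprB//.
    by rewrite cmodN cmodM ler_wpM2r// cmod_ge0.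
  move=> H; apply/cvgrPdist_le => /= e e0.
  have eE : e = rc (cre e).
    by apply/ceqP; split=> //; rewrite cim_rc; exact: (ger0_Im (ltW e0)).
  move: e0; rewrite eE [0]/(rc 0) ltcR => /H[r r0 h].
  rewrite /dnbhs near_withinE; apply/cnearP; exists r => // y.
  rewrite subr0 => yr /= y0; rewrite scE normE lecR.
  have := h (y + x); rewrite addrK => /(_ yr) h1.
  have -> : d - y^-1 *: (f (y + x) - f x) =
       - (y^-1 * (f (y + x) - f x - d * y)).
    by rewrite /GRing.scale /=; field.
  rewrite cmodN cmodM cmodV.
  by rewrite ler_pdivrMl ?(mulrC (cmod y))// cmod_gt0; exact: y0.
split=> [[h1 h2]|h].
  by apply/key; rewrite -h2.
move/key: h => h; split; first by apply/cvg_ex; exists d.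
by apply: cvg_lim h; exact: norm_hausdorff.
Qed.

End ComplexBasics.

(** * Rules for complex derivatives, and functions with derivative zero along a segment *)

Section Calculus.
Context {R : realType}.
Implicit Types (x y z : CC R) (a b r e : R) (f g : CC R -> CC R).

(** The supremum of the parameters reached can be crossed, because the local step leads from just
    before [t] to just after it. This form of completeness serves wherever a compactness argument
    along a path is needed. *)
Lemma unit_interval_induction (P : R -> Prop) : P 0 ->
  (forall t, 0 <= t <= 1 -> exists2 r, 0 < r & forall s u, 0 <= s <= t ->
     t <= u <= 1 -> t - s < r -> u - t < r -> P s -> P u) ->
  P 1.
Proof.
move=> P0 H.
pose S := [set s : R | 0 <= s <= 1 /\ P s].
have S0 : S 0 by rewrite /S /= lexx ler01.
have Sup : has_sup S.
  split; first by exists 0.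
  by exists 1 => s [/andP[_ s1] _].
pose t := sup S.
have t0 : 0 <= t by apply: (ub_le_sup (proj2 Sup)).
have t1 : t <= 1 by apply: ge_sup; [exists 0 | move=> s [/andP[_]]].
have [|r r0 h] := H t; first by rewrite t0.
have [s [/andP[s0 s1] Ps] st] : exists2 s, S s & t - r < s.
  by have [s Ss ?] := sup_adherent r0 Sup; exists s.
have sle : s <= t by apply: (ub_le_sup (proj2 Sup)); split=> //; rewrite s0.
have [tlt|tge] := ltP t 1; last first.
  by apply: h Ps; rewrite ?s0 ?sle ?tge ?lexx //; lra.
pose u := Num.min 1 (t + r / 2).
have tu : t < u by rewrite lt_min tlt /=; lra.
have u1 : u <= 1 by rewrite ge_min lexx.
have ur : u <= t + r / 2 by rewrite ge_min lexx orbT.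
have Pu : P u by apply: h Ps; rewrite ?s0 ?sle ?(ltW tu) ?u1 //; lra.
have : u <= t by apply: (ub_le_sup (proj2 Sup)); split=> //; rewrite u1 andbT; lra.
lra.
Qed.

Lemma cder_near f g x d r : 0 < r ->
  (forall y, cmod (y - x) < r -> f y = g y) -> cder f x d -> cder g x d.
Proof.
move=> r0 fg H e /H[r' r'0 h]; exists (Num.min r r'); first by rewrite lt_min r0.
move=> y; rewrite lt_min => /andP[h1 h2].
by rewrite -!fg ?subrr ?cmod0//; exact: h.
Qed.

Lemma cder_ext f g x d : f =1 g -> cder f x d -> cder g x d.
Proof. by move=> fg; apply: (@cder_near _ _ _ _ 1) => //. Qed.

Lemma cder_eq f x d d' : cder f x d -> d = d' -> cder f x d'.
Proof. by move=> h <-. Qed.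

Lemma cder_cst c x : cder (fun=> c) x 0.
Proof.
by move=> e e0; exists 1 => // y _; rewrite subrr mul0r subrr cmod0 mulr_ge0 ?cmod_ge0 ?ltW.
Qed.

Lemma cder_id x : cder (fun y => y) x 1.
Proof.
by move=> e e0; exists 1 => // y _; rewrite mul1r subrr cmod0 mulr_ge0 ?cmod_ge0 ?ltW.
Qed.

Lemma cderD f g x df dg :
  cder f x df -> cder g x dg -> cder (fun y => f y + g y) x (df + dg).
Proof.
by move=> /cderP hf /cderP hg; apply/cderP; exact: is_deriveD.
Qed.

Lemma cderM f g x df dg : cder f x df -> cder g x dg ->
  cder (fun y => f y * g y) x (df * g x + f x * dg).
Proof.
move=> /cderP hf /cderP hg; apply/cderP.
apply: is_derive_eq; rewrite /GRing.scale /= addrC; congr (_ + _).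
by rewrite mulrC.
Qed.

Lemma cderZ c f x df : cder f x df -> cder (fun y => c * f y) x (c * df).
Proof.
by move=> hf; apply: (cder_eq (cderM (cder_cst c x) hf)); rewrite mul0r add0r.
Qed.

Lemma cderN f x df : cder f x df -> cder (fun y => - f y) x (- df).
Proof.
move=> /(cderZ (-1)) h; rewrite -mulN1r; apply: cder_ext h => y.
by rewrite mulN1r.
Qed.

Lemma cderB f g x df dg :
  cder f x df -> cder g x dg -> cder (fun y => f y - g y) x (df - dg).
Proof. by move=> hf hg; apply: cderD => //; apply: cderN. Qed.

Lemma cder_sum I (s : seq I) (F : I -> CC R -> CC R) (dF : I -> CC R) x :
  (forall i, cder (F i) x (dF i)) ->
  cder (fun y => \sum_(i <- s) F i y) x (\sum_(i <- s) dF i).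
Proof.
move=> h; elim: s => [|i s IH].
  by rewrite big_nil; apply: cder_ext (cder_cst 0 x) => y; rewrite big_nil.
rewrite big_cons; apply: cder_ext (cderD (h i) IH) => y.
by rewrite big_cons.
Qed.

Lemma cder_cont f x d : cder f x d -> forall e, 0 < e ->
  exists2 r, 0 < r & forall y, cmod (y - x) < r -> cmod (f y - f x) < e.
Proof.
move=> /(_ 1 ltr01)[r r0 h] e e0.
have d0 := cmod_ge0 d.
exists (Num.min r (e / (2 + cmod d))).
  by rewrite lt_min r0 divr_gt0//; lra.
move=> y; rewrite lt_min => /andP[/h h1 h2].
have -> : f y - f x = f y - f x - d * (y - x) + d * (y - x) by rewrite subrK.
apply: le_lt_trans (cmodD _ _) _; rewrite cmodM.
move: h2; rewrite ltr_pdivlMr; last lra.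
have := cmod_ge0 (y - x); rewrite mul1r in h1.
nra.
Qed.

Lemma cder_comp f g x df dg : cder g x dg -> cder f (g x) df ->
  cder (fun y => f (g y)) x (df * dg).
Proof.
move=> hg hf e e0.
have D0 := cmod_ge0 dg; have F0 := cmod_ge0 df.
(* Half of [e] goes to each error term: [e1] controls that of [f], using that [g] is Lipschitz at
   [x] with constant [1 + cmod dg]. The bound [e2 <= 1] yields this Lipschitz estimate, and the rest
   of [e2] controls the error of [g]. *)
pose e1 := e / (2 * (1 + cmod dg)).
have e10 : 0 < e1 by rewrite divr_gt0//; lra.
pose e2 := Num.min 1 (e / (2 * (1 + cmod df))).
have e20 : 0 < e2 by rewrite lt_min ltr01 /= divr_gt0//; lra.
have [r1 r10 h1] := hf _ e10.
have [r2 r20 h2] := hg _ e20.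
have [r3 r30 h3] := cder_cont hg r10.
exists (Num.min r2 r3); first by rewrite lt_min r20.
move=> y; rewrite lt_min => /andP[/h2 k2 /h3 /h1 k1].
have -> : f (g y) - f (g x) - df * dg * (y - x) =
  (f (g y) - f (g x) - df * (g y - g x)) + df * (g y - g x - dg * (y - x)).
  by ring.
apply: le_trans (cmodD _ _) _; rewrite cmodM.
have gl : cmod (g y - g x) <= (1 + cmod dg) * cmod (y - x).
  have -> : g y - g x = g y - g x - dg * (y - x) + dg * (y - x) by rewrite subrK.
  apply: le_trans (cmodD _ _) _; rewrite cmodM mulrDl lerD2r.
  apply: le_trans k2 _; rewrite ler_wpM2r ?cmod_ge0// ge_min lexx//.
have k1' : cmod (f (g y) - f (g x) - df * (g y - g x)) <= e / 2 * cmod (y - x).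
  apply: le_trans k1 _; apply: le_trans (ler_wpM2l (ltW e10) gl) _.
  rewrite mulrA ler_wpM2r ?cmod_ge0// /e1.
  have -> // : e / (2 * (1 + cmod dg)) * (1 + cmod dg) = e / 2.
  by field; rewrite gt_eqF//; lra.
have k2' : cmod df * cmod (g y - g x - dg * (y - x)) <= e / 2 * cmod (y - x).
  apply: le_trans (ler_wpM2l F0 k2) _; rewrite mulrA ler_wpM2r ?cmod_ge0//.
  have : e2 <= e / (2 * (1 + cmod df)) by rewrite ge_min lexx orbT.
  rewrite ler_pdivlMr; last lra.
  by nra.
lra.
Qed.

Lemma cderV x : x != 0 -> cder (fun y => y^-1) x (- x ^- 2).
Proof.
move=> x0 e e0; have m0 : 0 < cmod x by rewrite cmod_gt0.
exists (Num.min (cmod x / 2) (e * cmod x ^+ 3 / 2)).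
  by rewrite lt_min !divr_gt0// mulr_gt0 ?exprn_gt0.
move=> y; rewrite lt_min => /andP[h1 h2].
have my : cmod x / 2 < cmod y.
  have := cmod_tri x y 0; rewrite !subr0 cmodB; lra.
have y0 : y != 0 by rewrite -cmod_gt0; lra.
have -> : y^-1 - x^-1 - - x ^- 2 * (y - x) = (y - x) * ((y - x) * (x ^- 2 * y^-1)).
  by field; rewrite ?x0 ?y0.
rewrite cmodM mulrC ler_wpM2r ?cmod_ge0// !cmodM !cmodV cmodX.
rewrite -invfM ler_pdivrMr; last by rewrite mulr_gt0 ?exprn_gt0//; lra.
have [X0 X20] : 0 < cmod x ^+ 2 /\ 0 <= e * cmod x ^+ 2.
  by split; [rewrite exprn_gt0 | rewrite mulr_ge0 ?sqr_ge0 ?ltW].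
have : e * cmod x ^+ 3 / 2 = (e * cmod x ^+ 2) * (cmod x / 2) by rewrite exprSr; field.
have : (e * cmod x ^+ 2) * (cmod x / 2) <= (e * cmod x ^+ 2) * cmod y.
  by rewrite ler_wpM2l// ltW.
rewrite mulrA; lra.
Qed.

(** For each [e > 0] the bound [cmod (F t - F 0) <= e * t] propagates along the segment. All
    uniqueness of horizontal sections rests on this; the derivative need vanish only at points of
    the segment. *)
Lemma cder0_segment f p q :
  (forall t, 0 <= t <= 1 -> cder f (p + rc t * (q - p)) 0) -> f p = f q.
Proof.
move=> H.
apply/eqP; rewrite -subr_eq0 -cmod_eq0 cmodB; apply/eqP/le_anti.
rewrite cmod_ge0 andbT.
pose F (t : R) := f (p + rc t * (q - p)).
have F0 : F 0 = f p by rewrite /F rc0 mul0r addr0.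
have F1 : F 1 = f q by rewrite /F rc1 mul1r addrC subrK.
have [->|pq] := eqVneq p q; first by rewrite subrr cmod0.
have m0 : 0 < cmod (q - p) by rewrite cmod_gt0 subr_eq0 eq_sym.
apply/ler_addgt0Pl => e e0; rewrite addr0.
suff : cmod (F 1 - F 0) <= e * 1 by rewrite F0 F1 mulr1.
apply: (@unit_interval_induction (fun t => cmod (F t - F 0) <= e * t)).
  by rewrite subrr cmod0 mulr0.
move=> t t01; have [|r r0 h] := H t t01 (e / cmod (q - p)).
  by rewrite divr_gt0.
have K u : `|u - t| < r / cmod (q - p) -> cmod (F u - F t) <= e * `|u - t|.
  rewrite ltr_pdivlMr// => ur.
  have E : p + rc u * (q - p) - (p + rc t * (q - p)) = rc (u - t) * (q - p).
    by rewrite rcB; ring.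
  have := h (p + rc u * (q - p)); rewrite E cmodM cmod_rc => /(_ ur).
  rewrite mul0r subr0 => /le_trans; apply.
  by rewrite mulrCA divfK ?gt_eqF// mulrC.
exists (r / cmod (q - p)); first by rewrite divr_gt0.
move=> s u /andP[s0 st] /andP[tu u1] ts ut Ps.
have k1 : cmod (F s - F t) <= e * (t - s).
  by have := K s; rewrite distrC ger0_norm ?subr_ge0//; exact.
have k2 : cmod (F u - F t) <= e * (u - t).
  by have := K u; rewrite ger0_norm ?subr_ge0//; exact.
have := cmod_tri (F u) (F t) (F 0); have := cmod_tri (F t) (F s) (F 0).
rewrite (cmodB (F t) (F s)); lra.
Qed.

End Calculus.

(** * Power series with a geometric error bound *)

Section PowerSeries.
Context {R : realType}.
Implicit Types (x y z : CC R) (r e K L C : R) (c d : nat -> CC R).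

Lemma le_geometric_gap (a b K : R) : (forall N, a <= b + K / 2 ^+ N) -> a <= b.
Proof.
move=> H; rewrite leNgt; apply/negP => ba.
have [K0|K0] := leP K 0.
  have := H 0%N; rewrite expr0 divr1; lra.
pose N := Num.bound (K / (a - b)).
have NK : K / (a - b) < N%:R.
  by apply: archi_boundP; rewrite divr_ge0 ?subr_ge0// ltW.
have N2 : N%:R < (2 ^+ N : R) by rewrite -natrX ltr_nat ltn_expl.
have := H N; rewrite -lerBlDl ler_pdivlMr ?exprn_gt0//.
move: NK; rewrite ltr_pdivrMr ?subr_gt0// => NK.
have : (a - b) * N%:R < (a - b) * 2 ^+ N by rewrite ltr_pM2l// subr_gt0.
lra.
Qed.

(** The intervals of radius [2 * C / 2 ^+ N] around the partial sums are nested; the supremum of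
    their left ends lies in all of them. *)
Lemma real_series_geometric (u : nat -> R) C :
  (forall k, `|u k| <= C / 2 ^+ k) ->
  exists l, forall N, `|l - \sum_(k < N) u k| <= 2 * C / 2 ^+ N.
Proof.
move=> H; pose S N := \sum_(k < N) u k.
have SS N : S N.+1 = S N + u N by rewrite /S big_ord_recr.
pose a N := S N - 2 * C / 2 ^+ N; pose b N := S N + 2 * C / 2 ^+ N.
have E N : C / 2 ^+ N = 2 * C / 2 ^+ N.+1.
  by rewrite exprS; field; rewrite expf_neq0.
have C0 N : 0 <= C / 2 ^+ N by apply: le_trans (H N).
have am m n : (m <= n)%N -> a m <= a n.
  move=> /subnK<-; elim: (n - m)%N => // k IH; apply: le_trans IH _.
  rewrite addSn /a SS -E; have := H (k + m)%N; rewrite ler_norml.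
  rewrite -mulrA; lra.
have bm m n : (m <= n)%N -> b n <= b m.
  move=> /subnK<-; elim: (n - m)%N => // k IH; apply: le_trans IH.
  rewrite addSn /b SS -E; have := H (k + m)%N; rewrite ler_norml.
  rewrite -mulrA; lra.
have ab m n : a m <= b n.
  apply: le_trans (am _ _ (leq_maxl m n)) _; apply: le_trans (bm _ _ (leq_maxr m n)).
  by rewrite /a /b -mulrA; have := C0 (maxn m n); lra.
pose A := [set z | exists n, z = a n].
have supA : has_sup A.
  split; first by exists (a 0%N), 0%N.
  by exists (b 0%N) => _ [n ->].
exists (sup A) => N; rewrite ler_norml.
have l1 : a N <= sup A by apply: (ub_le_sup (proj2 supA)); exists N.
have l2 : sup A <= b N by apply: ge_sup; [exists (a 0%N), 0%N | move=> _ [n ->]].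
by move: l1 l2; rewrite /a /b -/(S N); lra.
Qed.

Definition psum c x N := \sum_(k < N) c k * x ^+ k.
(** Convergence at a fixed rate, with a constant that may depend on [x]. Linearity, index shifts and
    uniqueness then become inequalities between constants, without limits. *)
Definition hsum c x s := exists K, forall N, cmod (s - psum c x N) <= K / 2 ^+ N.

Lemma hsum_uniq c x s t : hsum c x s -> hsum c x t -> s = t.
Proof.
move=> [K H] [K' H']; apply/eqP; rewrite -subr_eq0 -cmod_eq0.
apply/eqP/le_anti; rewrite cmod_ge0 andbT.
apply: (@le_geometric_gap _ _ (K + K')) => N; rewrite add0r mulrDl.
apply: le_trans (cmod_tri s (psum c x N) t) _.
by rewrite (cmodB _ t) lerD.
Qed.

Lemma hsum_ex c C L x : (forall k, cmod (c k) <= C * L ^+ k) ->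
  0 <= L -> L * cmod x <= 1 / 2 -> exists s, hsum c x s.
Proof.
move=> H L0 Lx.
have bnd k : cmod (c k * x ^+ k) <= C / 2 ^+ k.
  have C0 : 0 <= C by have := H 0%N; rewrite expr0 mulr1; apply: le_trans; exact: cmod_ge0.
  rewrite cmodM cmodX; apply: le_trans (ler_wpM2r (exprn_ge0 _ (cmod_ge0 _)) (H k)) _.
  rewrite -mulrA -exprMn ler_wpM2l// -exprVn lerXn2r// ?nnegrE ?mulr_ge0 ?cmod_ge0//; lra.
have [a Ha] : exists l, forall N, `|l - \sum_(k < N) cre (c k * x ^+ k)| <= 2 * C / 2 ^+ N.
  by apply: (@real_series_geometric (fun k => cre (c k * x ^+ k))) => k; apply: le_trans (cre_le _) (bnd k).
have [b Hb] : exists l, forall N, `|l - \sum_(k < N) cim (c k * x ^+ k)| <= 2 * C / 2 ^+ N.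
  by apply: (@real_series_geometric (fun k => cim (c k * x ^+ k))) => k; apply: le_trans (cim_le _) (bnd k).
exists (mkc a b), (4 * C) => N; apply: le_trans (cmod_le _) _.
rewrite creB cimB cre_mk cim_mk.
have -> : cre (psum c x N) = \sum_(k < N) cre (c k * x ^+ k).
  by rewrite /psum; elim/big_rec2: _ => // i u v _ <-; rewrite creD.
have -> : cim (psum c x N) = \sum_(k < N) cim (c k * x ^+ k).
  by rewrite /psum; elim/big_rec2: _ => // i u v _ <-; rewrite cimD.
have := Ha N; have := Hb N; rewrite -!mulrA; lra.
Qed.

Definition ps c x : CC R := xget 0 [set s | hsum c x s].

Lemma psE c x s : hsum c x s -> ps c x = s.
Proof.
move=> h; apply: hsum_uniq (h).
exact: (xgetI (P := [set s | hsum c x s]) 0 h).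
Qed.

Lemma psP c C L x : (forall k, cmod (c k) <= C * L ^+ k) ->
  0 <= L -> L * cmod x <= 1 / 2 -> hsum c x (ps c x).
Proof. by move=> h1 h2 h3; have [s hs] := hsum_ex h1 h2 h3; rewrite (psE hs). Qed.

Lemma hsum_ext c d x s : c =1 d -> hsum c x s -> hsum d x s.
Proof. by move=> /funext ->. Qed.

Lemma hsum0 x : hsum (fun=> 0) x 0.
Proof.
exists 0 => N; rewrite /psum big1 ?subrr ?cmod0 ?mul0r// => i _.
by rewrite mul0r.
Qed.

Lemma hsumD c d x s t : hsum c x s -> hsum d x t ->
  hsum (fun k => c k + d k) x (s + t).
Proof.
move=> [K H] [K' H']; exists (K + K') => N.
have -> : psum (fun k => c k + d k) x N = psum c x N + psum d x N.
  by rewrite /psum -big_split /=; apply: eq_bigr => i _; rewrite mulrDl.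
by rewrite opprD addrACA mulrDl; apply: le_trans (cmodD _ _) (lerD _ _).
Qed.

Lemma hsumZ a c x s : hsum c x s -> hsum (fun k => a * c k) x (a * s).
Proof.
move=> [K H]; exists (cmod a * K) => N.
have -> : psum (fun k => a * c k) x N = a * psum c x N.
  by rewrite /psum mulr_sumr; apply: eq_bigr => i _; rewrite mulrA.
by rewrite -mulrBr cmodM -mulrA ler_wpM2l ?cmod_ge0.
Qed.

Lemma hsum_sum I (s : seq I) (F : I -> nat -> CC R) (S : I -> CC R) x :
  (forall i, hsum (F i) x (S i)) ->
  hsum (fun k => \sum_(i <- s) F i k) x (\sum_(i <- s) S i).
Proof.
move=> h; elim: s => [|i s IH].
  by rewrite big_nil; apply: hsum_ext (hsum0 x) => k; rewrite big_nil.
by rewrite big_cons; apply: hsum_ext (hsumD (h i) IH) => k; rewrite big_cons.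
Qed.

Lemma hsum_shift c x s : hsum (fun k => c k.+1) x s -> hsum c x (c 0%N + x * s).
Proof.
(* The second argument of the maximum covers [N = 0], where the partial sum is empty and the shifted
   series gives no bound. *)
move=> [K H]; exists (Num.max (2 * (cmod x * K)) (cmod (c 0%N + x * s))) => [[|N]].
  by rewrite /psum big_ord0 subr0 expr0 divr1 le_max lexx orbT.
have -> : psum c x N.+1 = c 0%N + x * psum (fun k => c k.+1) x N.
  rewrite /psum big_ord_recl expr0 mulr1 mulr_sumr; congr (_ + _).
  by apply: eq_bigr => i _; rewrite /= /bump /= ?add1n exprS mulrCA.
rewrite opprD addrACA subrr add0r -mulrBr cmodM.
apply: le_trans (ler_wpM2l (cmod_ge0 x) (H N)) _.
rewrite [leRHS](_ : _ = Num.max (2 * (cmod x * K)) (cmod (c 0%N + x * s)) / 2 / 2 ^+ N).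
  rewrite (mulrA (cmod x)) ler_wpM2r ?invr_ge0 ?exprn_ge0// ler_pdivlMr// mulrC.
  by rewrite le_max lexx.
by rewrite exprS; field; rewrite expf_neq0.
Qed.

(** The second-order remainder of [x ^+ k] is at most [k ^ 2 r ^ (k - 2)] times the squared
    increment; the factor [r ^+ 2] is kept on the left to avoid the exponent [k - 2]. Induction on
    [k], writing the next remainder as [y] times the previous one plus a quadratic term. *)
Lemma pow_taylor x y r k : 0 <= r -> cmod x <= r -> cmod y <= r ->
  cmod (y ^+ k - x ^+ k - k%:R * x ^+ k.-1 * (y - x)) * r ^+ 2
    <= k%:R ^+ 2 * r ^+ k * cmod (y - x) ^+ 2.
Proof.
move=> r0 xr yr; elim: k => [|k IH].
  by rewrite !expr0 subrr !mul0r subrr cmod0 mul0r expr0n /= !mul0r.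
have -> : y ^+ k.+1 - x ^+ k.+1 - k.+1%:R * x ^+ k.+1.-1 * (y - x) =
  y * (y ^+ k - x ^+ k - k%:R * x ^+ k.-1 * (y - x)) + k%:R * x ^+ k.-1 * (y - x) ^+ 2.
  case: k {IH} => [|k]; first by rewrite !expr0 !expr1; ring.
  by rewrite /= -[k.+2%:R]natr1 !exprS; ring.
apply: le_trans (ler_wpM2r (sqr_ge0 r) (cmodD _ _)) _.
rewrite mulrDl cmodM -(mulrA (cmod y)).
have D0 := sqr_ge0 (cmod (y - x)).
have h1 : cmod y * (cmod (y ^+ k - x ^+ k - k%:R * x ^+ k.-1 * (y - x)) * r ^+ 2) <=
  k%:R ^+ 2 * r ^+ k.+1 * cmod (y - x) ^+ 2.
  apply: (@le_trans _ _ (r * (k%:R ^+ 2 * r ^+ k * cmod (y - x) ^+ 2))).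
    by rewrite ler_pM ?cmod_ge0 ?mulr_ge0 ?sqr_ge0 ?cmod_ge0.
  by rewrite (exprS r k) le_eqVlt; apply/orP; left; apply/eqP; ring.
have h2 : cmod (k%:R * x ^+ k.-1 * (y - x) ^+ 2) * r ^+ 2 <=
  k%:R * r ^+ k.+1 * cmod (y - x) ^+ 2.
  case: k {IH h1} => [|k]; first by rewrite !mul0r cmod0 !mul0r.
  rewrite !cmodM !cmodX -(rmorph_nat (@real_complex R)) cmod_rc normr_nat.
  rewrite /= [leRHS](_ : _ = k.+1%:R * r ^+ 2 * cmod (y - x) ^+ 2 * r ^+ k).
    rewrite [leLHS](_ : _ = k.+1%:R * r ^+ 2 * cmod (y - x) ^+ 2 * cmod x ^+ k); last by ring.
    by rewrite ler_wpM2l ?mulr_ge0 ?sqr_ge0 ?cmod_ge0// lerXn2r// nnegrE cmod_ge0.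
  by rewrite -addn2 exprD; ring.
apply: le_trans (lerD h1 h2) _; rewrite -!mulrDl ler_wpM2r// ler_wpM2r ?exprn_ge0//.
by rewrite -natr1; have := ler0n R k; nra.
Qed.

Lemma sqr_le_exp2 k : (k ^ 2 <= 2 * 2 ^ k)%N.
Proof.
have [|k4] := ltnP k 4; first by case: k => [|[|[|[|]]]].
rewrite -(subnK k4); elim: (k - 4)%N => [//|n IH].
rewrite addSn [(2 ^ _.+1)%N]expnS; move: IH; rewrite -!mulnn; nia.
Qed.

(** Summing [pow_taylor] over the terms leaves a quadratic remainder. The radius [1 / (4 L)] leaves
    room for two losses: the derived coefficients grow like [(2 L) ^ k], and [hsum] asks for terms
    decaying like [2 ^ - k]. *)
Lemma ps_der c C L x : 0 < L -> (forall k, cmod (c k) <= C * L ^+ k) ->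
  4 * L * cmod x < 1 -> cder (ps c) x (ps (fun k => k.+1%:R * c k.+1) x).
Proof.
move=> L0 H Lx.
have [x0 L0'] := (cmod_ge0 x, ltW L0).
have C0 : 0 <= C by have := H 0%N; rewrite expr0 mulr1; apply: le_trans; exact: cmod_ge0.
pose d k := k.+1%:R * c k.+1.
have Hd k : cmod (d k) <= (C * L) * (2 * L) ^+ k.
  rewrite /d cmodM -(rmorph_nat (@real_complex R)) cmod_rc normr_nat.
  apply: le_trans (ler_wpM2l (ler0n _ _) (H _)) _.
  rewrite exprMn exprS !mulrA ler_wpM2r ?exprn_ge0//.
  rewrite -(mulrA _ C) (mulrC _ (C * L)) ler_wpM2l ?mulr_ge0//.
  by rewrite -natrX ler_nat ltn_expl.
have [Kd Sd] : hsum d x (ps d x) by apply: (psP Hd); rewrite ?mulr_ge0 ?ltW//; lra.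
have [Kx Sx] : hsum c x (ps c x) by apply: (psP H) => //; nra.
pose r := (4 * L)^-1.
have r0 : 0 < r by rewrite invr_gt0 mulr_gt0.
have xr : cmod x < r by rewrite /r -div1r ltr_pdivlMr ?mulr_gt0// mulrC.
(* The number 64 is 16 from [r ^ -2 = 16 L ^ 2], times 2 from [k ^ 2 <= 2 * 2 ^ k], times 2 from the
   sum of the powers of [1/2]. *)
pose K := 64 * C * L ^+ 2.
have K0 : 0 <= K by rewrite !mulr_ge0 ?exprn_ge0.
have quad y : cmod y <= r ->
  cmod (ps c y - ps c x - ps d x * (y - x)) <= K * cmod (y - x) ^+ 2.
  move=> yr; have D0 := cmod_ge0 (y - x).
  have yL : 4 * L * cmod y <= 1.
    by move: yr; rewrite /r -div1r ler_pdivlMr ?mulr_gt0// mulrC.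
  have [Ky Sy] : hsum c y (ps c y) by apply: (psP H) => //; lra.
  apply: (@le_geometric_gap _ _ (Ky + Kx + Kd * cmod (y - x))) => N.
  have Kx0 : 0 <= Kx by have := Sx 0%N; rewrite expr0 divr1; apply: le_trans; exact: cmod_ge0.
  have Ky0 : 0 <= Ky by have := Sy 0%N; rewrite expr0 divr1; apply: le_trans; exact: cmod_ge0.
  have half (k0 : R) : 0 <= k0 -> k0 / 2 ^+ N.+1 <= k0 / 2 ^+ N.
    move=> k00; rewrite ler_wpM2l// lef_pV2 ?posrE ?exprn_gt0// exprS.
    by have := exprn_ge0 N (ler0n R 2); lra.
  have regroup (t u v p q r' z : CC R) : t - u - v * z =
    (p - q - r' * z) + ((t - p) - (u - q) - (v - r') * z) by ring.
  rewrite (regroup (ps c y) (ps c x) (ps d x) (psum c y N.+1) (psum c x N.+1)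
    (psum d x N) (y - x)).
  apply: le_trans (cmodD _ _) _; apply: lerD.
    have -> : psum c y N.+1 - psum c x N.+1 - psum d x N * (y - x) =
      \sum_(k < N.+1) c k * (y ^+ k - x ^+ k - k%:R * x ^+ k.-1 * (y - x)).
      rewrite /psum -sumrB big_ord_recl [RHS]big_ord_recl mulr_suml -addrA -sumrB.
      congr (_ + _); first by rewrite /= !expr0; ring.
      by apply: eq_bigr => i _; rewrite /d /= /bump /= ?add1n; ring.
    apply: le_trans (cmod_sum _ _ _) _.
    apply: (@le_trans _ _ (\sum_(k < N.+1) 32 * C * L ^+ 2 * cmod (y - x) ^+ 2 / 2 ^+ k)).
      apply: ler_sum => k _; rewrite cmodM.
      rewrite -(@ler_pM2r _ (r ^+ 2)) ?exprn_gt0// -(mulrA (cmod (c k))).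
      apply: le_trans (ler_pM (cmod_ge0 _) _ (H k) (pow_taylor k (ltW r0) (ltW xr) yr)) _.
        by rewrite mulr_ge0 ?cmod_ge0 ?sqr_ge0.
      have LrE : L ^+ k * r ^+ k = 4 ^- k.
        by rewrite -exprMn /r invfM mulrCA mulfV ?gt_eqF// mulr1 exprVn.
      have LrE2 : L ^+ 2 * r ^+ 2 = 16^-1.
        rewrite -exprMn /r invfM mulrCA mulfV ?gt_eqF// mulr1 exprVn.
        by congr (_^-1); rewrite -natrX.
      rewrite [leLHS](_ : _ = C * cmod (y - x) ^+ 2 * (k%:R ^+ 2 * (L ^+ k * r ^+ k))); last ring.
      rewrite [leRHS](_ : _ = C * cmod (y - x) ^+ 2 * (32 * (L ^+ 2 * r ^+ 2) / 2 ^+ k)); last ring.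
      rewrite ler_wpM2l ?mulr_ge0 ?sqr_ge0// LrE LrE2 ler_pdivrMr ?exprn_gt0//.
      have -> : (4 : R) ^+ k = 2 ^+ k * 2 ^+ k by rewrite -exprMn; congr (_ ^+ _); ring.
      rewrite mulrA divfK ?expf_neq0//.
      have := sqr_le_exp2 k; rewrite -(ler_nat R) natrM !natrX; lra.
    rewrite -mulr_sumr.
    have -> : K * cmod (y - x) ^+ 2 = 32 * C * L ^+ 2 * cmod (y - x) ^+ 2 * 2 by rewrite /K; ring.
    rewrite ler_wpM2l ?mulr_ge0 ?sqr_ge0//.
    have -> : \sum_(k < N.+1) (2 ^- k : R) = 2 - 2 / 2 ^+ N.+1.
      elim: N.+1 => [|n IH]; first by rewrite big_ord0 expr0 divr1 subrr.
      rewrite big_ord_recr /= IH exprS; field; rewrite expf_neq0//.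
    by rewrite gerBl divr_ge0 ?exprn_ge0.
  apply: le_trans (cmodD _ _) _; rewrite [leRHS]mulrDl; apply: lerD.
    apply: le_trans (cmodD _ _) _; rewrite cmodN [leRHS]mulrDl.
    by apply: lerD; [apply: le_trans (Sy N.+1) (half _ Ky0) | apply: le_trans (Sx N.+1) (half _ Kx0)].
  by rewrite cmodN cmodM [leRHS]mulrAC ler_wpM2r.
move=> e e0; exists (Num.min (r - cmod x) (e / (K + 1))).
  by rewrite lt_min subr_gt0 xr divr_gt0//; lra.
move=> y; rewrite lt_min => /andP[h1 h2].
apply: le_trans (quad y _) _.
  by have := cmod_tri y x 0; rewrite !subr0; lra.
move: h2; rewrite ltr_pdivlMr; last lra.
by have := cmod_ge0 (y - x); nra.
Qed.

End PowerSeries.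

(** * Matrix-valued derivatives and power series, and Frobenius series *)

Section MatrixCalculus.
Context {R : realType}.
Implicit Types (x y z p : CC R).

Definition mder m k (Z : CC R -> 'M[CC R]_(m, k)) x (D : 'M[CC R]_(m, k)) :=
  forall i j, cder (fun y => Z y i j) x (D i j).

Lemma mder_cst m k (A : 'M[CC R]_(m, k)) x : mder (fun=> A) x 0.
Proof. by move=> i j; rewrite mxE; exact: cder_cst. Qed.

Lemma mderM m k l (A : CC R -> 'M[CC R]_(m, k)) (Z : CC R -> 'M[CC R]_(k, l)) x dA dZ :
  mder A x dA -> mder Z x dZ ->
  mder (fun y => A y *m Z y) x (dA *m Z x + A x *m dZ).
Proof.
move=> hA hZ i j; rewrite !mxE -big_split /=.
apply: (@cder_ext _ (fun y => \sum_l A y i l * Z y l j)); first by move=> y; rewrite mxE.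
by apply: cder_sum => u; exact: cderM.
Qed.

Lemma mderZ m k (f : CC R -> CC R) (Z : CC R -> 'M[CC R]_(m, k)) x df dZ :
  cder f x df -> mder Z x dZ ->
  mder (fun y => f y *: Z y) x (df *: Z x + f x *: dZ).
Proof.
move=> hf hZ i j; rewrite !mxE.
apply: (@cder_ext _ (fun y => f y * Z y i j)); first by move=> y; rewrite mxE.
exact: cderM.
Qed.

Lemma mderD m k (A Z : CC R -> 'M[CC R]_(m, k)) x dA dZ :
  mder A x dA -> mder Z x dZ -> mder (fun y => A y + Z y) x (dA + dZ).
Proof.
move=> hA hZ i j; rewrite !mxE.
apply: (@cder_ext _ (fun y => A y i j + Z y i j)); first by move=> y; rewrite mxE.
exact: cderD.
Qed.

Lemma mder_eq m k (Z : CC R -> 'M[CC R]_(m, k)) x D D' :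
  mder Z x D -> D = D' -> mder Z x D'.
Proof. by move=> h <-. Qed.

Lemma mder_near m k (Y Z : CC R -> 'M[CC R]_(m, k)) x D r : 0 < r ->
  (forall y, cmod (y - x) < r -> Y y = Z y) -> mder Y x D -> mder Z x D.
Proof.
move=> r0 h H i j; apply: (@cder_near _ (fun y => Y y i j) _ _ _ r) => //.
by move=> y /h ->.
Qed.

Lemma mder_tr m k (Z : CC R -> 'M[CC R]_(m, k)) x D :
  mder Z x D -> mder (fun y => (Z y)^T) x D^T.
Proof.
move=> h i j; rewrite mxE; apply: cder_ext (h j i) => y.
by rewrite mxE.
Qed.

Lemma mder_comp m k (Z : CC R -> 'M[CC R]_(m, k)) f x D df :
  cder f x df -> mder Z (f x) D -> mder (fun y => Z (f y)) x (df *: D).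
Proof.
move=> hf h i j; rewrite mxE mulrC.
exact: (@cder_comp _ (fun y => Z y i j) f).
Qed.

Lemma mder_shift m k (Z : CC R -> 'M[CC R]_(m, k)) x p D :
  mder Z (x - p) D -> mder (fun y => Z (y - p)) x D.
Proof.
move=> h; rewrite -[D]scale1r.
apply: (mder_comp (f := fun y => y - p)) h.
by apply: cder_eq (cderB (cder_id x) (cder_cst p x)) _; rewrite subr0.
Qed.

Lemma mder0_segment m k (Z : CC R -> 'M[CC R]_(m, k)) p q :
  (forall t, 0 <= t <= 1 -> mder Z (p + rc t * (q - p)) 0) -> Z p = Z q.
Proof.
move=> H; apply/matrixP => i j; apply: (@cder0_segment _ (fun y => Z y i j)) => t t01.
by have := H t t01 i j; rewrite mxE.
Qed.

(* the coefficient of [dx] in [B * sum_j E_jj dx/(x - s_j)] *)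
Definition okubo n (B : 'M[CC R]_n) (s : 'I_n -> CC R) x : 'M[CC R]_n :=
  B *m diag_mx (\row_j (x - s j)^-1).

Definition mps m k (v : nat -> 'M[CC R]_(m, k)) x : 'M[CC R]_(m, k) :=
  \matrix_(i, j) ps (fun l => v l i j) x.

Definition mhsum m k (v : nat -> 'M[CC R]_(m, k)) x (S : 'M[CC R]_(m, k)) :=
  forall i j, hsum (fun l => v l i j) x (S i j).

Lemma mhsum_uniq m k (v : nat -> 'M[CC R]_(m, k)) x S T :
  mhsum v x S -> mhsum v x T -> S = T.
Proof. by move=> h1 h2; apply/matrixP => i j; apply: hsum_uniq (h1 i j) (h2 i j). Qed.

Lemma mhsum_ext m k (v w : nat -> 'M[CC R]_(m, k)) x S :
  v =1 w -> mhsum v x S -> mhsum w x S.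
Proof. by move=> /funext ->. Qed.

Lemma mhsumD m k (v w : nat -> 'M[CC R]_(m, k)) x S T :
  mhsum v x S -> mhsum w x T -> mhsum (fun l => v l + w l) x (S + T).
Proof.
move=> h1 h2 i j; rewrite mxE.
by apply: hsum_ext (hsumD (h1 i j) (h2 i j)) => l; rewrite mxE.
Qed.

Lemma mhsumZ m k a (v : nat -> 'M[CC R]_(m, k)) x S :
  mhsum v x S -> mhsum (fun l => a *: v l) x (a *: S).
Proof.
by move=> h i j; rewrite mxE; apply: hsum_ext (hsumZ a (h i j)) => l; rewrite mxE.
Qed.

Lemma mhsumM m k l (A : 'M[CC R]_(m, k)) (v : nat -> 'M[CC R]_(k, l)) x S :
  mhsum v x S -> mhsum (fun l => A *m v l) x (A *m S).
Proof.
move=> h i j; rewrite mxE.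
apply: hsum_ext (hsum_sum _ (fun u => hsumZ (A i u) (h u j))) => u.
by rewrite mxE.
Qed.

Lemma mhsum_shift m k (v : nat -> 'M[CC R]_(m, k)) x S :
  mhsum (fun l => v l.+1) x S -> mhsum v x (v 0%N + x *: S).
Proof.
by move=> h i j; rewrite !mxE; exact: (hsum_shift (h i j)).
Qed.

Lemma mpsP m k (v : nat -> 'M[CC R]_(m, k)) x C L :
  (forall l i j, cmod (v l i j) <= C * L ^+ l) -> 0 <= L -> L * cmod x <= 1 / 2 ->
  mhsum v x (mps v x).
Proof. by move=> h L0 Lx i j; rewrite mxE; apply: (psP (C := C) (L := L)). Qed.

Lemma natc (k : nat) : (k%:R : CC R) = rc k%:R.
Proof. by rewrite /rc rmorph_nat. Qed.

Lemma der_coef_bound (c : nat -> CC R) C L : 0 <= L ->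
  (forall k, cmod (c k) <= C * L ^+ k) ->
  forall k, cmod (k.+1%:R * c k.+1) <= (C * L) * (2 * L) ^+ k.
Proof.
move=> L0 H k.
have C0 : 0 <= C by have := H 0%N; rewrite expr0 mulr1; apply: le_trans; exact: cmod_ge0.
rewrite cmodM natc cmod_rc normr_nat.
apply: le_trans (ler_wpM2l (ler0n _ _) (H _)) _.
rewrite exprMn exprS !mulrA ler_wpM2r ?exprn_ge0//.
rewrite -(mulrA _ C) (mulrC _ (C * L)) ler_wpM2l ?mulr_ge0//.
by rewrite -natrX ler_nat ltn_expl.
Qed.

Lemma mps_der m k (v : nat -> 'M[CC R]_(m, k)) x C L : 0 < L ->
  (forall l i j, cmod (v l i j) <= C * L ^+ l) -> 4 * L * cmod x < 1 ->
  exists2 D, mder (mps v) x D & mhsum (fun l => l.+1%:R *: v l.+1) x D.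
Proof.
move=> L0 H Lx.
exists (\matrix_(i, j) ps (fun l => l.+1%:R * v l.+1 i j) x) => i j.
  have h := @ps_der _ (fun l => v l i j) C L x L0 (fun l => H l i j) Lx.
  apply: cder_eq (cder_ext _ h) _; last by rewrite [RHS]mxE.
  by move=> y; rewrite [RHS]mxE.
rewrite mxE; apply: (@hsum_ext _ (fun l => l.+1%:R * v l.+1 i j)).
  by move=> l; rewrite mxE.
apply: (psP (der_coef_bound (ltW L0) (fun l => H l i j))); last lra.
by rewrite mulr_ge0// ltW.
Qed.

Lemma mps0 m k (v : nat -> 'M[CC R]_(m, k)) : mps v 0 = v 0%N.
Proof.
apply/matrixP => i j; rewrite mxE; apply: psE.
exists (cmod (v 0%N i j)) => [[|N]]; first by rewrite /psum big_ord0 subr0 expr0 divr1.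
rewrite /psum big_ord_recl expr0 mulr1 big1 => [|l _].
  by rewrite addr0 subrr cmod0 divr_ge0 ?cmod_ge0 ?exprn_ge0.
by rewrite exprS mul0r mulr0.
Qed.

Lemma mps_ex_bound m k (T : nat -> 'M[CC R]_m) (v : nat -> 'M[CC R]_(m, k)) tau L :
  0 <= tau -> (forall l i j, cmod (T l i j) <= tau) -> m%:R * tau <= L ->
  (forall l, v l.+1 = T l *m v l) ->
  exists C, forall l i j, cmod (v l i j) <= C * L ^+ l.
Proof.
move=> tau0 HT mL Hv.
exists (\sum_i \sum_j cmod (v 0%N i j)); set C := \sum_i _.
have L0 : 0 <= L by apply: le_trans mL; rewrite mulr_ge0.
have C0 : 0 <= C by apply: sumr_ge0 => i _; apply: sumr_ge0 => j _; exact: cmod_ge0.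
elim=> [|l IH] i j.
  rewrite expr0 mulr1 /C (bigD1 i)//= (bigD1 j)//= -addrA lerDl.
  apply: addr_ge0; apply: sumr_ge0 => u _; first exact: cmod_ge0.
  by apply: sumr_ge0 => w _; exact: cmod_ge0.
rewrite Hv mxE; apply: le_trans (cmod_sum _ _ _) _.
apply: (@le_trans _ _ (\sum_(u < m) tau * (C * L ^+ l))).
  by apply: ler_sum => u _; rewrite cmodM ler_pM ?cmod_ge0.
rewrite sumr_const card_ord -mulr_natl exprS (mulrA _ tau) (mulrCA C).
rewrite ler_wpM2r ?mulr_ge0 ?exprn_ge0//.
Qed.

Section Frobenius.
Variables (n m : nat) (B : 'M[CC R]_n) (S : 'I_n -> CC R).
Let Sd := diag_mx (\row_j S j).

(* [w = x^-sg * sum_k v_k x^k] solves [(x - S) w' = - (B + 1) w]; the horizontal section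
   is [(x - S) w], here without the factor [x^-sg]. *)
Definition frobenius_section (v : nat -> 'M[CC R]_(n, m)) x := (x%:M - Sd) *m mps v x.

Variables (sg : CC R) (v : nat -> 'M[CC R]_(n, m)) (C L : R).
Hypothesis L0 : 0 < L.
Hypothesis vB : forall l i j, cmod (v l i j) <= C * L ^+ l.
Hypothesis rec0 : sg *: (Sd *m v 0%N) = 0.
Hypothesis rec : forall k, (k.+1%:R - sg) *: (Sd *m v k.+1) =
  (k.+1%:R - sg) *: v k + B *m v k.

Lemma shiftmx_diag x : x%:M - Sd = diag_mx (\row_j (x - S j)).
Proof.
apply/matrixP => i j; rewrite !mxE; case: eqVneq => [->|_] //=; rewrite ?mulr1n//.
by rewrite !mulr0n subr0.
Qed.

Lemma okubo_frobenius x : (forall j, x != S j) ->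
  okubo B S x *m frobenius_section v x = B *m mps v x.
Proof.
move=> xS; rewrite /okubo /frobenius_section -mulmxA; congr (_ *m _).
rewrite shiftmx_diag mulmxA mulmx_diag.
rewrite (_ : \row_j _ = const_mx 1); first by rewrite diag_const_mx mul1mx.
by apply/rowP => j; rewrite !mxE mulVf// subr_eq0.
Qed.

(** The hypotheses [rec0] and [rec] compare coefficients in [(x - S) w' = - (B + 1) w]; the step
    [key] turns them back into an identity of sums by [mhsum_uniq]. The term [sg / x] makes up for
    the omitted factor [x^-sg]. *)
Lemma frobenius_der x : 4 * L * cmod x < 1 -> (forall j, x != S j) -> x != 0 ->
  mder (frobenius_section v) x
    ((sg / x) *: frobenius_section v x - okubo B S x *m frobenius_section v x).
Proof.
move=> Lx xS x0.
have [D hD sD] := mps_der L0 vB Lx.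
have sg_ : mhsum v x (mps v x).
  by apply: (mpsP vB); rewrite ?ltW//; have := cmod_ge0 x; nra.
set g := mps v x in sg_ *.
have xD : mhsum (fun k => k%:R *: v k) x (x *: D).
  have := @mhsum_shift _ _ (fun k => k%:R *: v k) x D sD.
  by rewrite scale0r add0r.
have key : Sd *m (x *: D - sg *: g) = x *: (x *: D + (1 - sg) *: g + B *m g).
  apply: (@mhsum_uniq _ _ (fun k => Sd *m (k%:R *: v k + (- sg) *: v k)) x).
    rewrite -scaleNr; exact: (mhsumM _ (mhsumD xD (mhsumZ _ sg_))).
  have h : mhsum (fun k => k%:R *: v k + (1 - sg) *: v k + B *m v k) x
      (x *: D + (1 - sg) *: g + B *m g).
    exact: (mhsumD (mhsumD xD (mhsumZ _ sg_)) (mhsumM _ sg_)).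
  have := @mhsum_shift _ _ (fun k => Sd *m (k%:R *: v k + (- sg) *: v k)) x.
  move=> /(_ (x *: D + (1 - sg) *: g + B *m g)).
  rewrite /= scale0r add0r -scalemxAr scaleNr rec0 oppr0 add0r; apply.
  apply: mhsum_ext h => k.
  rewrite /= -[in RHS]scalerDl -scalemxAr rec; congr (_ + _).
  by rewrite -!scalerDl -natr1; congr (_ *: _); ring.
have hA : mder (fun y : CC R => y%:M - Sd) x 1%:M.
  move=> i j; rewrite !mxE.
  apply: (@cder_ext _ (fun y => (i == j)%:R * y - Sd i j)).
    by move=> y; rewrite !mxE mulr_natl.
  apply: cder_eq (cderB (cderZ _ (cder_id x)) (cder_cst _ x)) _.
  by rewrite subr0 mulr1.
apply: mder_eq (mderM hA hD) _.
rewrite okubo_frobenius// /frobenius_section -/g mul1mx.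
apply: (scalerI x0); rewrite scalerBr scalerA mulrCA mulfV// mulr1 scalerDr.
rewrite !mulmxBl !mul_scalar_mx.
move: key; rewrite mulmxBr -scalemxAr -scalemxAr.
move=> /(canRL (subrK _)) key; rewrite [x *: (x *: D - _)]scalerBr key.
apply/matrixP => i j; rewrite !mxE; ring.
Qed.

End Frobenius.
End MatrixCalculus.

(** * Local solutions *)

Section LocalSolutions.
Context {R : realType}.
Implicit Types (x y z p : CC R).

Lemma mhsum_at0 m k (v : nat -> 'M[CC R]_(m, k)) : mhsum v 0 (v 0%N).
Proof.
move=> i j; exists (cmod (v 0%N i j)) => [[|N]].
  by rewrite /psum big_ord0 subr0 expr0 divr1.
rewrite /psum big_ord_recl expr0 mulr1 big1 => [|l _].
  by rewrite addr0 subrr cmod0 divr_ge0 ?cmod_ge0 ?exprn_ge0.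
by rewrite exprS mul0r mulr0.
Qed.

Definition hsol n m (B : 'M[CC R]_n) (s : 'I_n -> CC R)
    (Z : CC R -> 'M[CC R]_(n, m)) x :=
  mder Z x (- (okubo B s x *m Z x)).

Lemma okubo_shift n (B : 'M[CC R]_n) (s : 'I_n -> CC R) p x :
  okubo B (fun j => s j - p) (x - p) = okubo B s x.
Proof.
rewrite /okubo; congr (_ *m diag_mx _); apply/rowP => j; rewrite !mxE.
by rewrite opprB addrA subrK.
Qed.

Lemma entry_bound m k (A : 'M[CC R]_(m, k)) :
  exists2 b : R, 0 <= b & forall i j, cmod (A i j) <= b.
Proof.
have ge0 i : 0 <= \sum_j cmod (A i j) by apply: sumr_ge0 => j _; exact: cmod_ge0.
exists (\sum_i \sum_j cmod (A i j)); first by apply: sumr_ge0.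
move=> i j; rewrite (bigD1 i)//= (bigD1 j)//= -addrA lerDl addr_ge0//.
  by apply: sumr_ge0 => u _; exact: cmod_ge0.
by apply: sumr_ge0.
Qed.

Lemma diag_mxM_entry n m (d : 'rV[CC R]_n) (A : 'M[CC R]_(n, m)) i j :
  (diag_mx d *m A) i j = d 0 i * A i j.
Proof. by rewrite mul_diag_mx mxE. Qed.

(** A Frobenius series with [sg = 0]: away from the poles the diagonal matrix [S] is invertible and
    the recursion can be solved freely. The radius is a multiple of [d] that depends only on [n] and
    [b]; this uniformity makes continuation along a whole segment possible. *)
Lemma local_hsol n m (B : 'M[CC R]_n) (s : 'I_n -> CC R) (b d : R) p (Z0 : 'M[CC R]_(n, m)) :
  0 <= b -> (forall i j, cmod (B i j) <= b) -> 0 < d ->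
  (forall j, d <= cmod (s j - p)) ->
  exists2 Z, Z p = Z0 &
    forall x, 4 * (n.+1%:R * (1 + b)) * cmod (x - p) < d -> hsol B s Z x.
Proof.
move=> b0 Bb d0 sd; pose S j := s j - p.
have S0 j : S j != 0 by rewrite -cmod_gt0; apply: lt_le_trans (sd j).
pose V := diag_mx (\row_j (S j)^-1).
have SV : diag_mx (\row_j S j) *m V = 1%:M.
  rewrite mulmx_diag (_ : \row_j _ = const_mx 1) ?diag_const_mx//.
  by apply/rowP => j; rewrite !mxE mulfV.
pose T k : 'M[CC R]_n := V *m (1%:M + k.+1%:R^-1 *: B).
(* The sign comes from the value [(0 - S) v 0] of the section at the centre, which has to be
   [Z0]. *)
pose v k : 'M[CC R]_(n, m) := iteri k (fun l w => T l *m w) (- (V *m Z0)).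
have Hv k : v k.+1 = T k *m v k by [].
pose L := n.+1%:R * (1 + b) / d.
have L0 : 0 < L by rewrite divr_gt0// mulr_gt0//; lra.
have HT k i j : cmod (T k i j) <= (1 + b) / d.
  rewrite /T diag_mxM_entry !mxE cmodM mulrC.
  apply: ler_pM; rewrite ?cmod_ge0//; last first.
    by rewrite cmodV lef_pV2 ?posrE ?cmod_gt0//; exact: sd.
  apply: le_trans (cmodD _ _) _; apply: lerD.
    by case: (i == j); rewrite ?mulr1n ?mulr0n ?cmod1 ?cmod0.
  rewrite cmodM cmodV natc cmod_rc normr_nat.
  apply: le_trans _ (Bb i j); rewrite ler_piMl ?cmod_ge0// invf_le1// ler1n//.
have [||C vB] := mps_ex_bound (T := T) (v := v) (tau := (1 + b) / d) (L := L) _ HT _ Hv.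
- by rewrite divr_ge0 ?ltW//; lra.
- by rewrite /L mulrA ler_wpM2r ?invr_ge0 ?(ltW d0)// ler_wpM2r ?ler_nat//; lra.
have rec k : (k.+1%:R - 0) *: (diag_mx (\row_j S j) *m v k.+1) =
  (k.+1%:R - 0) *: v k + B *m v k.
  rewrite subr0 Hv /T mulmxA mulmxA SV mul1mx mulmxDl mul1mx scalerDr.
  by rewrite -scalemxAl scalerA mulfV ?pnatr_eq0// scale1r.
have rec0 : 0 *: (diag_mx (\row_j S j) *m v 0%N) = 0 by rewrite scale0r.
exists (fun x => frobenius_section S v (x - p)).
  rewrite subrr /frobenius_section mps0 /v /= raddf0 sub0r mulNmx mulmxN opprK.
  by rewrite mulmxA SV mul1mx.
move=> x xd; apply: mder_shift; rewrite -(okubo_shift B s p); set y := x - p.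
have yL : 4 * L * cmod y < 1.
  by rewrite /L mulrA mulrAC ltr_pdivrMr// mul1r.
have yS j : y != S j.
  apply: contraTneq xd => yS; rewrite -leNgt -/y yS; apply: le_trans (sd j) _.
  rewrite ler_peMl ?cmod_ge0// -natr1; have := ler0n R n; nra.
(* The centre is excluded in [frobenius_der]; there the derivative is read off from the coefficients
   [v 0] and [v 1]. *)
have [->|y0] := eqVneq y 0; last first.
  apply: mder_eq (frobenius_der L0 vB rec0 rec yL yS y0) _.
  by rewrite mul0r scale0r sub0r.
rewrite okubo_frobenius; last by move=> j; rewrite eq_sym S0.
have [D hD sD] : exists2 D, mder (mps v) 0 D & mhsum (fun l => l.+1%:R *: v l.+1) 0 D.
  by apply: mps_der L0 vB _; rewrite cmod0 mulr0.
have DE : D = v 1%N.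
  rewrite -[RHS]scale1r.
  exact: mhsum_uniq sD (mhsum_at0 (fun l => l.+1%:R *: v l.+1)).
have hA : mder (fun y : CC R => y%:M - diag_mx (\row_j S j)) 0 1%:M.
  move=> i j; rewrite !mxE.
  apply: (@cder_ext _ (fun y => (i == j)%:R * y - diag_mx (\row_j S j) i j)).
    by move=> z; rewrite !mxE mulr_natl.
  apply: cder_eq (cderB (cderZ _ (cder_id 0)) (cder_cst _ 0)) _.
  by rewrite subr0 mulr1.
apply: mder_eq (mderM hA hD) _.
rewrite raddf0 sub0r mulNmx mul1mx DE mps0.
have := rec 0%N; rewrite subr0 !scale1r => ->.
by rewrite opprD addNKr.
Qed.

Lemma cder_prod_ex I (r : seq I) (F : I -> CC R -> CC R) x :
  (forall i, exists d, cder (F i) x d) ->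
  exists d, cder (fun y => \prod_(i <- r) F i y) x d.
Proof.
move=> h; elim: r => [|i r [d IH]].
  by exists 0; apply: cder_ext (cder_cst 1 x) => y; rewrite big_nil.
have [di hi] := h i.
by eexists; apply: cder_ext (cderM hi IH) => y; rewrite big_cons.
Qed.

Lemma det_der n (Z : CC R -> 'M[CC R]_n) x D : mder Z x D ->
  exists d, cder (fun y => \det (Z y)) x d.
Proof.
move=> h.
have /choice[d hd] (g : {perm 'I_n}) : exists d, cder (fun y => (-1) ^+ g * \prod_i Z y i (g i)) x d.
  have [d hd] := cder_prod_ex (index_enum 'I_n) (fun i => ex_intro _ _ (h i (g i))).
  by eexists; apply: cderZ hd.
by eexists; apply: cder_sum hd.
Qed.

Lemma unitmx_near n (Z : CC R -> 'M[CC R]_n) x D : mder Z x D ->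
  Z x \in unitmx ->
  exists2 r : R, 0 < r & forall y, cmod (y - x) < r -> Z y \in unitmx.
Proof.
move=> /det_der[d hd]; rewrite unitmxE unitfE -cmod_gt0 => m0.
have [r r0 h] := cder_cont hd m0; exists r => // y /h.
rewrite unitmxE unitfE -cmod_gt0 => h1.
have := cmod_tri (\det (Z x)) (\det (Z y)) 0; rewrite !subr0 cmodB.
by move: (cmod _) (cmod _) (cmod _) h1 => t u v; lra.
Qed.

(** The way to propagate a corank of at most one to nearby points: a suitable rank-one perturbation
    is invertible, and invertibility is an open condition. *)
Lemma rank_rank1_perturb n (A E : 'M[CC R]_n) : (\rank E <= 1)%N ->
  A + E \in unitmx -> (n.-1 <= \rank A)%N.
Proof.
move=> E1; rewrite -row_full_unit /row_full => /eqP AE.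
have := mxrankS (addmx_sub_adds (submx_refl A) (submx_refl E)).
rewrite AE => /leq_trans /(_ (mxrank_adds_leqif A E)).
lia.
Qed.

Section AtPole.
Variables (n m : nat) (B : 'M[CC R]_n) (S : 'I_n -> CC R) (i : 'I_n).
Variables (sg : CC R) (eta : R) (v0 : 'M[CC R]_(n, m)).
Hypothesis Si : S i = 0.
Hypothesis Sj : forall j, j != i -> S j != 0.
Let Sd := diag_mx (\row_j S j).
Let a k : CC R := k.+1%:R - sg.
(** This is [a k.+1 + B i i], the coefficient of row [i] of [v_{k+1}] in the constraint which that
    row has to satisfy. *)
Let c k : CC R := k.+2%:R - sg + B i i.
Hypothesis a0 : forall k, a k != 0.
Hypothesis c0 : forall k, c k != 0.
Hypothesis eta0 : 0 <= eta.
Hypothesis aeta : forall k, cmod (a k)^-1 <= eta.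
Hypothesis ceta : forall k, cmod (c k)^-1 <= eta.
Hypothesis inv0 : forall j, (1 - sg) * v0 i j + (B *m v0) i j = 0.

(* Row [i] of the recursion carries no information about [v_{k+1}] because [S_i = 0];
   it is instead a constraint on [v_k], preserved by the choice of row [i] of [T]. *)
Lemma pole_recursion : exists v C L, [/\ v 0%N = v0, 0 < L,
  forall l u j, cmod (v l u j) <= C * L ^+ l &
  forall k, a k *: (Sd *m v k.+1) = a k *: v k + B *m v k].
Proof.
have [b b0 Bb] := entry_bound B.
(* Since [S i = 0] and [0^-1 = 0], row [i] of [V] vanishes, while [V] inverts [Sd] on the other
   coordinates. *)
pose V := diag_mx (\row_j (S j)^-1).
have [u u0 Vu] := entry_bound V.
pose P k := V *m (1%:M + (a k)^-1 *: B).
have Vrow j l (A : 'M[CC R]_(n, l)) w : (V *m A) j w = (S j)^-1 * A j w.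
  by rewrite diag_mxM_entry mxE.
pose T k : 'M[CC R]_n := P k - (c k)^-1 *: (delta_mx i i *m (B *m P k)).
have HP k w j : cmod (P k w j) <= u * (1 + eta * b).
  rewrite Vrow cmodM; apply: ler_pM; rewrite ?cmod_ge0//.
    by have := Vu w w; rewrite !mxE eqxx mulr1n.
  rewrite !mxE; apply: le_trans (cmodD _ _) _; apply: lerD.
    by case: (w == j); rewrite ?mulr1n ?mulr0n ?cmod1 ?cmod0.
  by rewrite cmodM ler_pM ?cmod_ge0.
pose q := u * (1 + eta * b).
have q0 : 0 <= q by rewrite mulr_ge0// addr_ge0// mulr_ge0.
pose tau := q + eta * (n%:R * (b * q)).
have tau0 : 0 <= tau.
  by rewrite addr_ge0// mulr_ge0// mulr_ge0// mulr_ge0.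
have HT k w j : cmod (T k w j) <= tau.
  rewrite /T mxE [X in _ + X]mxE; apply: le_trans (cmodD _ _) _; apply: lerD; first exact: HP.
  rewrite cmodN mxE cmodM; apply: ler_pM; rewrite ?cmod_ge0//.
  rewrite delta_row cmodM; have : cmod ((w == i)%:R : CC R) <= 1.
    by case: (w == i); rewrite ?cmod1 ?cmod0.
  have : cmod ((B *m P k) i j) <= n%:R * (b * q).
    rewrite mxE; apply: le_trans (cmod_sum _ _ _) _.
    apply: (@le_trans _ _ (\sum_(l < n) b * q)).
      by apply: ler_sum => l _; rewrite cmodM ler_pM ?cmod_ge0.
    by rewrite sumr_const card_ord mulr_natl.
  have := cmod_ge0 ((w == i)%:R : CC R); have := cmod_ge0 ((B *m P k) i j).
  nra.
have [v Hv v00] : exists2 v : nat -> 'M[CC R]_(n, m),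
    (forall k, v k.+1 = T k *m v k) & v 0%N = v0.
  by exists (fun k => iteri k (fun l w => T l *m w) v0).
have Piv k l (A : 'M[CC R]_(n, l)) w : (P k *m A) i w = 0.
  by rewrite -mulmxA Vrow Si invr0 mul0r.
have Hvi k w : v k.+1 i w = - ((c k)^-1 * (B *m (P k *m v k)) i w).
  by rewrite Hv /T mulmxBl mxE Piv add0r mxE -scalemxAl mxE -!mulmxA delta_row eqxx mul1r.
have Hvj k j w : j != i -> v k.+1 j w = (P k *m v k) j w.
  move=> ji; rewrite Hv /T mulmxBl mxE [X in _ + X]mxE -scalemxAl [X in _ - X]mxE.
  rewrite -!mulmxA delta_row.
  by rewrite (negbTE ji) mul0r mulr0 subr0.
have inv k j : a k * v k i j + (B *m v k) i j = 0.
  case: k => [|k]; first by rewrite v00; exact: inv0.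
  have -> : (B *m v k.+1) i j = (B *m (P k *m v k)) i j + B i i * v k.+1 i j.
    rewrite mxE [in RHS]mxE (bigD1 i)//= [in RHS](bigD1 i)//= Piv mulr0 add0r addrC.
    by congr (_ + _); apply: eq_bigr => l li; rewrite Hvj.
  rewrite addrCA -mulrDl -[a k.+1 + _]/(c k) Hvi mulrN mulrA mulfV// mul1r.
  by rewrite subrr.
have [|C vB] := mps_ex_bound (T := T) (v := v) (tau := tau) (L := n%:R * tau + 1)
  tau0 HT _ Hv; first by rewrite lerDl.
exists v, C, (n%:R * tau + 1); split => //.
  by rewrite ltr_wpDl// mulr_ge0.
move=> k; apply/matrixP => j w; have [->|ji] := eqVneq j i.
  rewrite [LHS]mxE diag_mxM_entry [in LHS]mxE Si mul0r mulr0.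
  by rewrite -[LHS](inv k w) [RHS]mxE [in RHS]mxE.
rewrite [LHS]mxE diag_mxM_entry [in LHS]mxE Hvj// -mulmxA Vrow.
rewrite mulVKf ?Sj// mulmxDl mul1mx -scalemxAl [in LHS]mxE mulrDr.
rewrite [in X in _ + X]mxE mulrA mulfV// mul1r.
by rewrite [RHS]mxE [in RHS]mxE.
Qed.

End AtPole.
End LocalSolutions.

(** * Local exponents at a pole for the matrix [B = ka (J + 1)] *)

Section SpecialResidues.
Context {R : realType}.
Implicit Types (x y z p : CC R).

Definition resB n (ka : R) : 'M[CC R]_n := rc ka *: (const_mx 1 + 1%:M).

Lemma resBE n ka (i j : 'I_n) : resB n ka i j = rc (ka * (1 + (i == j)%:R)).
Proof. by rewrite !mxE rcM rcD /rc; case: (i == j). Qed.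

Variables (n : nat) (ka : R) (s : 'I_n -> CC R).
Hypothesis ka6 : ka = 6^-1 \/ ka = - 6^-1.
Hypothesis s_inj : injective s.
Let B := resB n ka.

(** The residue at [s i] has eigenvalues 0 and [2 ka], which correspond to the two values of [sg].
    As [2 ka] is [1/3] or [-1/3], every divisor in the recursion has modulus at least [1/3]; hence
    the bound 3 on the inverses and the absence of logarithms. *)
Lemma pole_section m (i : 'I_n) (sg : R) (v0 : 'M[CC R]_(n, m)) :
  sg = 0 \/ sg = 1 + 2 * ka ->
  rc sg *: (diag_mx (\row_j (s j - s i)) *m v0) = 0 ->
  (forall j, (1 - rc sg) * v0 i j + (B *m v0) i j = 0) ->
  exists v r, [/\ 0 < r, v 0%N = v0, exists D, mder (mps v) 0 D &
    forall x, x != 0 -> cmod x < r -> (forall j, x != s j - s i) /\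
      mder (frobenius_section (fun j => s j - s i) v) x
      ((rc sg / x) *: frobenius_section (fun j => s j - s i) v x
       - okubo B (fun j => s j - s i) x *m frobenius_section (fun j => s j - s i) v x)].
Proof.
move=> sgE rec0 inv0; pose S j := s j - s i.
have Si : S i = 0 by rewrite /S subrr.
have Sj j : j != i -> S j != 0.
  by rewrite /S subr_eq0; apply: contra_neq => /s_inj.
have Bii : B i i = rc (2 * ka) by rewrite /B resBE eqxx [1 + _](_ : _ = 2)// mulrC.
have lb (k : nat) (u : R) : `|u| <= 2 / 3 -> cmod (k.+1%:R - rc u)^-1 <= 3 /\ k.+1%:R - rc u != 0.
  move=> ub; rewrite natc -rcB cmodV cmod_rc.
  have h : 3^-1 <= k.+1%:R - u.
    move: ub; rewrite ler_norml -natr1; have := ler0n R k; lra.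
  rewrite -cmod_gt0 cmod_rc ger0_norm; last lra.
  split; last lra.
  by rewrite -[leRHS]invrK lef_pV2// posrE; lra.
have ka_le : `|2 * ka| <= 2 / 3.
  by rewrite ler_norml; case: ka6 => ->; apply/andP; split; lra.
have ka_le' : `|- (2 * ka)| <= 2 / 3 by rewrite normrN.
have z_le : `|0 : R| <= 2 / 3 by rewrite normr0; lra.
have sk (k : nat) : k.+1%:R - rc sg != 0 /\ cmod (k.+1%:R - rc sg)^-1 <= 3.
  case: sgE => [->|->]; first by have [h1 h2] := lb k _ z_le.
  rewrite rcD rc1; case: k => [|k].
    rewrite opprD addrA subrr add0r cmodV cmodN oppr_eq0 -cmod_gt0 cmod_rc.
    have -> : `|2 * ka| = 3^-1.
      by case: ka6 => ->; rewrite ?mulrN ?normrN ger0_norm; lra.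
    by rewrite invrK lexx; split=> //; lra.
  have -> : k.+2%:R - (1 + rc (2 * ka)) = k.+1%:R - rc (2 * ka).
    by rewrite -[k.+2%:R]natr1; ring.
  by have [h1 h2] := lb k _ ka_le.
have ck (k : nat) : k.+2%:R - rc sg + B i i != 0 /\ cmod (k.+2%:R - rc sg + B i i)^-1 <= 3.
  rewrite Bii; case: sgE => [->|->].
    have -> : k.+2%:R - rc 0 + rc (2 * ka) = k.+2%:R - rc (- (2 * ka)).
      by rewrite rcN rc0 subr0 opprK.
    by have [h1 h2] := lb k.+1 _ ka_le'.
  have -> : k.+2%:R - rc (1 + 2 * ka) + rc (2 * ka) = k.+1%:R - rc 0.
    by rewrite rcD rc1 rc0 -[k.+2%:R]natr1; ring.
  by have [h1 h2] := lb k _ z_le.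
have [|v [C [L [v00 L0 vB rec]]]] := pole_recursion Si Sj (fun k => proj1 (sk k))
  (fun k => proj1 (ck k)) _ (fun k => proj2 (sk k)) (fun k => proj2 (ck k)) inv0; first lra.
have [d d0 dS] : exists2 d : R, 0 < d & forall j, j != i -> d <= cmod (S j).
  have h : exists d : R, 0 < d /\ forall j, j \in enum 'I_n -> j != i -> d <= cmod (S j).
    elim: (enum 'I_n) => [|j l [d [d0 hd]]]; first by exists 1.
    have [ji|ji] := eqVneq j i.
      by exists d; split=> // u; rewrite inE => /orP[/eqP->|/hd//]; rewrite ji eqxx.
    exists (Num.min d (cmod (S j))); rewrite lt_min d0 cmod_gt0 Sj//; split=> // u.
    by rewrite inE ge_min => /orP[/eqP->|/hd h /h ->]; rewrite ?lexx ?orbT.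
  by have [d [d0 hd]] := h; exists d => // j; apply: hd; rewrite mem_enum.
exists v, (Num.min d (4 * L)^-1); rewrite lt_min d0 invr_gt0 mulr_gt0//; split=> //.
- have [D hD _] : exists2 D, mder (mps v) 0 D & mhsum (fun l => l.+1%:R *: v l.+1) 0 D.
    by apply: mps_der L0 vB _; rewrite cmod0 mulr0.
  by exists D.
- move=> x x0; rewrite lt_min => /andP[xd xL].
  have xS j : x != S j.
    have [->|ji] := eqVneq j i; first by rewrite Si.
    by apply: contraTneq xd => ->; rewrite -leNgt dS.
  split=> //; apply: (frobenius_der L0 vB _ rec) => //.
    by rewrite v00; exact: rec0.
  by move: xL; rewrite -div1r ltr_pdivlMr ?mulr_gt0// mulrC.
Qed.

(** The sections of exponent 0, which are single-valued around [s i]. Row [i] of [v0] is dictated by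
    the constraint of [pole_recursion], the other rows are free. The value at the pole is [- Sd],
    and subtracting [E] makes it invertible, which persists nearby. *)
Lemma frobenius_rank (i : 'I_n) : exists r (h : CC R -> 'M[CC R]_n), [/\ 0 < r,
  forall x, x != s i -> cmod (x - s i) < r -> hsol B s h x &
  forall x, cmod (x - s i) < r -> (n.-1 <= \rank (h x))%N].
Proof.
pose S j := s j - s i; pose Sd := diag_mx (\row_j S j).
pose E : 'M[CC R]_n := delta_mx i i.
have Si : S i = 0 by rewrite /S subrr.
have Bii : B i i = rc (2 * ka) by rewrite /B resBE eqxx [1 + _](_ : _ = 2)// mulrC.
have c0 : 1 + B i i != 0.
  rewrite Bii -rc1 -rcD -cmod_gt0 cmod_rc gtr0_norm; case: ka6 => ->; lra.
pose v0 : 'M[CC R]_n := (1%:M - E) - (1 + B i i)^-1 *: (E *m (B *m (1%:M - E))).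
have Erow (A : 'M[CC R]_n) j w : (E *m A) j w = (j == i)%:R * A i w.
  rewrite mxE (bigD1 i)//= big1 ?addr0; last first.
    by move=> q qi; rewrite mxE (negbTE qi) andbF mul0r.
  by rewrite mxE eqxx andbT.
have SdE : Sd *m E = 0.
  apply/matrixP => j w; rewrite diag_mxM_entry !mxE.
  by case: eqVneq => [->|]; rewrite ?Si ?mul0r// mulr0.
have Sdv0 : Sd *m v0 = Sd.
  rewrite /v0 [LHS]mulmxBr -scalemxAr [Sd *m (E *m _)]mulmxA SdE mul0mx scaler0 subr0.
  by rewrite mulmxBr mulmx1 SdE subr0.
have v0i j : v0 i j = - ((1 + B i i)^-1 * (B *m (1%:M - E)) i j).
  rewrite /v0 mxE [X in _ + X]mxE [X in _ - X]mxE Erow eqxx mul1r.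
  have -> : (1%:M - E) i j = 0 by rewrite !mxE eqxx /= [j == i]eq_sym subrr.
  by rewrite add0r.
have Ev0 : v0 = (1%:M - E) + E *m v0.
  rewrite {2}/v0 mulmxBr -scalemxAr [E *m (E *m _)]mulmxA mul_delta_mx.
  by rewrite [E *m (1%:M - E)]mulmxBr mulmx1 mul_delta_mx subrr sub0r.
have Bv0 j : (B *m v0) i j = (B *m (1%:M - E)) i j + B i i * v0 i j.
  rewrite {1}Ev0 mulmxDr mxE; congr (_ + _).
  rewrite mxE (bigD1 i)//= big1 ?addr0 => [|q qi]; first by rewrite Erow eqxx mul1r.
  by rewrite Erow (negbTE qi) mul0r mulr0.
have [|j|v [r [r0 v00 [D hD hv]]]] := @pole_section n i 0 v0 (or_introl erefl).
- by rewrite rc0 scale0r.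
- rewrite rc0 subr0 mul1r Bv0 addrCA -[X in _ + (X + _)]mul1r -mulrDl v0i mulrN mulrA.
  by rewrite mulfV// mul1r subrr.
pose h x := frobenius_section S v (x - s i).
have h0 : mder h (s i) (v0 - Sd *m D).
  apply: mder_shift; rewrite subrr.
  have hA : mder (fun y : CC R => y%:M - Sd) 0 1%:M.
    move=> j k; rewrite !mxE.
    apply: (@cder_ext _ (fun y => (j == k)%:R * y - Sd j k)).
      by move=> z; rewrite !mxE mulr_natl.
    apply: cder_eq (cderB (cderZ _ (cder_id 0)) (cder_cst _ 0)) _.
    by rewrite subr0 mulr1.
  apply: mder_eq (mderM hA hD) _.
  by rewrite raddf0 sub0r mulNmx mul1mx mps0 v00.
have hE : mder (fun x => h x - E) (s i) (v0 - Sd *m D + 0).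
  by apply: mderD => //; exact: mder_cst.
have hsi : h (s i) = - Sd.
  by rewrite /h subrr /frobenius_section mps0 v00 raddf0 sub0r mulNmx Sdv0.
have uE : h (s i) - E \in unitmx.
  rewrite hsi -opprD -scaleN1r unitmxZ ?unitrN1// unitmxE.
  have -> : Sd + E = diag_mx (\row_j (S j + (j == i)%:R)).
    apply/matrixP => j k; rewrite !mxE.
    case: (eqVneq j k) => [->|jk]; first by rewrite !mulr1n andbb.
    rewrite !mulr0n add0r; case: (eqVneq j i) => //= ji.
    by rewrite -ji eq_sym (negbTE jk).
  rewrite det_diag unitfE; apply/prodf_neq0 => j _; rewrite mxE.
  case: (eqVneq j i) => [->|ji]; first by rewrite Si add0r oner_eq0.
  by rewrite addr0 subr_eq0; apply: contra_neq ji => /s_inj.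
have [r' r'0 hu] := unitmx_near hE uE.
exists (Num.min r r'), h; split; first by rewrite lt_min r0.
  move=> x xi; rewrite lt_min => /andP[xr _].
  have [|xS hd] := hv (x - s i) _ xr; first by rewrite subr_eq0.
  apply: mder_shift; apply: mder_eq hd _.
  by rewrite mul0r scale0r sub0r okubo_shift.
move=> x; rewrite lt_min => /andP[_ /hu].
apply: rank_rank1_perturb; rewrite mxrank_opp mxrank_delta//.
Qed.

(** The section of exponent [- 2 ka]. The series has [sg = 1 + 2 ka] and starts with the basis
    vector [e_i], on which [x - S] acts as [x - s i]; dividing by [x - s i] shifts the exponent by
    one. Coordinate [i] is then close to 1, so the section is nonzero. *)
Lemma frobenius_vector (i : 'I_n) : exists r (h : CC R -> 'M[CC R]_(n, 1)), [/\ 0 < r,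
  forall x, x != s i -> cmod (x - s i) < r ->
    mder h x ((rc (2 * ka) / (x - s i)) *: h x - okubo B s x *m h x) &
  forall x, x != s i -> cmod (x - s i) < r -> h x != 0].
Proof.
pose S j := s j - s i; pose Sd := diag_mx (\row_j S j).
have Si : S i = 0 by rewrite /S subrr.
have Bii : B i i = rc (2 * ka) by rewrite /B resBE eqxx [1 + _](_ : _ = 2)// mulrC.
pose v0 : 'M[CC R]_(n, 1) := delta_mx i 0.
have [||v [r [r0 v00 [D hD] hv]]] := @pole_section 1 i (1 + 2 * ka) v0 (or_intror erefl).
- apply/matrixP => j k; rewrite mxE diag_mxM_entry !mxE.
  by case: eqVneq => [->|]; rewrite ?subrr ?mul0r ?mulr0.
- move=> j; rewrite !mxE (bigD1 i)//= big1 => [|q qi]; last first.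
    by rewrite !mxE (negbTE qi) mulr0.
  rewrite -/(B i i) Bii mxE eqxx !ord1 eqxx !mulr1 addr0 rcD rc1; ring.
pose h0 x := frobenius_section S v (x - s i).
have [r' r'0 hg] := cder_cont (hD i 0) (ltr01 : 0 < (1 : R)).
exists (Num.min r r'), (fun x => (x - s i)^-1 *: h0 x); split; first by rewrite lt_min r0.
  move=> x xi; rewrite lt_min => /andP[xr _].
  have y0 : x - s i != 0 by rewrite subr_eq0.
  have [xS hd] := hv (x - s i) y0 xr.
  apply: mder_eq (mderZ (f := fun x => (x - s i)^-1) (df := - (x - s i) ^- 2) _ (mder_shift hd)) _.
    have := cder_comp (f := fun y => y^-1) (cderB (cder_id x) (cder_cst (s i) x)) (cderV y0).
    by rewrite subr0 mulr1.
  rewrite okubo_shift -/(h0 x) rcD rc1 -!scalemxAr scalerBr !scalerA addrA -scalerDl.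
  by congr (_ *: _ - _); field.
move=> x xi; rewrite lt_min => /andP[_ /= xr].
apply/eqP => /matrixP /(_ i 0); rewrite mxE [RHS]mxE /h0 /frobenius_section.
rewrite shiftmx_diag diag_mxM_entry mxE Si subr0 mulKf; last by rewrite subr_eq0.
move=> g0; have := hg (x - s i); rewrite subr0 => /(_ xr).
rewrite mps0 v00 g0 sub0r cmodN mxE !eqxx cmod1; lra.
Qed.

End SpecialResidues.

(** * Sections near infinity *)

Section AtInfinity.
Context {R : realType}.
Implicit Types (x y z p : CC R).
Variables (n : nat) (ka : R) (s : 'I_n -> CC R).
Hypothesis ka6 : ka = 6^-1 \/ ka = - 6^-1.
Hypothesis n_gt0 : (0 < n)%N.
Hypothesis n_le5 : (n <= 5)%N.
Let B := resB n ka.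

(* With [y = 1/(x - p)] the section is [(x - p)^-ka * (1 - y S) * sum_k v_k y^k]. *)
Lemma infinity_section p : exists R0 (h : CC R -> 'M[CC R]_n), 0 < R0 /\
  forall x, R0 < cmod (x - p) -> [/\ forall j, x != s j,
    mder h x ((rc ka / (x - p)) *: h x - okubo B s x *m h x) &
    (n.-1 <= \rank (h x))%N].
Proof.
pose S j := s j - p; pose Sd := diag_mx (\row_j S j).
pose J : 'M[CC R]_n := const_mx 1.
have JJ : J *m J = n%:R *: J.
  apply/matrixP => i j; rewrite !mxE.
  under eq_bigr do rewrite !mxE mulr1.
  by rewrite sumr_const card_ord mulr1.
have nR0 : 0 < (n%:R : R) by rewrite ltr0n.
have nR5 : n%:R <= (5 : R) by rewrite (ler_nat R n 5).
have kaE : B = rc ka *: J + (rc ka)%:M by rewrite /B /resB scalerDr scalemx1.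
pose nu : CC R := rc (n%:R * ka).
have nuE : rc ka * n%:R = nu by rewrite /nu rcM natc mulrC.
(* The eigenvalues of [ka J] are 0 and [nu = n ka]. The bound [n <= 5] keeps [nu] within [5/6] of 0,
   so [k + 1 - nu] stays at least [1/6]. *)
have nub : `|n%:R * ka| <= 5 / 6.
  by rewrite ler_norml; case: ka6 => ->; apply/andP; split; lra.
pose a k : CC R := k.+1%:R.
have a0 k : a k != 0 by rewrite pnatr_eq0.
have anu k : a k - nu != 0 /\ cmod (a k - nu)^-1 <= 6.
  have h : 6^-1 <= k.+1%:R - n%:R * ka.
    move: nub; rewrite ler_norml -natr1; have := ler0n R k; lra.
  rewrite /a natc -rcB -cmod_gt0 cmodV cmod_rc ger0_norm; last lra.
  split; first lra.
  by rewrite -[leRHS]invrK lef_pV2// posrE; lra.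
(* The recursion asks for the inverse of [a k - ka J], which [J J = n J] gives in closed form. *)
pose T k := ((a k + rc ka) / a k) *: ((1%:M + (rc ka / (a k - nu)) *: J) *m Sd).
(* The projection onto the kernel of [J], which is the eigenspace of [B] for [ka]; it has corank
   one. *)
pose v0 : 'M[CC R]_n := 1%:M - n%:R^-1 *: J.
pose v k : 'M[CC R]_n := iteri k (fun l w => T l *m w) v0.
have Hv k : v k.+1 = T k *m v k by [].
have nC0 : (n%:R : CC R) != 0 by rewrite pnatr_eq0 -lt0n.
have Jv0 : J *m v0 = 0.
  by rewrite /v0 mulmxBr mulmx1 -scalemxAr JJ scalerA mulVf// scale1r subrr.
have rec k : (a k + rc ka) *: v k.+1 - B *m v k.+1 = (a k + rc ka) *: (Sd *m v k).
  have [ak _] := anu k.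
  have E : (a k + rc ka) *: 1%:M - B = (a k)%:M - rc ka *: J.
    by rewrite kaE scalerDl !scalemx1 opprD addrACA subrr addr0.
  have -> : (a k + rc ka) *: v k.+1 - B *m v k.+1 = ((a k)%:M - rc ka *: J) *m v k.+1.
    by rewrite -E mulmxBl -[(_ *: 1%:M) *m _]scalemxAl mul1mx.
  rewrite Hv /T -!scalemxAl -scalemxAr !mulmxA.
  have -> : ((a k)%:M - rc ka *: J) *m (1%:M + (rc ka / (a k - nu)) *: J) = (a k)%:M.
    rewrite mulmxBl mul_scalar_mx mulmxDr mulmx1 -scalemxAr -scalemxAl JJ scalerDr.
    apply/matrixP => i j; rewrite !mxE -[RHS]mulr_natr; move: (i == j)%:R ak => t.
    by rewrite -nuE; move: (rc ka) (a k) (n%:R) => u1 u2 u3 h; field.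
  by rewrite mul_scalar_mx -scalemxAl scalerA divfK.
have v00 : v 0%N = v0 by [].
clearbody v.
have [b b0 Sb] := entry_bound Sd.
have [tau tau0 HT] : exists2 tau : R, 0 <= tau & forall k i j, cmod (T k i j) <= tau.
  exists (2 * (2 * b)); first by lra.
  move=> k i j; rewrite mxE cmodM; apply: ler_pM; rewrite ?cmod_ge0//.
    rewrite mulrDl mulfV//; apply: le_trans (cmodD _ _) _; rewrite cmod1.
    rewrite cmodM cmodV /a natc !cmod_rc [`|k.+1%:R|]ger0_norm//.
    have : `|ka| / k.+1%:R <= 1.
      rewrite ler_pdivrMr// mul1r -natr1.
      have := ler0n R k; case: ka6 => ->; rewrite ?normrN ger0_norm; lra.
    by move=> h; rewrite [leRHS](_ : 2 = 1 + 1)// lerD2l.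
  rewrite /Sd mul_mx_diag mxE.
  have Sjj : cmod (S j) <= b by have := Sb j j; rewrite !mxE eqxx mulr1n.
  rewrite mxE cmodM; apply: ler_pM; rewrite ?cmod_ge0//; last by rewrite mxE.
  rewrite !mxE mulr1; apply: le_trans (cmodD _ _) _.
  have : cmod (((i == j)%:R) : CC R) <= 1 by case: (i == j); rewrite ?cmod1 ?cmod0.
  have : cmod (rc ka / (a k - nu)) <= 1.
    rewrite cmodM cmod_rc; have [_ h] := anu k.
    have := cmod_ge0 (a k - nu)^-1.
    have -> : `|ka| = 6^-1 by case: ka6 => ->; rewrite ?normrN ger0_norm//; lra.
    lra.
  rewrite -mulr_natr mul1r; lra.
(* The summand 1 makes the growth rate positive, and the summand [b] puts all poles inside the
   excluded disc. *)
have [|C vB] := mps_ex_bound (T := T) (v := v) (tau := tau) (L := n%:R * tau + 1 + b)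
  tau0 HT _ Hv; first lra.
set L := n%:R * tau + 1 + b in vB.
have nt0 : 0 <= n%:R * tau := mulr_ge0 (ler0n R n) tau0.
have L1 : 1 <= L by rewrite /L -addrA addrCA lerDl addr_ge0.
have L0 : 0 < L by apply: lt_le_trans L1; exact: ltr01.
pose h0 y := (1%:M - y *: Sd) *m mps v y.
have hA y : mder (fun y : CC R => 1%:M - y *: Sd) y (- Sd).
  move=> i j; rewrite !mxE.
  apply: (@cder_ext _ (fun y => (i == j)%:R - Sd i j * y)).
    by move=> z; rewrite !mxE mulrC.
  apply: cder_eq (cderB (cder_cst _ y) (cderZ _ (cder_id y))) _.
  by rewrite sub0r mulr1 !mxE.
have main y : 4 * L * cmod y < 1 -> exists2 D, mder h0 y D &
    rc ka *: h0 y + y *: D = B *m mps v y.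
  move=> Ly; have [D hD sD] := mps_der L0 vB Ly.
  have sg : mhsum v y (mps v y).
    by apply: (mpsP vB); rewrite ?ltW//; have := cmod_ge0 y; nra.
  eexists; first exact: mderM (hA y) hD.
  set g := mps v y in sg *.
  have yD : mhsum (fun k => k%:R *: v k) y (y *: D).
    have := @mhsum_shift _ _ _ (fun k => k%:R *: v k) y D sD.
    by rewrite scale0r add0r.
  have key : (y *: D + rc ka *: g) - B *m g = y *: (Sd *m (y *: D + (1 + rc ka) *: g)).
    apply: (@mhsum_uniq _ _ _ (fun k => (k%:R *: v k + rc ka *: v k) + (- 1) *: (B *m v k)) y).
      rewrite -[- (B *m g)]scaleN1r; apply: mhsumD; last by apply: mhsumZ; apply: mhsumM.
      exact: (mhsumD yD (mhsumZ _ sg)).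
    have hh : mhsum (fun k => Sd *m (k%:R *: v k + (1 + rc ka) *: v k)) y
        (Sd *m (y *: D + (1 + rc ka) *: g)).
      exact: (mhsumM _ (mhsumD yD (mhsumZ _ sg))).
    have := @mhsum_shift _ _ _ (fun k => (k%:R *: v k + rc ka *: v k) + (- 1) *: (B *m v k)) y.
    move=> /(_ (Sd *m (y *: D + (1 + rc ka) *: g))) /=.
    rewrite v00 scale0r add0r scaleN1r kaE mulmxDl -scalemxAl Jv0 scaler0 add0r.
    rewrite mul_scalar_mx subrr add0r -kaE; apply.
    apply: mhsum_ext hh => k.
    rewrite scaleN1r -[in RHS]scalerDl -/(a k) [in RHS]rec.
    by rewrite -scalerDl -scalemxAr /a -natr1 addrA.
  have -> : B *m g = (y *: D + rc ka *: g) - y *: (Sd *m (y *: D + (1 + rc ka) *: g)).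
    by rewrite -key subKr.
  rewrite /h0 -/g mulmxBl mul1mx mulNmx mulmxBl mul1mx -!scalemxAl.
  rewrite mulmxDr -!scalemxAr.
  move: (D) (Sd *m D) (Sd *m g) => D' U W; apply/matrixP => i j; rewrite !mxE.
  by move: (D' i j) (g i j) (U i j) (W i j) => t1 t2 t3 t4; ring.
have uv : v0 + n%:R^-1 *: J \in unitmx by rewrite /v0 subrK unitmx1.
have [|D0 hD0 _] := main 0; first by rewrite cmod0 mulr0.
have h00 : h0 0 = v0 by rewrite /h0 mps0 v00 scale0r subr0 mul1mx.
have [r r0 hu] : exists2 r : R, 0 < r &
    forall y, cmod (y - 0) < r -> h0 y + n%:R^-1 *: J \in unitmx.
  apply: (unitmx_near (mderD hD0 (mder_cst (n%:R^-1 *: J) 0))).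
  by rewrite h00.
exists (4 * L + r^-1), (fun x => h0 (x - p)^-1); split.
  by rewrite addr_gt0 ?invr_gt0 ?mulr_gt0.
move=> x xR.
have ri : 0 < r^-1 by rewrite invr_gt0.
have m0 : 0 < cmod (x - p) by lra.
have y0 : x - p != 0 by rewrite -cmod_gt0.
have Ly : 4 * L * cmod (x - p)^-1 < 1 by rewrite cmodV ltr_pdivrMr// mul1r; lra.
have xs j : x - p != S j.
  apply: contraTneq xR => ->; rewrite -leNgt.
  have Sjj : cmod (S j) <= b by have := Sb j j; rewrite !mxE eqxx mulr1n.
  have bL : b <= L by rewrite /L lerDr addr_ge0.
  lra.
split.
- by move=> j; apply: contra_neq (xs j) => ->.
- have [D hD DE] := main _ Ly.
  have hinv : cder (fun y => (y - p)^-1) x (- (x - p) ^- 2).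
    have := cder_comp (f := fun y => y^-1) (cderB (cder_id x) (cder_cst p x)) (cderV y0).
    by rewrite subr0 mulr1.
  apply: mder_eq (mder_comp hinv hD) _.
  rewrite -(okubo_shift B s p) /okubo -mulmxA /h0 [diag_mx _ *m _]mulmxA.
  have -> : diag_mx (\row_j (x - p - (s j - p))^-1) *m (1%:M - (x - p)^-1 *: Sd) =
      (x - p)^-1 *: 1%:M.
    rewrite /Sd scale_scalar_mx mulr1.
    apply/matrixP => i j; rewrite diag_mxM_entry !mxE.
    case: eqVneq => [->|_]; last by rewrite !mulr0n mulr0 subr0 mulr0.
    rewrite !mulr1n; have := xs j; rewrite -subr_eq0 /S => hx.
    by field; rewrite y0 hx.
  rewrite -[(_ *: 1%:M) *m _]scalemxAl mul1mx -[B *m (_ *: _)]scalemxAr -DE scalerDr !scalerA -/(h0 _).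
  rewrite opprD mulrC addrA subrr add0r -scaleNr.
  by congr (_ *: _); field.
- apply: (rank_rank1_perturb (E := n%:R^-1 *: J)).
    apply: leq_trans (mxrank_scale _ _) _.
    rewrite (_ : J = (const_mx 1 : 'cV_n) *m (const_mx 1 : 'rV_n)).
      exact: leq_trans (mxrankM_maxl _ _) (rank_leq_col _).
    by apply/matrixP => i j; rewrite !mxE big_ord1 !mxE mulr1.
  apply: hu; rewrite subr0 cmodV -[r]invrK ltf_pV2 ?posrE//; lra.
Qed.

End AtInfinity.

(** * Fundamental solutions on star-shaped domains *)

Section StarDomains.
Context {R : realType}.
Implicit Types (x y z p c : CC R) (O N : CC R -> Prop).

(** A product of numbers truncated at 1 lies below each of its factors; this also covers [n = 0]. *)
Lemma finite_min n (f : 'I_n -> R) : (forall j, 0 < f j) ->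
  exists2 d : R, 0 < d & forall j, d <= f j.
Proof.
move=> f0; exists (\prod_j Num.min 1 (f j)).
  by apply: prodr_gt0 => j _; rewrite lt_min ltr01 f0.
move=> j; rewrite (bigD1 j)//=.
apply: (@le_trans _ _ (Num.min 1 (f j))); last by rewrite ge_min lexx orbT.
rewrite ler_piMr//; first by rewrite le_min ler01 ltW.
by apply: prodr_ile1 => i _; rewrite le_min ler01 (ltW (f0 i)) ge_min lexx.
Qed.

(** Row solutions of [Y' = Y Om]. Their products with horizontal sections have derivative zero, and
    this pairing carries all comparisons of solutions. *)
Definition dsol n m (B : 'M[CC R]_n) (s : 'I_n -> CC R)
    (Y : CC R -> 'M[CC R]_(m, n)) x :=
  mder Y x (Y x *m okubo B s x).

(** The dual of an Okubo system is again one: transposition exchanges [B] and the diagonal factor,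
    and [invmx B] restores their order. So one existence result yields both kinds of solutions. *)
Lemma dual_hsol n m (B : 'M[CC R]_n) (s : 'I_n -> CC R) (Z : CC R -> 'M[CC R]_(n, m)) x :
  B \in unitmx -> hsol (- B^T) s Z x -> dsol B s (fun y => (Z y)^T *m invmx B) x.
Proof.
move=> uB hZ; apply: mder_eq (mderM (mder_tr hZ) (mder_cst (invmx B) x)) _.
rewrite mulmx0 addr0 /okubo mulNmx mulNmx opprK !trmx_mul trmxK tr_diag_mx.
by rewrite -!mulmxA (mulmxV uB) mulmx1 (mulKmx uB).
Qed.

Lemma pair_mder0 n m k (B : 'M[CC R]_n) (s : 'I_n -> CC R)
    (Y : CC R -> 'M[CC R]_(m, n)) (Z : CC R -> 'M[CC R]_(n, k)) x :
  dsol B s Y x -> hsol B s Z x -> mder (fun y => Y y *m Z y) x 0.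
Proof.
move=> hY hZ; apply: mder_eq (mderM hY hZ) _.
by rewrite mulmxN -mulmxA subrr.
Qed.

Definition seg p q (t : R) : CC R := p + rc t * (q - p).
Definition in01 (t : R) := 0 <= t <= 1.
Definition copen O := forall x, O x -> exists2 r : R, 0 < r & forall y, cmod (y - x) < r -> O y.
Definition star O c := O c /\ forall x, O x -> forall t, in01 t -> O (seg c x t).

Lemma seg0 p q : seg p q 0 = p. Proof. by rewrite /seg rc0 mul0r addr0. Qed.
Lemma seg1 p q : seg p q 1 = q. Proof. by rewrite /seg rc1 mul1r addrC subrK. Qed.

Section Fundamental.
Variables (n : nat) (B : 'M[CC R]_n) (s : 'I_n -> CC R).

(** The inverse is kept as a dual solution: two fundamental matrices are compared through the
    locally constant product of the inverse of one with the other. *)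
Definition fund O (F G : CC R -> 'M[CC R]_n) := forall x, O x ->
  [/\ hsol B s F x, dsol B s G x & G x *m F x = 1%:M].

Lemma fundC O F G x : fund O F G -> O x -> F x *m G x = 1%:M.
Proof. by move=> h /h[_ _]; exact: mulmx1C. Qed.

Lemma fund_sub O N F G : (forall x, N x -> O x) -> fund O F G -> fund N F G.
Proof. by move=> h H x /h; exact: H. Qed.

Lemma hsol_near m (Y Z : CC R -> 'M[CC R]_(n, m)) x (r : R) : 0 < r ->
  (forall y, cmod (y - x) < r -> Y y = Z y) -> hsol B s Y x -> hsol B s Z x.
Proof.
move=> r0 h H; rewrite /hsol -h ?subrr ?cmod0//; exact: mder_near h _.
Qed.

Lemma dsol_near m (Y Z : CC R -> 'M[CC R]_(m, n)) x (r : R) : 0 < r ->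
  (forall y, cmod (y - x) < r -> Y y = Z y) -> dsol B s Y x -> dsol B s Z x.
Proof.
move=> r0 h H; rewrite /dsol -h ?subrr ?cmod0//; exact: mder_near h _.
Qed.

Lemma hsolM m k (Z : CC R -> 'M[CC R]_(n, m)) (C : 'M[CC R]_(m, k)) x :
  hsol B s Z x -> hsol B s (fun y => Z y *m C) x.
Proof.
move=> h; apply: mder_eq (mderM h (mder_cst C x)) _.
by rewrite mulmx0 addr0 mulNmx mulmxA.
Qed.

Lemma dsolM m k (Z : CC R -> 'M[CC R]_(m, n)) (C : 'M[CC R]_(k, m)) x :
  dsol B s Z x -> dsol B s (fun y => C *m Z y) x.
Proof.
move=> h; apply: mder_eq (mderM (mder_cst C x) h) _.
by rewrite mul0mx add0r mulmxA.
Qed.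

Lemma pair_segment m k (Y : CC R -> 'M[CC R]_(m, n)) (Z : CC R -> 'M[CC R]_(n, k)) p q :
  (forall t, in01 t -> dsol B s Y (seg p q t)) ->
  (forall t, in01 t -> hsol B s Z (seg p q t)) -> Y p *m Z p = Y q *m Z q.
Proof.
move=> hY hZ; apply: (@mder0_segment _ _ _ (fun y => Y y *m Z y)) => t t01.
by apply: pair_mder0; [apply: hY | apply: hZ].
Qed.

Hypothesis uB : B \in unitmx.

Lemma local_fund : exists2 K : R, 0 < K & forall (d : R) p, 0 < d ->
  (forall j, d <= cmod (s j - p)) ->
  exists F G, F p = 1%:M /\ fund (fun x => cmod (x - p) < d * K) F G.
Proof.
have [b b0 Bb] := entry_bound B.
have Bb' i j : cmod ((- B^T) i j) <= b by rewrite !mxE cmodN Bb.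
pose K := 4 * (n.+1%:R * (1 + b)).
have K0 : 0 < K by rewrite !mulr_gt0//; lra.
exists K^-1; first by rewrite invr_gt0.
move=> d p d0 sd.
have [F Fp hF] := local_hsol (1%:M : 'M[CC R]_n) b0 Bb d0 sd.
(* With the initial value [B^T] the dual solution is the identity at [p], so its product with [F] is
   constantly 1. *)
have [Z Zp hZ] := local_hsol (B^T : 'M[CC R]_n) b0 Bb' d0 sd.
exists F, (fun y => (Z y)^T *m invmx B); split=> // x xd.
have hx : K * cmod (x - p) < d by move: xd; rewrite ltr_pdivlMr// mulrC.
split; first exact: hF.
  by apply: dual_hsol => //; exact: hZ.
have sgx t : in01 t -> K * cmod (seg p x t - p) < d.
  move=> /andP[t0 t1]; rewrite /seg addrAC subrr add0r cmodM cmod_rc ger0_norm//.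
  apply: le_lt_trans hx; rewrite ler_pM2l//.
  by rewrite ler_piMl ?cmod_ge0.
rewrite -(@pair_segment _ _ (fun y => (Z y)^T *m invmx B) F p x).
- by rewrite Fp Zp trmxK mulmx1 mulmxV.
- by move=> t /sgx h; apply: dual_hsol => //; exact: hZ.
- by move=> t /sgx h; exact: hF.
Qed.

(** Near each parameter half the distance still bounds; the induction on the unit interval glues
    these local bounds. *)
Lemma segment_pole_dist c x :
  (forall t, in01 t -> forall j, seg c x t != s j) ->
  exists2 d : R, 0 < d & forall t, in01 t -> forall j, d <= cmod (s j - seg c x t).
Proof.
move=> H.
suff : exists2 d : R, 0 < d & forall t, 0 <= t <= 1 -> forall j, d <= cmod (s j - seg c x t) by [].
apply: (@unit_interval_induction _ (fun v => exists2 d : R, 0 < d &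
  forall t, 0 <= t <= v -> forall j, d <= cmod (s j - seg c x t))).
  have [|d d0 hd] := @finite_min n (fun j => cmod (s j - seg c x 0)).
    move=> j; rewrite cmod_gt0 subr_eq0 eq_sym; apply: H.
    by rewrite /in01 lexx ler01.
  by exists d => // t t0; have -> : t = 0 by lra.
move=> t t01.
have [|d d0 hd] := @finite_min n (fun j => cmod (s j - seg c x t)).
  by move=> j; rewrite cmod_gt0 subr_eq0 eq_sym; exact: H.
exists (d / 2 / (1 + cmod (x - c))).
  by rewrite !divr_gt0//; have := cmod_ge0 (x - c); lra.
move=> u v /andP[u0 ut] /andP[tv v1] tu vt [d' d'0 hd'].
exists (Num.min d' (d / 2)); first by rewrite lt_min d'0 divr_gt0.
move=> w /andP[w0 wv] j; rewrite ge_min.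
have [wu|uw] := leP w u; first by rewrite hd' ?w0.
apply/orP; right.
have m0 := cmod_ge0 (x - c).
have wt : `|w - t| < d / 2 / (1 + cmod (x - c)).
  by rewrite ltr_norml; apply/andP; split; lra.
have E : cmod (seg c x w - seg c x t) <= d / 2.
  have -> : seg c x w - seg c x t = rc (w - t) * (x - c) by rewrite /seg rcB; ring.
  rewrite cmodM cmod_rc; move: wt; rewrite ltr_pdivlMr; last lra.
  have := normr_ge0 (w - t); nra.
have := cmod_tri (s j) (seg c x w) (seg c x t); have := hd j; lra.
Qed.

(** A thickened initial piece of the segment. It is star-shaped about each point of that piece, so
    solutions agreeing at one such point agree wherever a disc about that point overlaps the
    tube. *)
Definition tube c x (r t : R) y := exists2 u, 0 <= u <= t & cmod (y - seg c x u) < r.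

Lemma tube_open c x r t : copen (tube c x r t).
Proof.
move=> y [u ut yu]; exists (r - cmod (y - seg c x u)); first by rewrite subr_gt0.
move=> z zy; exists u => //.
have := cmod_tri z y (seg c x u); lra.
Qed.

Lemma tube_star c x r t v : 0 < r -> 0 <= v <= t -> star (tube c x r t) (seg c x v).
Proof.
move=> r0 vt; split; first by exists v => //; rewrite subrr cmod0.
move=> y [u ut yu] w /andP[w0 w1]; exists (v + w * (u - v)).
  have -> : v + w * (u - v) = (1 - w) * v + w * u by ring.
  nra.
have -> : seg (seg c x v) y w - seg c x (v + w * (u - v)) = rc w * (y - seg c x u).
  by rewrite /seg rcD rcM rcB; ring.
rewrite cmodM cmod_rc ger0_norm//; apply: le_lt_trans yu.
by rewrite ler_piMl ?cmod_ge0.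
Qed.

Lemma tube_fund c x : (forall t, in01 t -> forall j, seg c x t != s j) ->
  exists N F G, [/\ copen N, star N c, N x, F c = 1%:M & fund N F G].
Proof.
move=> /segment_pole_dist[d d0 hd].
have [K K0 HK] := local_fund.
pose r := d * K; have r0 : 0 < r by rewrite mulr_gt0.
have r20 : 0 < r / 2 by rewrite divr_gt0.
suff [F [G [Fc FG]]] : exists F G, F c = 1%:M /\ fund (tube c x (r / 2) 1) F G.
  exists (tube c x (r / 2) 1), F, G; split => //.
  - exact: tube_open.
  - by rewrite -[X in star _ X](seg0 c x); apply: tube_star => //; rewrite lexx ler01.
  - by exists 1; rewrite ?lexx ?ler01// seg1 subrr cmod0.
apply: (@unit_interval_induction _ (fun v => exists F G, F c = 1%:M /\
  fund (tube c x (r / 2) v) F G)).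
  have [|F [G [Fp FG]]] := HK d c d0.
    by move=> j; have := hd 0 _ j; rewrite seg0; apply; rewrite /in01 lexx ler01.
  exists F, G; split=> //; apply: fund_sub FG => y [u u0].
  have -> : u = 0 by lra.
  by rewrite seg0 -/r; lra.
move=> t t01.
have m0 := cmod_ge0 (x - c).
(* Both [u] and [v] lie this close to [t], so the segment moves by at most [r / 2] between them. The
   new part of the tube, of radius [r / 2], then stays inside the disc of radius [r] about the point
   at [u]. *)
exists (r / 4 / (1 + cmod (x - c))); first by rewrite !divr_gt0//; lra.
move=> u v /andP[u0 ut] /andP[tv v1] tu vt [F [G [Fc FG]]].
have u01 : in01 u by rewrite /in01 u0 /=; lra.
have [F1 [G1 [F1u FG1]]] := HK d (seg c x u) d0 (hd u u01).
pose D y := cmod (y - seg c x u) < r.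
pose T := tube c x (r / 2) u.
have Tu : T (seg c x u) by exists u; rewrite ?u0 ?lexx// subrr cmod0.
have Tst : star T (seg c x u) by apply: tube_star => //; rewrite u0 lexx.
have Dst y : D y -> forall w, in01 w -> D (seg (seg c x u) y w).
  move=> Dy w /andP[w0 w1]; rewrite /D /seg addrAC subrr add0r.
  rewrite cmodM cmod_rc ger0_norm//; apply: le_lt_trans Dy.
  by rewrite ler_piMl ?cmod_ge0.
have agree y : T y -> D y -> F y = F1 y *m F (seg c x u).
  move=> Ty Dy.
  have := @pair_segment _ _ G1 F (seg c x u) y.
  have Du : D (seg c x u) by rewrite /D subrr cmod0.
  have [_ _ G1u] := FG1 _ Du; rewrite F1u mulmx1 in G1u.
  rewrite G1u mul1mx => ->.
  - by rewrite mulmxA (fundC FG1)// mul1mx.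
  - by move=> w w01; have [] := FG1 _ (Dst _ Dy w w01).
  - by move=> w w01; have [] := FG _ (Tst.2 _ Ty w w01).
have agreeG y : T y -> D y -> G y = G (seg c x u) *m G1 y.
  move=> Ty Dy.
  have [_ _ e] := FG _ Ty.
  have e2 : G (seg c x u) *m G1 y *m F y = 1%:M.
    rewrite (agree _ Ty Dy) mulmxA -(mulmxA (G _)).
    have [_ _ ->] := FG1 _ Dy; rewrite mulmx1.
    by have [_ _ ->] := FG _ Tu.
  by rewrite -[RHS]mulmx1 -(fundC FG Ty) mulmxA e2 mul1mx.
pose F' y := if `[< T y >] then F y else F1 y *m F (seg c x u).
pose G' y := if `[< T y >] then G y else G (seg c x u) *m G1 y.
have TF y : T y -> F' y = F y by move=> Ty; rewrite /F' asboolT.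
have TG y : T y -> G' y = G y by move=> Ty; rewrite /G' asboolT.
have DF y : D y -> F' y = F1 y *m F (seg c x u).
  by move=> Dy; rewrite /F'; case: asboolP => // Ty; exact: agree.
have DG y : D y -> G' y = G (seg c x u) *m G1 y.
  by move=> Dy; rewrite /G'; case: asboolP => // Ty; exact: agreeG.
exists F', G'; split.
  rewrite TF//; exists 0; first by rewrite lexx.
  by rewrite seg0 subrr cmod0.
move=> y Ty.
have [Ty1|nTy] := pselect (T y).
  have [e e0 he] := tube_open Ty1.
  have [h1 h2 h3] := FG y Ty1; split.
  - by apply: hsol_near e0 _ h1 => z /he /TF.
  - by apply: dsol_near e0 _ h2 => z /he /TG.
  - by rewrite TF// TG.
have Dy : D y.
  have [w /andP[w0 wv] yw] := Ty.
  have [wu|uw] := leP w u.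
    by exfalso; apply: nTy; exists w => //; rewrite w0.
  have E : cmod (seg c x w - seg c x u) <= r / 2.
    have -> : seg c x w - seg c x u = rc (w - u) * (x - c) by rewrite /seg rcB; ring.
    rewrite cmodM cmod_rc ger0_norm; last lra.
    have : w - u < 2 * (r / 4 / (1 + cmod (x - c))) by lra.
    rewrite mulrA ltr_pdivlMr; last lra.
    nra.
  by rewrite /D; have := cmod_tri y (seg c x w) (seg c x u); lra.
have [h1 h2 h3] := FG1 y Dy.
have e0 : 0 < r - cmod (y - seg c x u) by rewrite subr_gt0.
have near z : cmod (z - y) < r - cmod (y - seg c x u) -> D z.
  by rewrite /D; have := cmod_tri z y (seg c x u); lra.
split.
- by apply: hsol_near e0 _ (hsolM (F (seg c x u)) h1) => z /near /DF.
- by apply: dsol_near e0 _ (dsolM (G (seg c x u)) h2) => z /near /DG.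
- rewrite DF// DG// -mulmxA (mulmxA (G1 y)) h3 mul1mx.
  by have [_ _ ->] := FG _ Tu.
Qed.

(** Each [x] gets a solution on a neighbourhood of the segment from [c], evaluated at [x] only.
    Nearby choices are coherent: all are 1 at [c], and the segment from [c] to a common point lies
    in both neighbourhoods. *)
Theorem star_fund O c : copen O -> star O c ->
  (forall x, O x -> forall j, x != s j) ->
  exists F G, F c = 1%:M /\ fund O F G.
Proof.
move=> Oop [Oc Ost] Os.
have /choice[f hf] x : exists NFG : (CC R -> Prop) * ((CC R -> 'M[CC R]_n) * (CC R -> 'M[CC R]_n)),
    O x -> [/\ copen NFG.1, star NFG.1 c, NFG.1 x, NFG.2.1 c = 1%:M & fund NFG.1 NFG.2.1 NFG.2.2].
  have [Ox|] := pselect (O x); last by exists (O, (fun=> 0, fun=> 0)).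
  have [|N [F [G h]]] := @tube_fund c x; last by exists (N, (F, G)).
  by move=> t t01; apply: Os; exact: Ost.
pose F x := (f x).2.1 x; pose G x := (f x).2.2 x.
have fE x y : O x -> O y -> (f x).1 y -> F y = (f x).2.1 y /\ G y = (f x).2.2 y.
  move=> Ox Oy Nxy.
  have [_ [cx sx] _ Fx FGx] := hf x Ox.
  have [_ [cy sy] Nyy Fy FGy] := hf y Oy.
  have Gx : (f x).2.2 c = 1%:M by have [_ _] := FGx _ cx; rewrite Fx mulmx1.
  have := @pair_segment _ _ (f x).2.2 (f y).2.1 c y.
  rewrite Gx Fy mulmx1 => h.
  have E : (f y).2.1 y = (f x).2.1 y.
    rewrite -[RHS]mulmx1 h.
    - by rewrite mulmxA (fundC FGx)// mul1mx.
    - by move=> t t01; have [] := FGx _ (sx _ Nxy t t01).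
    - by move=> t t01; have [] := FGy _ (sy _ Nyy t t01).
  split=> //; rewrite /G.
  have [_ _ e1] := FGx _ Nxy.
  by rewrite -[RHS]mulmx1 -(fundC FGy Nyy) mulmxA E e1 mul1mx.
exists F, G; split; first by rewrite /F; have [_ _ _ -> _] := hf c Oc.
move=> x Ox.
have [Nop [cx sx] Nx Fx FGx] := hf x Ox.
have [h1 h2 h3] := FGx _ Nx.
have [e e0 he] := Nop _ Nx; have [e' e'0 he'] := Oop _ Ox.
have near y : cmod (y - x) < Num.min e e' -> F y = (f x).2.1 y /\ G y = (f x).2.2 y.
  by rewrite lt_min => /andP[/he Ny /he' Oy]; exact: fE.
have m0 : 0 < Num.min e e' by rewrite lt_min e0.
split=> //.
- by apply: hsol_near m0 _ h1 => y /near[->].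
- by apply: dsol_near m0 _ h2 => y /near[_ ->].
Qed.

End Fundamental.
End StarDomains.

(** * Slits and sectors *)

Section Charts.
Context {R : realType}.
Implicit Types (x y z p q : CC R) (O N : CC R -> Prop).

Definition rcont (f : CC R -> R) := forall x (e : R), 0 < e ->
  exists2 r : R, 0 < r & forall y, cmod (y - x) < r -> `|f y - f x| < e.

Lemma copen_gt0 f : rcont f -> copen (fun x => 0 < f x).
Proof.
move=> h x fx; have [r r0 hr] := h x _ fx; exists r => // y /hr.
by rewrite ltr_norml; lra.
Qed.

Lemma copen_neq0 f : rcont f -> copen (fun x => f x != 0).
Proof.
move=> h x; rewrite -normr_gt0 => fx; have [r r0 hr] := h x _ fx; exists r => // y /hr.
by apply: contraTneq => ->; rewrite sub0r normrN ltxx.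
Qed.

Lemma copenI O N : copen O -> copen N -> copen (fun x => O x /\ N x).
Proof.
move=> hO hN x [/hO[r r0 h] /hN[r' r'0 h']].
exists (Num.min r r'); first by rewrite lt_min r0.
by move=> y; rewrite lt_min => /andP[/h ? /h'].
Qed.

Lemma copenU O N : copen O -> copen N -> copen (fun x => O x \/ N x).
Proof.
by move=> hO hN x [/hO[r r0 h]|/hN[r r0 h]]; exists r => // y /h; [left|right].
Qed.

Lemma copen_all n (O : 'I_n -> CC R -> Prop) : (forall i, copen (O i)) ->
  copen (fun x => forall i, O i x).
Proof.
move=> h x Ox.
have /choice[r hr] i : exists r : R, 0 < r /\ forall y, cmod (y - x) < r -> O i y.
  by have [r r0 hr] := h i x (Ox i); exists r.
have [d d0 hd] := @finite_min R n r (fun i => (hr i).1).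
by exists d => // y yd i; apply: (hr i).2; exact: lt_le_trans (hd i).
Qed.

Definition convex N := forall x y, N x -> N y -> forall t, in01 t -> N (seg x y t).

Lemma convex_transition n (B : 'M[CC R]_n) (s : 'I_n -> CC R) N F G F' G' :
  convex N -> (exists x, N x) -> fund B s N F G -> fund B s N F' G' ->
  exists2 C : 'M[CC R]_n, C \in unitmx & forall x, N x -> F x = F' x *m C /\ G' x = C *m G x.
Proof.
move=> Nc [p Np] FG FG'; exists (G' p *m F p).
  have : (G p *m F' p) *m (G' p *m F p) = 1%:M.
    rewrite mulmxA -(mulmxA (G p)) (fundC FG')// mulmx1.
    by have [_ _ ->] := FG _ Np.
  by case/mulmx1_unit.
move=> x Nx; have E : G' p *m F p = G' x *m F x.
  apply: (pair_segment (B := B) (s := s)).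
    by move=> t t01; have [] := FG' _ (Nc _ _ Np Nx t t01).
  by move=> t t01; have [] := FG _ (Nc _ _ Np Nx t t01).
rewrite E mulmxA (fundC FG')// mul1mx; split=> //.
by rewrite -mulmxA (fundC FG)// mulmx1.
Qed.

Section Cuts.
Variables (n : nat) (s : 'I_n -> CC R) (c : CC R) (de : R).
Definition px x := cre (x - c).
Definition py x := cim (x - c).
(** The inverse slope of the ray from [c] through [s j]. Accordingly [sl j] is the horizontal offset
    from the line of that ray, positive to the right of it. *)
Definition rho j := px (s j) / py (s j).
Definition sl j x := px x - rho j * py x.
Hypothesis Y0 : forall j, 0 < py (s j).
Hypothesis de0 : 0 < de.
Hypothesis rhoN : forall i j, i != j -> de <= `|rho i - rho j|.

Lemma px_seg p q t : px (seg p q t) = px p + t * (px q - px p).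
Proof. by rewrite /px /seg; rewrite !creE; ring. Qed.
Lemma py_seg p q t : py (seg p q t) = py p + t * (py q - py p).
Proof. by rewrite /py /seg; rewrite !creE; ring. Qed.
Lemma sl_seg j p q t : sl j (seg p q t) = sl j p + t * (sl j q - sl j p).
Proof. by rewrite /sl px_seg py_seg; ring. Qed.

Definition pt (a b : R) : CC R := c + mkc a b.
Lemma px_pt a b : px (pt a b) = a.
Proof. by rewrite /px /pt; rewrite !creE; ring. Qed.
Lemma py_pt a b : py (pt a b) = b.
Proof. by rewrite /py /pt; rewrite !creE; ring. Qed.

Lemma px_pole j : px (s j) = rho j * py (s j).
Proof. by rewrite /rho divfK// gt_eqF. Qed.
Lemma sl_pole j : sl j (s j) = 0.
Proof. by rewrite /sl px_pole subrr. Qed.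
Lemma pxy_eq x y : px x = px y -> py x = py y -> x = y.
Proof.
rewrite /px /py !creE => h1 h2; apply/ceqP; split; lra.
Qed.

Lemma px_lip x y : `|px y - px x| <= cmod (y - x).
Proof. by have := cre_le (y - x); rewrite /px !creE opprD addrACA opprK addNr addr0. Qed.
Lemma py_lip x y : `|py y - py x| <= cmod (y - x).
Proof. by have := cim_le (y - x); rewrite /py !creE opprD addrACA opprK addNr addr0. Qed.
Lemma cmod_pxy x y : cmod (y - x) <= `|px y - px x| + `|py y - py x|.
Proof.
have := cmod_le (y - x).
by rewrite /px /py !creE [X in _ -> _ <= `|X| + _](_ : _ = cre y - cre x)
  ?[X in _ -> _ <= _ + `|X|](_ : _ = cim y - cim x) //; ring.
Qed.

Lemma rcont_lin (a b d : R) : rcont (fun x => a * px x + b * py x + d).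
Proof.
move=> x e e0; have a0 := normr_ge0 a; have b0 := normr_ge0 b.
exists (e / (1 + `|a| + `|b|)); first by rewrite divr_gt0//; lra.
move=> y; rewrite ltr_pdivlMr; last lra.
move=> h.
have -> : a * px y + b * py y + d - (a * px x + b * py x + d) =
  a * (px y - px x) + b * (py y - py x) by ring.
apply: le_lt_trans (ler_normD _ _) _; rewrite !normrM.
have h1 := ler_wpM2l a0 (px_lip x y); have h2 := ler_wpM2l b0 (py_lip x y).
have := cmod_ge0 (y - x); rewrite !mulrDr mulr1 in h; lra.
Qed.

Lemma rcont_eq f g : f =1 g -> rcont f -> rcont g.
Proof. by move=> /funext ->. Qed.

Lemma rcont_sl j : rcont (sl j).
Proof.
by apply: rcont_eq (rcont_lin 1 (- rho j) 0) => x; rewrite /sl; ring.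
Qed.

(* the plane cut along the ray from [s j] away from [c] *)
Definition slit j x := sl j x != 0 \/ 0 < py (s j) - py x.
Definition slits x := forall j, slit j x.
(** A cone with apex [c] around the ray through [s i]. Its half-width in inverse slope is at most
    the gap to any other ray, so it meets no other ray. *)
Definition sector i x := 0 < py x /\ 0 < de * py x - sl i x /\ 0 < de * py x + sl i x.
(* slit along the part of the ray before [s i], complementary to the cut [slit i] *)
Definition cosector i x := sector i x /\ (sl i x != 0 \/ 0 < py x - py (s i)).

Lemma slit_open j : copen (slit j).
Proof.
apply: copenU; first exact: copen_neq0 (rcont_sl j).
apply: copen_gt0; apply: rcont_eq (rcont_lin 0 (-1) (py (s j))) => x; ring.
Qed.

Lemma slits_open : copen slits.
Proof. by apply: copen_all => j; exact: slit_open. Qed.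

Lemma cosector_open i : copen (cosector i).
Proof.
apply: copenI.
  apply: copenI; first by apply: copen_gt0; apply: rcont_eq (rcont_lin 0 1 0) => x; ring.
  apply: copenI; apply: copen_gt0.
    by apply: rcont_eq (rcont_lin (-1) (de + rho i) 0) => x; rewrite /sl; ring.
  by apply: rcont_eq (rcont_lin 1 (de - rho i) 0) => x; rewrite /sl; ring.
apply: copenU; first exact: copen_neq0 (rcont_sl i).
by apply: copen_gt0; apply: rcont_eq (rcont_lin 0 1 (- py (s i))) => x; ring.
Qed.

Lemma px_c : px c = 0. Proof. by rewrite /px subrr. Qed.
Lemma py_c : py c = 0. Proof. by rewrite /py subrr. Qed.
Lemma sl_c j : sl j c = 0. Proof. by rewrite /sl px_c py_c mulr0 subrr. Qed.

Lemma slit_star j : star (slit j) c.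
Proof.
split; first by right; rewrite py_c subr0.
move=> x sx t /andP[t0 t1]; rewrite /slit sl_seg py_seg sl_c py_c !subr0 !add0r.
have Yj := Y0 j.
have [->|tn0] := eqVneq t 0; first by right; rewrite mul0r subr0.
case: sx => [h|h]; first by left; rewrite mulf_neq0.
right; nra.
Qed.

Lemma slits_star : star slits c.
Proof.
split=> [j|x sx t t01 j]; first exact: (slit_star j).1.
by apply: (slit_star j).2.
Qed.

Lemma slit_avoid j x : slit j x -> x != s j.
Proof.
by case=> h; apply: contraTneq h => ->; rewrite ?sl_pole ?eqxx// subrr ltxx.
Qed.

Lemma sector_slit i j x : j != i -> sector i x -> slit j x.
Proof.
move=> ji [y0 [h1 h2]]; left.
have := rhoN ji.
have -> : sl j x = sl i x + (rho i - rho j) * py x by rewrite /sl; ring.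
by move=> h; apply/eqP => e; move: h; rewrite ler_normr => /orP[h|h]; nra.
Qed.

Lemma cosector_avoid i j x : cosector i x -> x != s j.
Proof.
move=> [sx h]; have [->|ji] := eqVneq j i; last exact/slit_avoid/(sector_slit ji sx).
by case: h => h; apply: contraTneq h => ->; rewrite ?sl_pole ?eqxx// subrr ltxx.
Qed.

Lemma cosector_slits i x : cosector i x -> sl i x != 0 -> slits x.
Proof.
move=> [sx _] h j; have [->|ji] := eqVneq j i; first by left.
exact: sector_slit sx.
Qed.

Lemma sector_convex i : convex (sector i).
Proof.
move=> x y [a1 [a2 a3]] [b1 [b2 b3]] t /andP[t0 t1].
rewrite /sector sl_seg py_seg; have : 0 <= 1 - t by rewrite subr_ge0.
move=> t1'.
have cv (a b : R) : 0 < a -> 0 < b -> 0 < (1 - t) * a + t * b by move=> ? ?; nra.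
split; [|split].
- by have := cv _ _ a1 b1; lra.
- by have := cv _ _ a2 b2; lra.
- by have := cv _ _ a3 b3; lra.
Qed.

(** The centre lies on the ray at twice the height of [s i]. From there the removed part of the ray
    lies behind [s i] and hides nothing else. *)
Lemma cosector_star i : exists c', star (cosector i) c'.
Proof.
have Yi := Y0 i.
pose c' := pt (rho i * (2 * py (s i))) (2 * py (s i)).
have s0 : sl i c' = 0 by rewrite /sl px_pt py_pt subrr.
have p0 : py c' = 2 * py (s i) by rewrite py_pt.
have sc : sector i c'.
  have d0 : 0 < de * (2 * py (s i)) by rewrite !mulr_gt0.
  by rewrite /sector s0 p0 subr0 addr0; split; [lra|].
exists c'; split.
  by split=> //; right; rewrite p0; lra.
move=> x [sx h] t t01; split; first exact: sector_convex.
move: t01 => /andP[t0 t1].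
rewrite sl_seg py_seg s0 p0 add0r subr0.
have [->|tn0] := eqVneq t 0; first by right; rewrite mul0r addr0; lra.
case: h => [h|h]; first by left; rewrite mulf_neq0.
right; nra.
Qed.

Definition rside i x := sector i x /\ 0 < sl i x.
Definition lside i x := sector i x /\ 0 < - sl i x.

Lemma rside_convex i : convex (rside i).
Proof.
move=> x y [sx hx] [sy hy] t t01; split; first exact: sector_convex.
by move: t01 => /andP[t0 t1]; rewrite sl_seg; nra.
Qed.

Lemma lside_convex i : convex (lside i).
Proof.
move=> x y [sx hx] [sy hy] t t01; split; first exact: sector_convex.
by move: t01 => /andP[t0 t1]; rewrite sl_seg; nra.
Qed.

Lemma rside_cosector i x : rside i x -> cosector i x.
Proof. by move=> [sx h]; split=> //; left; rewrite gt_eqF. Qed.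
Lemma lside_cosector i x : lside i x -> cosector i x.
Proof. by move=> [sx h]; split=> //; left; rewrite lt_eqF// -oppr_gt0. Qed.
Lemma rside_slits i x : rside i x -> slits x.
Proof. by move=> h; apply: cosector_slits (rside_cosector h) _; rewrite gt_eqF//; case: h. Qed.
Lemma lside_slits i x : lside i x -> slits x.
Proof. by move=> h; apply: cosector_slits (lside_cosector h) _; rewrite lt_eqF// -oppr_gt0; case: h. Qed.

Lemma rside_ex i : exists x, rside i x.
Proof.
exists (pt (rho i + de / 2) 1); split.
  by rewrite /sector /sl px_pt py_pt; move: (rho i) de0 => u d0; split; [|split]; lra.
by rewrite /sl px_pt py_pt; move: (rho i) de0 => u d0; lra.
Qed.

Lemma lside_ex i : exists x, lside i x.
Proof.
exists (pt (rho i - de / 2) 1); split.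
  by rewrite /sector /sl px_pt py_pt; move: (rho i) de0 => u d0; split; [|split]; lra.
by rewrite /sl px_pt py_pt; move: (rho i) de0 => u d0; lra.
Qed.

Lemma slit_or_cosector i x : x != s i -> slit i x \/ cosector i x.
Proof.
move=> xs; have [h|/not_orP[h1 h2]] := pselect (slit i x); [by left|right].
move: h1 h2 => /negP; rewrite negbK => /eqP h1 /negP; rewrite -leNgt subr_le0 => h2.
have Yi := Y0 i.
have : py x != py (s i).
  apply: contra_neq xs => e; apply: pxy_eq => //.
  by rewrite px_pole -e; move: h1; rewrite /sl; lra.
rewrite eq_sym => ne; have lt : py (s i) < py x by rewrite lt_neqAle ne.
split; last by right; lra.
have d0 : 0 < de * py x by rewrite mulr_gt0//; lra.
by rewrite /sector h1 subr0 addr0; split; [lra|].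
Qed.

Lemma charts_cover x : (forall j, x != s j) -> slits x \/ exists i, cosector i x.
Proof.
move=> xs; have [h|/existsNP[i h]] := pselect (slits x); [by left|right].
by exists i; have [] := slit_or_cosector (xs i).
Qed.

End Cuts.
End Charts.

(** * Branches of powers and the order of their jump *)

Section ScalarEquation.
Context {R : realType}.
Implicit Types (x y z p q u : CC R) (O N : CC R -> Prop).

(* [f] behaves as a branch of [(x - a)^-k] *)
Definition pow_at (k a : CC R) (f : CC R -> CC R) x :=
  cder f x (- (k / (x - a) * f x)) /\ f x != 0.

Lemma pow_atV k a f x : pow_at k a f x -> pow_at (- k) a (fun y => (f y)^-1) x.
Proof.
move=> [h f0]; split; last by rewrite invr_eq0.
apply: cder_eq (cder_comp h (cderV f0)) _.
by rewrite [- k / _]mulNr; move: (k / _) => z; field.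
Qed.

Lemma pow_atM k k' a f g x : pow_at k a f x -> pow_at k' a g x ->
  pow_at (k + k') a (fun y => f y * g y) x.
Proof.
move=> [h f0] [h' g0]; split; last by rewrite mulf_neq0.
by apply: cder_eq (cderM h h') _; ring.
Qed.

Lemma pow_at_near k a f g x (r : R) : 0 < r ->
  (forall y, cmod (y - x) < r -> f y = g y) -> pow_at k a f x -> pow_at k a g x.
Proof.
move=> r0 h [h1 h2]; have e : f x = g x by apply: h; rewrite subrr cmod0.
by rewrite /pow_at -e; split=> //; exact: cder_near h _.
Qed.

Lemma pow_atZ k a f x m : m != 0 -> pow_at k a f x -> pow_at k a (fun y => m * f y) x.
Proof.
move=> m0 [h f0]; split; last by rewrite mulf_neq0.
by apply: cder_eq (cderZ m h) _; ring.
Qed.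

(** The segment from [a + u] to [a + xi * u] misses [a], because [xi] is not real. *)
Lemma punctured_cst a (g : CC R -> CC R) xi u : u != 0 -> cim xi != 0 ->
  (forall x, x != a -> cder g x 0) -> g (a + u) = g (a + xi * u).
Proof.
move=> u0 xi0 hg; apply: cder0_segment => t t01; apply: hg.
have -> : a + u + rc t * (a + xi * u - (a + u)) = a + u * (1 - rc t + rc t * xi) by ring.
rewrite -subr_eq0 addrAC subrr add0r mulf_neq0//.
apply/eqP => /ceqP[]; rewrite !creE => h1 h2.
have /eqP : t * cim xi = 0 by lra.
rewrite mulf_eq0 (negbTE xi0) orbF => /eqP t0; move: h1; rewrite t0; lra.
Qed.

Lemma pow_at_rot k a f xi x : xi != 0 -> (forall y, y != a -> pow_at k a f y) -> x != a ->
  cder (fun y => f (a + xi * (y - a)) / f y) x 0.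
Proof.
move=> xi0 hf xa.
have xa0 : x - a != 0 by rewrite subr_eq0.
have za : a + xi * (x - a) != a by rewrite -subr_eq0 addrAC subrr add0r mulf_neq0.
have [h1 n1] := hf _ xa; have [h2 n2] := hf _ za.
have hl : cder (fun y => a + xi * (y - a)) x xi.
  apply: cder_eq (cderD (cder_cst a x) (cderZ xi (cderB (cder_id x) (cder_cst a x)))) _.
  by rewrite add0r subr0 mulr1.
apply: cder_eq (cderM (cder_comp hl h2) (cder_comp h1 (cderV n1))) _.
rewrite [a + _ - a](_ : _ = xi * (x - a)); last by ring.
by move: (f _) n2 => A nA; field; rewrite xi0 xa0 n1.
Qed.

(** For [e k = 1] the power [f ^+ e] is, locally, a constant multiple of [1 / (y - a)]. *)
Lemma pow_at_cst k a f x e : e%:R * k = 1 -> x != a -> pow_at k a f x ->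
  cder (fun y => f y ^+ e * (y - a)) x 0.
Proof.
move=> ek xa [h f0].
have xa0 : x - a != 0 by rewrite subr_eq0.
have hp m : cder (fun y => f y ^+ m) x (- (m%:R * k / (x - a) * f x ^+ m)).
  elim: m => [|m IH].
    by rewrite !mul0r oppr0; apply: cder_ext (cder_cst 1 x) => y; rewrite expr0.
  apply: (@cder_ext _ (fun y => f y * f y ^+ m)); first by move=> y; rewrite exprS.
  by apply: cder_eq (cderM h IH) _; rewrite exprS -natr1; ring.
apply: cder_eq (cderM (hp e) (cderB (cder_id x) (cder_cst a x))) _.
by rewrite ek; field.
Qed.

(** The quotient of [f] after and before a half-turn is constant, hence equal to its own inverse, so
    [f ^+ 2] agrees at [a + 1] and [a - 1]. But [f ^+ 2 * (x - a)] is constant too, which gives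
    opposite values. Two quarter-turns by [j] are used because the straight segment would pass
    through [a]. *)
Lemma no_square_root a f : (forall x, x != a -> pow_at (2^-1) a f x) -> False.
Proof.
move=> hf; pose j : CC R := mkc 0 1.
have jj : j * j = -1 by apply/ceqP; rewrite !creE; split; ring.
have j0 : cim j != 0 by rewrite cim_mk oner_eq0.
have n1 : (-1 : CC R) != 0 by rewrite oppr_eq0 oner_eq0.
have jn : j != 0 by apply: contra_neq n1 => h; rewrite -jj h mul0r.
have rot g : (forall x, x != a -> cder g x 0) -> g (a + 1) = g (a - 1).
  move=> hg; rewrite (punctured_cst (oner_neq0 _) j0 hg).
  by rewrite mulr1 (punctured_cst jn j0 hg) jj.
have a1 : a + 1 != a by rewrite -subr_eq0 addrAC subrr add0r oner_eq0.
have a2 : a - 1 != a by rewrite -subr_eq0 addrAC subrr add0r.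
have ce : 2%:R * 2^-1 = 1 :> CC R by rewrite mulfV// pnatr_eq0.
have := rot _ (fun x xa => pow_at_rot n1 hf xa).
rewrite !mulN1r ![a + _ - a]addrAC subrr !add0r opprK => e1.
have e2 := rot _ (fun x xa => pow_at_cst ce xa (hf x xa)).
move: e2; rewrite ![a + _ - a]addrAC subrr !add0r mulr1 mulrN1 => e2.
have [_ f1] := hf _ a1; have [_ f2] := hf _ a2.
move: e1 => /(congr1 (fun z => z * f (a + 1) * f (a - 1))).
rewrite divfK// mulrAC divfK// -!expr2 e2 => /eqP.
rewrite -addr_eq0 -mulr2n mulrn_eq0 /= sqrf_eq0.
by rewrite (negbTE f2).
Qed.

(** The quotient of [f] after and before rotation by [w] is constant. Its values at three successive
    points multiply to 1, so its cube is 1; the constancy of [f ^+ 3 * (x - a)] would then force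
    [w = 1]. *)
Lemma no_cube_root a f (w : CC R) : w ^+ 3 = 1 -> cim w != 0 ->
  (forall x, x != a -> pow_at (3^-1) a f x) -> False.
Proof.
move=> w3 w0 hf.
have wn : w != 0 by apply/eqP => h; move: w0; rewrite h cim0 eqxx.
have rot g u : u != 0 -> (forall x, x != a -> cder g x 0) -> g (a + u) = g (a + w * u).
  by move=> u0 hg; exact: punctured_cst.
have ne u : u != 0 -> a + u != a by move=> u0; rewrite -subr_eq0 addrAC subrr add0r.
have o1 : (1 : CC R) != 0 := oner_neq0 _.
have w2 : w * w != 0 by rewrite mulf_neq0.
have www : w * (w * w) = 1 by rewrite -w3 !exprS expr0 mulr1.
have ce : 3%:R * 3^-1 = 1 :> CC R by rewrite mulfV// pnatr_eq0.
have hr x xa := pow_at_rot (x := x) wn hf xa.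
have := rot _ _ o1 hr; have := rot _ _ wn hr.
rewrite !mulr1 ![a + _ - a]addrAC subrr !add0r www !mulr1 => e1 e2.
have e3 := rot _ _ o1 (fun x xa => pow_at_cst ce xa (hf x xa)).
move: e3; rewrite ![a + _ - a]addrAC subrr !add0r !mulr1 => e3.
have [[_ fA] [_ fB]] := (hf _ (ne _ o1), hf _ (ne _ wn)).
have [_ fC] := hf _ (ne _ w2).
move: fA fB fC e1 e2 e3.
move: (f (a + 1)) (f (a + w)) (f (a + w * w)) => A B C A0 B0 C0 e1 e2 e3.
have g3 : (B / A) ^+ 3 = 1.
  have -> : (B / A) ^+ 3 = (B / A) * (B / A) * (B / A) by rewrite !exprS expr0 mulr1 mulrA.
  by rewrite {2 3}e2 {2}e1; field; rewrite A0 B0 C0.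
have BA : B ^+ 3 = A ^+ 3 by rewrite -[B](divfK A0) exprMn g3 mul1r.
have w1 : w = 1 by apply: (mulfI (expf_neq0 3 A0)); rewrite mulr1 [RHS]e3 BA.
by move: w0; rewrite w1 cim1 eqxx.
Qed.

Lemma pow_atX k a f x e : pow_at k a f x -> pow_at (e%:R * k) a (fun y => f y ^+ e) x.
Proof.
move=> h; elim: e => [|e IH].
  split; last by rewrite expr0 oner_eq0.
  by rewrite !mul0r oppr0; apply: cder_ext (cder_cst 1 x) => y; rewrite expr0.
apply: (@pow_at_near _ _ (fun y => f y * f y ^+ e) _ _ 1) => //.
  by move=> y _; rewrite exprS.
by rewrite -natr1 mulrDl mul1r addrC; exact: pow_atM.
Qed.

Lemma omega_props : omega R ^+ 3 = 1 /\ cim (omega R) != 0.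
Proof.
have E (a : R) : mkc (cos a) (sin a) ^+ 3 = mkc (cos (a *+ 3)) (sin (a *+ 3)).
  rewrite 2!mulrS mulr1n !exprS expr0 mulr1 !(cosD, sinD).
  by apply/ceqP; rewrite !creE; split; ring.
split; first rewrite [omega R]/(mkc _ _) E.
  have -> : (2 * pi / 3 : R) *+ 3 = pi *+ 2 by rewrite -[LHS]mulr_natl -[RHS]mulr_natl; field.
  by rewrite cos2pi sin2pi.
rewrite [omega R]/(mkc _ _) cim_mk gt_eqF//.
by apply: sin_gt0_pi; rewrite ?in_itv /=; have := pi_gt0 R; lra.
Qed.

Section ScalarJump.
Variables (n : nat) (s : 'I_n -> CC R) (c : CC R) (de : R) (i : 'I_n).
Hypothesis Y0 : forall j, 0 < py c (s j).
Hypothesis de0 : 0 < de.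
Hypothesis rhoN : forall i j, i != j -> de <= `|rho s c i - rho s c j|.

(** A branch of the power is the [1 x 1] case of [star_fund], with [k] as matrix and [s i] as its
    only pole. *)
Lemma scalar_solution k O p : k != 0 -> copen O -> star O p ->
  (forall x, O x -> x != s i) ->
  exists f, forall x, O x -> pow_at k (s i) f x.
Proof.
move=> k0 Oo Os Oa.
have uk : (k%:M : 'M[CC R]_1) \in unitmx by rewrite unitmxE det_scalar1 unitfE.
have [F [G [_ FG]]] := star_fund uk (s := fun=> s i) Oo Os (fun x Ox _ => Oa x Ox).
exists (fun x => F x 0 0) => x Ox; have [h1 h2 h3] := FG x Ox; split.
  apply: cder_eq (h1 0 0) _.
  by rewrite /okubo mul_scalar_mx mxE -scalemxAl mxE diag_mxM_entry mxE mulrA.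
apply/eqP => f0; move/matrixP: h3 => /(_ 0 0); rewrite !mxE big_ord1 f0 mulr0 => /esym/eqP.
by rewrite oner_eq0.
Qed.

Lemma pow_ratio N k a f g : convex N -> (exists x, N x) -> (forall x, N x -> x != a) ->
  (forall x, N x -> pow_at k a f x) -> (forall x, N x -> pow_at k a g x) ->
  exists2 m, m != 0 & forall x, N x -> f x = g x * m.
Proof.
move=> Nc [p Np] Na hf hg; exists (f p / g p).
  by rewrite mulf_neq0 ?invr_eq0//; [have [] := hf _ Np | have [] := hg _ Np].
move=> x Nx; have [_ g0] := hg _ Nx.
have -> : f p / g p = f x / g x; last by rewrite mulrC divfK.
apply: (@cder0_segment _ (fun y => f y / g y)) => t t01.
have Ny := Nc _ _ Np Nx t t01.
have [+ _] := pow_atM (hf _ Ny) (pow_atV (hg _ Ny)).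
by rewrite subrr !mul0r oppr0.
Qed.

(* Around [s i] the branch [l] of [(x - s i)^-1/6] is multiplied by a primitive sixth
   root of unity: otherwise its square or its cube would be a global third or
   second root of [1/(x - s i)]. *)
Lemma sixth_root_jump : exists l l' mp mm,
  [/\ mp != 0, mm != 0,
   [/\ forall x, slit s c i x -> pow_at (6^-1) (s i) l x,
   forall x, cosector s c de i x -> pow_at (6^-1) (s i) l' x,
   forall x, rside s c de i x -> l x = l' x * mp &
   forall x, lside s c de i x -> l x = l' x * mm] &
   (mp / mm) ^+ 2 - (mp / mm) + 1 = 0].
Proof.
have k0 : (6^-1 : CC R) != 0 by rewrite invr_eq0 pnatr_eq0.
have sa x : slit s c i x -> x != s i by exact: slit_avoid.
have ca x : cosector s c de i x -> x != s i by exact: cosector_avoid.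
have [l hl] := scalar_solution k0 (@slit_open _ _ s c i) (slit_star Y0 i) sa.
have [c' cst] := cosector_star Y0 de0 i.
have [l' hl'] := scalar_solution k0 (@cosector_open _ _ s c de i) cst ca.
have rs x : rside s c de i x -> slit s c i x by move=> h; exact: (rside_slits rhoN h).
have ls x : lside s c de i x -> slit s c i x by move=> h; exact: (lside_slits rhoN h).
have rc' x : rside s c de i x -> cosector s c de i x by exact: rside_cosector.
have lc' x : lside s c de i x -> cosector s c de i x by exact: lside_cosector.
have [mp mp0 hp] := pow_ratio (@rside_convex _ _ _ _ _ i) (rside_ex s c de0 i)
  (fun x h => sa x (rs x h)) (fun x h => hl x (rs x h)) (fun x h => hl' x (rc' x h)).
have [mm mm0 hm] := pow_ratio (@lside_convex _ _ _ _ _ i) (lside_ex s c de0 i)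
  (fun x h => sa x (ls x h)) (fun x h => hl x (ls x h)) (fun x h => hl' x (lc' x h)).
exists l, l', mp, mm; split => //.
set mu := mp / mm.
(* If the jump has order dividing [e], the powers [l ^+ e] and [mp ^+ e * l' ^+ e] agree on both
   sides of the cut and glue to a branch on the whole punctured plane. *)
have single e : mu ^+ e = 1 -> exists f, forall x, x != s i -> pow_at (e%:R * 6^-1) (s i) f x.
  move=> mue; have mpe : mp ^+ e = mm ^+ e.
    by apply: (divIf (expf_neq0 e mm0)); rewrite -expr_div_n mue divff// expf_neq0.
  pose f x := if `[< slit s c i x >] then l x ^+ e else l' x ^+ e * mp ^+ e.
  have fS x : slit s c i x -> f x = l x ^+ e by move=> h; rewrite /f asboolT.
  have fC x : cosector s c de i x -> f x = mp ^+ e * l' x ^+ e.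
    move=> h; rewrite /f; case: asboolP => sx; last by rewrite mulrC.
    have [y0|y0|y0] := ltgtP (sl s c i x) 0.
    - by rewrite hm ?exprMn ?mpe 1?mulrC//; split; [case: h | rewrite ?oppr_gt0].
    - by rewrite hp ?exprMn 1?mulrC//; split; [case: h | rewrite ?oppr_gt0].
    - case: h => _ [|h]; first by rewrite y0 eqxx.
      by case: sx => [|sx]; [rewrite y0 eqxx | move: h; rewrite -opprB oppr_gt0 ltNge (ltW sx)].
  exists f => x xa.
  have [sx|cx] := slit_or_cosector Y0 de0 xa.
    have [r r0 hr] := slit_open sx.
    apply: pow_at_near r0 _ (pow_atX e (hl x sx)) => y /hr sy.
    by rewrite fS.
  have [r r0 hr] := cosector_open cx.
  apply: pow_at_near r0 _ (pow_atZ (expf_neq0 e mp0) (pow_atX e (hl' x cx))) => y /hr cy.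
  by rewrite fC.
have k6 : 6%:R * 6^-1 = 1 :> CC R by rewrite mulfV// pnatr_eq0.
have [xr hr] := rside_ex s c de0 i; have [xl hl_] := lside_ex s c de0 i.
have cstS x : slit s c i x -> l c ^+ 6 * (c - s i) = l x ^+ 6 * (x - s i).
  move=> sx; apply: (@cder0_segment _ (fun y => l y ^+ 6 * (y - s i))) => t t01.
  have sy := (slit_star Y0 i).2 _ sx t t01.
  by apply: pow_at_cst k6 _ (hl _ sy); exact: sa.
have cstC x : cosector s c de i x -> l' c' ^+ 6 * (c' - s i) = l' x ^+ 6 * (x - s i).
  move=> cx; apply: (@cder0_segment _ (fun y => l' y ^+ 6 * (y - s i))) => t t01.
  have cy := cst.2 _ cx t t01.
  by apply: pow_at_cst k6 _ (hl' _ cy); exact: ca.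
(* In either chart the sixth power times [x - s i] is constant; comparing these constants on the two
   sides shows that the jump is a sixth root of unity. *)
have mpmm : mp ^+ 6 = mm ^+ 6.
  have e1 := cstS _ (rs _ hr); have e2 := cstS _ (ls _ hl_).
  rewrite (hp _ hr) exprMn [RHS]mulrAC -(cstC _ (rc' _ hr)) in e1.
  rewrite (hm _ hl_) exprMn [RHS]mulrAC -(cstC _ (lc' _ hl_)) e1 in e2.
  have cc : cosector s c de i c' := cst.1.
  apply: mulfI e2; rewrite mulf_neq0 ?expf_neq0//; last by rewrite subr_eq0 ca.
  by have [] := hl' _ cc.
have mu6 : mu ^+ 6 = 1 by rewrite exprMn exprVn mpmm mulfV// expf_neq0.
have [w3 w0] := omega_props.
have mu2 : mu ^+ 2 != 1.
  apply/eqP => /single[f hf]; apply: (no_cube_root w3 w0 (a := s i) (f := f)) => x /hf.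
  by have -> : 2%:R * 6^-1 = 3^-1 :> CC R by field.
have mu3 : mu ^+ 3 != 1.
  apply/eqP => /single[f hf]; apply: (no_square_root (a := s i) (f := f)) => x /hf.
  by have -> : 3%:R * 6^-1 = 2^-1 :> CC R by field.
have /eqP : (mu ^+ 3 - 1) * ((mu + 1) * (mu ^+ 2 - mu + 1)) = 0.
  have -> : (mu ^+ 3 - 1) * ((mu + 1) * (mu ^+ 2 - mu + 1)) = mu ^+ 6 - 1 by ring.
  by rewrite mu6 subrr.
rewrite !mulf_eq0 subr_eq0 (negbTE mu3) /= => /orP[|/eqP//].
by rewrite addr_eq0 => /eqP h; move: mu2; rewrite h sqrrN expr1n eqxx.
Qed.

End ScalarJump.
End ScalarEquation.

(** * Jumps across the slits *)

Section Jumps.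
Context {R : realType}.
Implicit Types (x y z p q u : CC R) (O N : CC R -> Prop).
Variables (m : nat) (ka : R).
Local Notation n := m.+1.
Variables (s : 'I_n -> CC R) (c : CC R) (de : R).
Hypothesis Y0 : forall j, 0 < py c (s j).
Hypothesis de0 : 0 < de.
Hypothesis rhoL : forall i j : 'I_n, (i < j)%N -> rho s c j + de <= rho s c i.
Let B : 'M[CC R]_n := resB n ka.
Variables (F G : CC R -> 'M[CC R]_n) (F' G' : 'I_n -> CC R -> 'M[CC R]_n).
Variables (Cp Cm : 'I_n -> 'M[CC R]_n).
Hypothesis FG : fund B s (slits s c) F G.
Hypothesis FG' : forall i, fund B s (cosector s c de i) (F' i) (G' i).
Hypothesis uCm : forall i, Cm i \in unitmx.
Hypothesis hCp : forall i x, rside s c de i x -> G' i x = Cp i *m G x.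
Hypothesis hCm : forall i x, lside s c de i x -> G' i x = Cm i *m G x.
(** On the right of ray [i] one has [F = F' Cp], on the left [F = F' Cm]. So [F], continued from
    right to left beyond [s i], arrives as [F] times this matrix. *)
Definition jump (Cp Cm : 'I_n -> 'M[CC R]_n) i := invmx (Cm i) *m Cp i.
Local Notation M := (jump Cp Cm).

Lemma rhoN i j : i != j -> de <= `|rho s c i - rho s c j|.
Proof.
rewrite neq_ltn => /orP[/rhoL|/rhoL] h; rewrite ler_normr; apply/orP; [left|right]; lra.
Qed.

(** Multiplication by a branch of [(x - a)^-b] removes the extra term of the Frobenius equations and
    leaves a true horizontal section. *)
Lemma twist_hsol k a b l (h : CC R -> 'M[CC R]_(n, k)) x : pow_at b a l x ->
  mder h x ((b / (x - a)) *: h x - okubo B s x *m h x) -> hsol B s (fun y => l y *: h y) x.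
Proof.
move=> [hl _] hh; apply: mder_eq (mderZ hl hh) _.
rewrite scalerBr scalerA -scalemxAr scaleNr addrA (mulrC (l x)) addNr sub0r.
by rewrite scalemxAr.
Qed.

(** The coordinates of the section [l h] in the basis [F]; they stay constant as long as no cut is
    crossed. *)
Definition pulled k (l : CC R -> CC R) (h : CC R -> 'M[CC R]_(n, k)) x := G x *m (l x *: h x).

(** The section [l' h] is horizontal across the ray, so its coordinates in the chart [F'] are the
    same on both sides. Rewriting them through [F] and [l] brings in the jump matrix and the scalar
    jump. *)
Lemma crossing k i l l' mp mm (h : CC R -> 'M[CC R]_(n, k)) q q' :
  mp != 0 -> mm != 0 ->
  rside s c de i q -> lside s c de i q' -> l q = l' q * mp -> l q' = l' q' * mm ->
  (forall t, in01 t -> cosector s c de i (seg q q' t)) ->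
  (forall t, in01 t -> hsol B s (fun y => l' y *: h y) (seg q q' t)) ->
  M i *m pulled l h q = (mp / mm) *: pulled l h q'.
Proof.
move=> mp0 mm0 hq hq' e e' hc hs.
have : G' i q *m (l' q *: h q) = G' i q' *m (l' q' *: h q').
  apply: (pair_segment (B := B) (s := s) (Y := G' i) (Z := fun y => l' y *: h y)) => // t t01.
  by have [] := FG' (hc t t01).
rewrite (hCp hq) (hCm hq') /pulled /jump.
have -> : l q *: h q = mp *: (l' q *: h q) by rewrite e mulrC scalerA.
have -> : l q' *: h q' = mm *: (l' q' *: h q') by rewrite e' mulrC scalerA.
move: (l' q *: h q) (l' q' *: h q') => A A' E.
rewrite -[G q *m _]scalemxAr -[G q' *m _]scalemxAr -[LHS]scalemxAr [RHS]scalerA divfK//; congr (_ *: _).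
by rewrite -[_ *m _ *m _]mulmxA [Cp i *m _]mulmxA E -mulmxA mulKmx.
Qed.

Lemma pulled_rank k l (h : CC R -> 'M[CC R]_(n, k)) x :
  slits s c x -> l x != 0 -> \rank (pulled l h x) = \rank (h x).
Proof.
move=> sx lx; rewrite /pulled -scalemxAr mxrank_scale_nz//.
have [_ _ /mulmx1_unit[uG _]] := FG sx.
by rewrite eqmxMfull ?row_full_unit.
Qed.

(* The points used to cross the [i]th cut near [s i]: all lie on segments of
   slope coordinate between [-a] and [a] and height between [Y - a] and [Y + a]. *)
Lemma pole_crossing k i l l' mp mm (h : CC R -> 'M[CC R]_(n, k)) (r : R) :
  mp != 0 -> mm != 0 -> 0 < r ->
  (forall x, rside s c de i x -> l x = l' x * mp) ->
  (forall x, lside s c de i x -> l x = l' x * mm) ->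
  (forall x, x != s i -> cmod (x - s i) < r ->
     (slit s c i x -> hsol B s (fun y => l y *: h y) x) /\
     (cosector s c de i x -> hsol B s (fun y => l' y *: h y) x)) ->
  exists x, [/\ slits s c x, x != s i, cmod (x - s i) < r &
    M i *m pulled l h x = (mp / mm) *: pulled l h x].
Proof.
move=> mp0 mm0 r0 hp hm hs.
have Yi := Y0 i; set Y := py c (s i) in Yi *; set ro := rho s c i.
have ro0 := normr_ge0 ro.
(* The three bounds keep the points well above [c], inside the sector of ray [i], and inside the
   disc of radius [r] about the pole; the last one accounts for the slant of the ray. *)
pose a := Num.min (Y / 2) (Num.min (de * Y / 4) (r / (2 * (3 + `|ro|)))).
have a0 : 0 < a by rewrite !lt_min !divr_gt0 ?mulr_gt0//; lra.
have a1 : a <= Y / 2 by rewrite ge_min lexx.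
have a2 : a <= de * Y / 4 by rewrite !ge_min lexx orbT.
have a3 : a * (3 + `|ro|) < r.
  have : a <= r / (2 * (3 + `|ro|)) by rewrite !ge_min lexx !orbT.
  rewrite ler_pdivlMr; last lra.
  by move=> h3; lra.
(* coordinates: slope [v], height [w] *)
pose P v w := pt c (v + ro * w) w.
have slP v w : sl s c i (P v w) = v by rewrite /sl px_pt py_pt addrK.
have pyP v w : py c (P v w) = w by rewrite py_pt.
have close x : `|sl s c i x| <= a -> `|py c x - Y| <= a -> cmod (x - s i) < r.
  move=> h1 h2; apply: le_lt_trans (cmod_pxy c (s i) x) _; rewrite -/Y.
  have -> : px c x - px c (s i) = sl s c i x + ro * (py c x - Y).
    by rewrite (px_pole Y0) /sl -/ro -/Y; ring.
  apply: le_lt_trans (lerD (ler_normD _ _) h2) _; rewrite normrM.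
  have := ler_wpM2l ro0 h2; lra.
have sect x : `|sl s c i x| <= a -> `|py c x - Y| <= a -> sector s c de i x.
  rewrite !ler_norml => /andP[h1 h2] /andP[h3 h4].
  have p1 : Y / 2 <= py c x by lra.
  have p2 : de * (Y / 2) <= de * py c x by rewrite ler_wpM2l// ltW.
  have p3 : 0 < de * Y by rewrite mulr_gt0.
  by split; [|split]; lra.
have segb v w v' w' t : in01 t -> `|v| <= a -> `|v'| <= a -> `|w - Y| <= a -> `|w' - Y| <= a ->
  `|sl s c i (seg (P v w) (P v' w') t)| <= a /\ `|py c (seg (P v w) (P v' w') t) - Y| <= a.
  rewrite sl_seg py_seg !slP !pyP => /andP[t0 t1].
  rewrite !ler_norml => /andP[b1 b2] /andP[b3 b4] /andP[b5 b6] /andP[b7 b8].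
  by split; apply/andP; split; nra.
have na : `|a| <= a by rewrite ger0_norm// ltW.
have nNa : `|- a| <= a by rewrite normrN.
have n0 : `|0 : R| <= a by rewrite normr0 ltW.
have yp : `|Y + a - Y| <= a by rewrite addrAC subrr add0r.
have ym : `|Y - a - Y| <= a by rewrite addrAC subrr add0r.
(* The triangle [x], [q], [q'] encircles the pole: [x] lies on the ray just before it, the other two
   lie above and on either side. Only the edge from [q] to [q'] crosses the cut. *)
pose q := P a (Y + a); pose q' := P (- a) (Y + a); pose x := P 0 (Y - a).
have hq : rside s c de i q by split; [apply: sect; rewrite ?slP ?pyP | rewrite slP].
have hq' : lside s c de i q' by split; [apply: sect; rewrite ?slP ?pyP | rewrite slP opprK].
have sx : slits s c x.
  move=> j; have [->|ji] := eqVneq j i; first by right; rewrite pyP -/Y; lra.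
  by apply: (sector_slit rhoN ji); apply: sect; rewrite ?slP ?pyP.
have below v : v != 0 -> `|v| <= a -> forall t, in01 t ->
    slits s c (seg x (P v (Y + a)) t) /\ cmod (seg x (P v (Y + a)) t - s i) < r.
  move=> v0 va t t01; have [h1 h2] := segb 0 (Y - a) v (Y + a) t t01 n0 va ym yp.
  split; last exact: close.
  move=> j; have [->|ji] := eqVneq j i; last by apply: (sector_slit rhoN ji); exact: sect.
  rewrite /slit sl_seg py_seg !slP !pyP subr0 add0r -/Y.
  have [->|t0] := eqVneq t 0; first by right; rewrite mul0r addr0; lra.
  by left; rewrite mulf_neq0.
have same v : v != 0 -> `|v| <= a -> pulled l h x = pulled l h (P v (Y + a)).
  move=> v0 va; apply: (pair_segment (B := B) (s := s) (Y := G) (Z := fun y => l y *: h y)).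
    by move=> t t01; have [sy _] := below v v0 va t t01; have [] := FG sy.
  move=> t t01; have [sy cl] := below v v0 va t t01.
  have yN : seg x (P v (Y + a)) t != s i by apply: (slit_avoid Y0 (sy i)).
  exact: (hs _ yN cl).1 (sy i).
exists x; split=> //; first exact: (slit_avoid Y0 (sx i)).
  by apply: close; rewrite ?slP ?pyP.
rewrite {1}(same a) ?gt_eqF// (same (- a)) ?oppr_eq0 ?gt_eqF//.
apply: (@crossing k i l l' mp mm) => //; [exact: hp | exact: hm | |].
  move=> t t01; have [h1 h2] := segb a (Y + a) (- a) (Y + a) t t01 na nNa yp yp.
  by split; [exact: sect | right; rewrite py_seg !pyP -/Y; lra].
move=> t t01; have [h1 h2] := segb a (Y + a) (- a) (Y + a) t t01 na nNa yp yp.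
have cy : cosector s c de i (seg q q' t).
  by split; [exact: sect | right; rewrite py_seg !pyP -/Y; lra].
exact: (hs _ (cosector_avoid Y0 rhoN i cy) (close _ h1 h2)).2.
Qed.

(** A large rectangle is traversed: along its top all cuts are crossed from right to left, and the
    way back passes the left side, the bottom and the right side without meeting a cut. The branch
    [l] jumps only at the cut of [s i0]; at the others it serves as its own continuation. *)
Lemma infinity_crossing k i0 l l' mp mm (h : CC R -> 'M[CC R]_(n, k)) (R0 : R) :
  mp != 0 -> mm != 0 ->
  (forall x, rside s c de i0 x -> l x = l' x * mp) ->
  (forall x, lside s c de i0 x -> l x = l' x * mm) ->
  (forall x, R0 < cmod (x - s i0) ->
     (slit s c i0 x -> hsol B s (fun y => l y *: h y) x) /\
     (cosector s c de i0 x -> hsol B s (fun y => l' y *: h y) x)) ->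
  exists x, [/\ slits s c x, R0 < cmod (x - s i0) &
    pprod (fun j => M (inord j)) n *m pulled l h x = (mp / mm) *: pulled l h x].
Proof.
move=> mp0 mm0 hp hm hs.
pose H := `|R0| + \sum_j py c (s j) + 1.
have sum0 : 0 <= \sum_j py c (s j) by apply: sumr_ge0 => j _; exact: ltW.
have HY j : py c (s j) + `|R0| < H.
  rewrite /H (bigD1 j)//=.
  set S := \sum_(i < n | i != j) _.
  have : 0 <= S by apply: sumr_ge0 => i _; exact: ltW.
  lra.
have R00 := normr_ge0 R0; have R0R := ler_norm R0.
have H0 : 0 < H by have := HY ord0; have := Y0 ord0; lra.
have farY x : `|R0| + py c (s i0) < `|py c x| -> R0 < cmod (x - s i0).
  move=> h1; have := py_lip c (s i0) x; have := ler_normD (py c x - py c (s i0)) (py c (s i0)).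
  rewrite subrK (ger0_norm (ltW (Y0 i0))); lra.
(* At height [H] adjacent rays are at least [3 dH] apart, so the points at distance [dH] on either
   side of each ray come in the expected order. *)
pose dH := de * H / 3.
have dH0 : 0 < dH by rewrite divr_gt0// mulr_gt0.
have deH : de * H = 3 * dH by rewrite /dH; field.
clearbody dH.
pose q j := pt c (rho s c j * H + dH) H; pose q' j := pt c (rho s c j * H - dH) H.
have slH j a : sl s c j (pt c a H) = a - rho s c j * H by rewrite /sl px_pt py_pt.
have hq j : rside s c de j (q j).
  split; last by rewrite slH; lra.
  by rewrite /sector slH py_pt deH; split=> //; split; lra.
have hq' j : lside s c de j (q' j).
  split; last by rewrite slH; lra.
  by rewrite /sector slH py_pt deH; split=> //; split; lra.
have ord (i j : 'I_n) : (i < j)%N -> rho s c j * H + 3 * dH <= rho s c i * H.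
  move=> /rhoL h1; have := ler_wpM2r (ltW H0) h1.
  by rewrite mulrDl deH; lra.
have Kseg x y : (forall t, in01 t -> slits s c (seg x y t) /\ R0 < cmod (seg x y t - s i0)) ->
    pulled l h x = pulled l h y.
  move=> hxy; apply: (pair_segment (B := B) (s := s) (Y := G) (Z := fun y => l y *: h y)).
    by move=> t /hxy[sy _]; have [] := FG sy.
  by move=> t /hxy[sy cl]; exact: (hs _ cl).1 (sy i0).
have level a b t : py c (seg (pt c a H) (pt c b H) t) = H.
  by rewrite py_seg !py_pt subrr mulr0 addr0.
have levelfar a b t : R0 < cmod (seg (pt c a H) (pt c b H) t - s i0).
  by apply: farY; rewrite level (ger0_norm (ltW H0)); have := HY i0; lra.
have levelpx a b t j : sl s c j (seg (pt c a H) (pt c b H) t) = a + t * (b - a) - rho s c j * H.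
  by rewrite /sl level px_seg !px_pt.
have ha j : M j *m pulled l h (q j) = (if j == i0 then mp / mm else 1) *: pulled l h (q' j).
  have cs t : in01 t -> cosector s c de j (seg (q j) (q' j) t).
    move=> /andP[t0 t1]; split; last by right; rewrite level; have := HY j; lra.
    have b1 : 0 <= t * dH by rewrite mulr_ge0// ltW.
    have b2 : t * dH <= dH by rewrite ler_piMl// ltW.
    by rewrite /sector level levelpx deH; split=> //; split; lra.
  have [ji|ji] := eqVneq j i0.
    rewrite ji in cs *.
    apply: (crossing (l' := l')) => // [||t t01].
    - by apply: hp; rewrite //.
    - by apply: hm.
    - exact: (hs _ (levelfar _ _ _)).2 (cs t t01).
  rewrite -[X in X *: _](divff (oner_neq0 (CC R))).
  apply: (crossing (l' := l)) => //; rewrite ?oner_neq0 ?mulr1//.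
  move=> t t01; apply: (hs _ (levelfar _ _ _)).1.
  apply: (sector_slit rhoN (i := j)); first by rewrite eq_sym.
  by case: (cs t t01).
have hb (i j : 'I_n) : j = i.+1 :> nat -> pulled l h (q' i) = pulled l h (q j).
  move=> ji; apply: Kseg => t /andP[t0 t1]; split; last exact: levelfar.
  move=> e; left; rewrite levelpx.
  have o1 := ord i j; rewrite ji ltnSn in o1; have {}o1 := o1 isT.
  have [ei|ei] := leqP e i.
    have : rho s c i * H <= rho s c e * H.
      have [->//|ne] := eqVneq e i.
      have := ord e i; rewrite ltn_neqAle ne ei => /(_ isT); lra.
    by move=> o2; apply/eqP; nra.
  have : rho s c e * H <= rho s c j * H.
    have [->//|ne] := eqVneq e j.
    have := ord j e; rewrite ltn_neqAle eq_sym ne ji ei => /(_ isT); lra.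
  by move=> o2; apply/eqP; nra.
(* The half-width exceeds the offset of every ray at heights up to [H], so the vertical sides meet
   no ray, and it keeps them farther than [R0] from [s i0]. *)
pose A := \sum_j `|rho s c j| * H + dH + `|R0| + `|px c (s i0)| + 1.
have Aro j : `|rho s c j| * H + dH + `|R0| + `|px c (s i0)| + 1 <= A.
  rewrite /A (bigD1 j)//= !lerD2r lerDl.
  by apply: sumr_ge0 => i _; rewrite mulr_ge0// ltW.
have A0 : 0 < A.
  by have := Aro ord0; have := mulr_ge0 (normr_ge0 (rho s c ord0)) (ltW H0);
     have := normr_ge0 (px c (s i0)); lra.
(* The way back from the last ray to the first, around the rectangle. *)
have hc : pulled l h (q' ord_max) = pulled l h (q ord0).
  have roH j (w : R) : `|w| <= H -> `|rho s c j * w| <= `|rho s c j| * H.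
    by move=> hw; rewrite normrM ler_wpM2l.
  have cvx (u v t : R) : 0 <= t <= 1 -> u < 0 -> v < 0 -> u + t * (v - u) < 0.
    by move=> /andP[t0 t1] u0 v0; nra.
  have roA j (w : R) : `|w| <= H -> - A < rho s c j * w < A.
    move=> /(roH j); rewrite ler_norml => /andP[k1 k2]; have := Aro j.
    by have := normr_ge0 (px c (s i0)); move=> k3 k4; apply/andP; split; lra.
  have HH : `|H| <= H by rewrite ger0_norm// ltW.
  have HNH : `|- H| <= H by rewrite normrN.
  have mono j : rho s c ord_max * H <= rho s c j * H <= rho s c ord0 * H.
    apply/andP; split.
      have [->//|ne] := eqVneq j ord_max.
      have := ord j ord_max; rewrite ltn_neqAle -val_eqE in ne *; rewrite ne -ltnS ltn_ord.
      by move=> /(_ isT); lra.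
    have [->//|ne] := eqVneq j ord0.
    have := ord ord0 j; rewrite lt0n -val_eqE in ne *; rewrite ne.
    by move=> /(_ isT); lra.
  have side (a : R) : `|a| = A ->
      pulled l h (pt c a H) = pulled l h (pt c a (- H)).
    move=> aA; apply: Kseg => t /andP[t0 t1].
    have pyE : py c (seg (pt c a H) (pt c a (- H)) t) = H + t * (- H - H).
      by rewrite py_seg !py_pt.
    have pxE : px c (seg (pt c a H) (pt c a (- H)) t) = a.
      by rewrite px_seg !px_pt subrr mulr0 addr0.
    have pyH : `|H + t * (- H - H)| <= H by rewrite ler_norml; apply/andP; split; nra.
    split.
      move=> e; left; rewrite /sl pyE pxE subr_eq0.
      apply: contra_eq_neq aA => ->.
      by rewrite lt_eqF// ltr_norml roA.
    have := px_lip c (s i0) (seg (pt c a H) (pt c a (- H)) t); rewrite pxE.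
    have := ler_normD (a - px c (s i0)) (px c (s i0)); rewrite subrK aA.
    have := Aro ord0; have := mulr_ge0 (normr_ge0 (rho s c ord0)) (ltW H0); lra.
  transitivity (pulled l h (pt c (- A) H)).
    apply: Kseg => t t01; split; last exact: levelfar.
  move=> e; left; rewrite levelpx; apply/eqP => e0.
    have := cvx (rho s c ord_max * H - dH - rho s c e * H) (- A - rho s c e * H) t t01.
    have /andP[m1 m2] := mono e; have /andP[m3 m4] := roA e H HH.
    have -> : rho s c ord_max * H - dH - rho s c e * H +
      t * (- A - rho s c e * H - (rho s c ord_max * H - dH - rho s c e * H)) =
      rho s c ord_max * H - dH + t * (- A - (rho s c ord_max * H - dH)) - rho s c e * H by ring.
    rewrite e0; lra.
  transitivity (pulled l h (pt c (- A) (- H))).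
    by apply: side; rewrite normrN ger0_norm// ltW.
  transitivity (pulled l h (pt c A (- H))).
    apply: Kseg => t /andP[t0 t1].
    have pyE : py c (seg (pt c (- A) (- H)) (pt c A (- H)) t) = - H.
      by rewrite py_seg !py_pt subrr mulr0 addr0.
    split; first by move=> e; right; rewrite pyE; have := Y0 e; lra.
    by apply: farY; rewrite pyE normrN (ger0_norm (ltW H0)); have := HY i0; lra.
  transitivity (pulled l h (pt c A H)).
    by rewrite side// ger0_norm// ltW.
  apply: Kseg => t t01; split; last exact: levelfar.
  move=> e; left; rewrite levelpx; apply/eqP => e0.
  have := cvx (- (A - rho s c e * H)) (- (rho s c ord0 * H + dH - rho s c e * H)) t t01.
  have /andP[m1 m2] := mono e; have /andP[m3 m4] := roA e H HH.
  have -> : - (A - rho s c e * H) + t * (- (rho s c ord0 * H + dH - rho s c e * H) - - (A - rho s c e * H)) =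
    - (A + t * (rho s c ord0 * H + dH - A) - rho s c e * H) by ring.
  rewrite e0; lra.
exists (q ord0); split.
- exact: (rside_slits rhoN (hq ord0)).
- by have := levelfar (rho s c ord0 * H + dH) 0 0; rewrite seg0.
have step j (jn : (j < n)%N) : pprod (fun j => M (inord j)) j *m pulled l h (q ord0) =
    (if (i0 < j)%N then mp / mm else 1) *: pulled l h (q (Ordinal jn)).
  elim: j jn => [|j IH] jn.
    rewrite mul1mx ltn0 scale1r; congr (pulled l h (q _)); exact: val_inj.
  rewrite /= -mulmxA (IH (ltnW jn)) -scalemxAr.
  have -> : inord j = Ordinal (ltnW jn) by apply: val_inj; rewrite /= inordK// ltnW.
  rewrite ha scalerA (hb _ (Ordinal jn))//; congr (_ *: _).
  have -> : (Ordinal (ltnW jn) == i0) = (nat_of_ord i0 == j) by rewrite eq_sym.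
  rewrite ltnS; move: (mp / mm) => mu.
  by case: ltngtP => _; rewrite ?mulr1 ?mul1r.
have -> : pprod (fun j => M (inord j)) n = M (inord m) *m pprod (fun j => M (inord j)) m by [].
rewrite -mulmxA (step m (ltnSn m)) -scalemxAr.
have -> : inord m = ord_max :> 'I_n by apply: val_inj; rewrite /= inordK.
have -> : Ordinal (ltnSn m) = ord_max by exact: val_inj.
rewrite ha scalerA hc; congr (_ *: _).
rewrite -val_eqE /=; have := ltn_ord i0; rewrite ltnS leq_eqVlt => /orP[/eqP->|im].
  by rewrite eqxx ltnn mul1r.
by rewrite im gtn_eqF// mulr1.
Qed.
End Jumps.

(** * The conditions satisfied by the tuple of jumps *)

Section JumpsSpec.
Context {R : realType}.
Implicit Types (x y z p q u : CC R).

Lemma resB_unit m (ka : R) : ka != 0 -> resB m.+1 ka \in unitmx.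
Proof.
move=> ka0; set n := m.+1.
have rka0 : rc ka != 0 by apply: contra_neq ka0 => /ceqP[]; rewrite !creE.
rewrite /resB unitmxZ ?unitfE//.
pose J : 'M[CC R]_n := const_mx 1.
have JJ : J *m J = n%:R *: J.
  apply/matrixP => i j; rewrite !mxE; under eq_bigr do rewrite !mxE mulr1.
  by rewrite sumr_const card_ord mulr1.
have n0 : (n.+1%:R : CC R) != 0 by rewrite pnatr_eq0.
suff : (J + 1%:M) *m (1%:M - n.+1%:R^-1 *: J) = 1%:M by case/mulmx1_unit.
rewrite mulmxBr mulmx1 -scalemxAr mulmxDl mul1mx JJ -{3}[J]scale1r -scalerDl.
by rewrite scalerA natr1 mulVf// scale1r addrC addKr.
Qed.

(** For the negative sign the inverse branches are taken; their jump is the inverse root of unity,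
    which satisfies the same equation. *)
Lemma sixth_root_jump_sgn n (s : 'I_n -> CC R) c de (i : 'I_n) (ka : R) :
  ka = 6^-1 \/ ka = - 6^-1 ->
  (forall j, 0 < py c (s j)) -> 0 < de ->
  (forall i j, i != j -> de <= `|rho s c i - rho s c j|) ->
  exists l l' mp mm,
  [/\ mp != 0, mm != 0,
   [/\ forall x, slit s c i x -> pow_at (rc ka) (s i) l x,
   forall x, cosector s c de i x -> pow_at (rc ka) (s i) l' x,
   forall x, rside s c de i x -> l x = l' x * mp &
   forall x, lside s c de i x -> l x = l' x * mm] &
   (mp / mm) ^+ 2 - (mp / mm) + 1 = 0].
Proof.
move=> ka6 Y0 de0 rN.
have [l [l' [mp [mm [mp0 mm0 [h1 h2 h3 h4] mu]]]]] := sixth_root_jump i Y0 de0 rN.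
have rE : rc (6^-1) = 6^-1 :> CC R by rewrite /rc fmorphV rmorph_nat.
case: ka6 => ->; first by rewrite rE; exists l, l', mp, mm.
rewrite rcN rE; exists (fun x => (l x)^-1), (fun x => (l' x)^-1), mp^-1, mm^-1.
rewrite !invr_eq0; split=> //.
  split=> x hx; [exact/pow_atV/h1 | exact/pow_atV/h2 | |].
    by rewrite h3// invfM.
  by rewrite h4// invfM.
have d0 : mp / mm != 0 by rewrite mulf_neq0 ?invr_eq0.
rewrite -invfM -[RHS](mulr0 ((mp / mm) ^- 2)) -mu invfM invrK.
by field; rewrite mp0 mm0.
Qed.

Lemma kernel_rank n (A K : 'M[CC R]_n) : A *m K = 0 -> (n.-1 <= \rank K)%N ->
  (\rank A <= 1)%N.
Proof. by move=> /mulmx0_rank_max; lia. Qed.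

(** For each [i] one branch of [(x - s i)^-ka] is used both at the pole, squared, and at infinity,
    where the sections are centred at [s i]. This ties the eigenvalue of the [i]th jump to the
    scalar at infinity, and since that scalar is determined by the product, one [zeta] serves all
    poles. *)
Theorem jumps_spec m (ka : R) (s : 'I_m.+1 -> CC R) (c : CC R) (de : R) :
  (2 <= m <= 4)%N -> ka = 6^-1 \/ ka = - 6^-1 -> injective s ->
  (forall j, 0 < py c (s j)) -> 0 < de ->
  (forall i j : 'I_m.+1, (i < j)%N -> rho s c j + de <= rho s c i) ->
  exists F G F' G' Cp Cm (zeta : CC R),
  [/\ [/\ F c = 1%:M, fund (resB m.+1 ka) s (slits s c) F G,
    forall i, fund (resB m.+1 ka) s (cosector s c de i) (F' i) (G' i),
    forall i, Cp i \in unitmx /\ Cm i \in unitmx &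
    forall i x, (rside s c de i x -> F x = F' i x *m Cp i) /\
                (lside s c de i x -> F x = F' i x *m Cm i)],
   zeta ^+ 2 - zeta + 1 = 0,
   forall i, (\rank (jump Cp Cm i - 1%:M)%R <= 1)%N,
   forall i, exists2 k : 'cV_m.+1, k != 0 & jump Cp Cm i *m k = zeta ^+ 2 *: k &
   (\rank (pprod (fun j => jump Cp Cm (inord j)) m.+1 - zeta%:M)%R <= 1)%N].
Proof.
move=> /andP[m2 m4] ka6 sinj Y0 de0 rhoL; pose B : 'M[CC R]_m.+1 := resB m.+1 ka.
have rN := rhoN rhoL.
have ka0 : ka != 0 by case: ka6 => ->; rewrite ?oppr_eq0 invr_eq0 pnatr_eq0.
have uB : B \in unitmx by exact: resB_unit.
have [F [G [Fc FG]]] := star_fund uB (@slits_open _ _ s c) (slits_star Y0)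
  (fun x sx j => slit_avoid Y0 (sx j)).
have /choice[FG' hFG'] i : exists FG' : (CC R -> 'M[CC R]_m.+1) * (CC R -> 'M[CC R]_m.+1),
    fund B s (cosector s c de i) FG'.1 FG'.2.
  have [c' st] := cosector_star Y0 de0 i.
  have [F' [G' [_ h]]] := star_fund uB (@cosector_open _ _ s c de i) st
    (fun x cx j => cosector_avoid Y0 rN j cx).
  by exists (F', G').
have /choice[Cp hCp] i : exists C : 'M[CC R]_m.+1, C \in unitmx /\ forall x, rside s c de i x ->
    F x = (FG' i).1 x *m C /\ (FG' i).2 x = C *m G x.
  have [C uC hC] := convex_transition (@rside_convex _ _ s c de i) (rside_ex s c de0 i)
    (fund_sub (fun x h => rside_slits rN h) FG)
    (fund_sub (fun x h => rside_cosector h) (hFG' i)).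
  by exists C.
have /choice[Cm hCm] i : exists C : 'M[CC R]_m.+1, C \in unitmx /\ forall x, lside s c de i x ->
    F x = (FG' i).1 x *m C /\ (FG' i).2 x = C *m G x.
  have [C uC hC] := convex_transition (@lside_convex _ _ s c de i) (lside_ex s c de0 i)
    (fund_sub (fun x h => lside_slits rN h) FG)
    (fund_sub (fun x h => lside_cosector h) (hFG' i)).
  by exists C.
have uCm i : Cm i \in unitmx by case: (hCm i).
have hp i x : rside s c de i x -> (FG' i).2 x = Cp i *m G x by move=> /(hCp i).2[].
have hm i x : lside s c de i x -> (FG' i).2 x = Cm i *m G x by move=> /(hCm i).2[].
pose M := jump Cp Cm.
(* for each centre, the total monodromy has its jump as eigenvalue *)
have inf i : exists zeta : CC R, [/\ zeta ^+ 2 - zeta + 1 = 0,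
    exists2 k : 'cV_m.+1, k != 0 & M i *m k = zeta ^+ 2 *: k &
    (\rank (pprod (fun j => M (inord j)) m.+1 - zeta%:M)%R <= 1)%N].
  have [l [l' [mp [mm [mp0 mm0 [h1 h2 h3 h4] mu]]]]] := sixth_root_jump_sgn i ka6 Y0 de0 rN.
  exists (mp / mm); split=> //.
    have [r [h [r0 hh h0]]] := frobenius_vector ka6 sinj i.
    have k2 : rc (2 * ka) = 2%:R * rc ka by rewrite rcM /rc rmorph_nat.
    have [||||||x [sx xs xr e]] := pole_crossing Y0 de0 rhoL FG hFG' uCm hp hm (i := i)
      (l := fun x => l x ^+ 2) (l' := fun x => l' x ^+ 2) (mp := mp ^+ 2) (mm := mm ^+ 2)
      (h := h) (r := r).
    - exact: expf_neq0.
    - exact: expf_neq0.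
    - exact: r0.
    - by move=> x /h3 ->; rewrite exprMn.
    - by move=> x /h4 ->; rewrite exprMn.
    - move=> x xs xr; have := hh x xs xr; rewrite k2 => hx.
      by split=> [/h1|/h2] /(pow_atX 2) hl; exact: twist_hsol hl hx.
    exists (pulled G (fun x => l x ^+ 2) h x).
      rewrite -mxrank_eq0 (pulled_rank FG)// ?mxrank_eq0 ?h0//.
      by rewrite expf_neq0//; case: (h1 x (sx i)).
    by rewrite e -expr_div_n.
  have [R0 [h [R00 hh]]] := @infinity_section R m.+1 ka s ka6 isT (ltac:(lia)) (s i).
  have [|||x [sx xR e]] := infinity_crossing Y0 de0 rhoL FG hFG' uCm hp hm (i0 := i)
    (l := l) (l' := l') (mp := mp) (mm := mm) (h := h) (R0 := R0) mp0 mm0.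
  - by [].
  - by [].
  - move=> x /hh[_ hx _].
    by split=> [/h1|/h2] hl; exact: twist_hsol hl hx.
  apply: (@kernel_rank _ _ (pulled G l h x)).
    by rewrite mulmxBl e mul_scalar_mx subrr.
  rewrite (pulled_rank FG)//; first by case: (hh x xR).
  by case: (h1 x (sx i)).
have [zeta [z1 z2 z3]] := inf ord0.
(* Two different scalars would make a nonzero scalar matrix, of rank at least 3, the difference of
   two matrices of rank at most one. *)
have same mu : (\rank (pprod (fun j => M (inord j)) m.+1 - mu%:M)%R <= 1)%N -> mu = zeta.
  move=> h; apply/eqP; apply: contraT => ne.
  have rk : \rank ((mu - zeta)%:M : 'M[CC R]_m.+1) = m.+1.
    by rewrite -scalemx1 mxrank_scale_nz ?mxrank1// subr_eq0.
  have := mxrank_add (pprod (fun j => M (inord j)) m.+1 - zeta%:M)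
    (- (pprod (fun j => M (inord j)) m.+1 - mu%:M)).
  have -> : pprod (fun j => M (inord j)) m.+1 - zeta%:M
    - (pprod (fun j => M (inord j)) m.+1 - mu%:M) = (mu - zeta)%:M.
    by rewrite opprB addrC addrA subrK raddfB.
  rewrite mxrank_opp rk; lia.
exists F, G, (fun i => (FG' i).1), (fun i => (FG' i).2), Cp, Cm, zeta; split; [|exact: z1| | |exact: z3].
- split; [exact: Fc | exact: FG | exact: hFG' | |] => i.
    by split; [case: (hCp i) | case: (hCm i)].
  by move=> x; split=> [/(hCp i).2[]|/(hCm i).2[]].
- move=> i; have [r [h [r0 hh hr]]] := frobenius_rank ka6 sinj i.
  have [||||||x [sx xs xr e]] := pole_crossing Y0 de0 rhoL FG hFG' uCm hp hm (i := i)
      (l := fun=> 1) (l' := fun=> 1) (mp := 1) (mm := 1) (h := h) (r := r).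
  - exact: oner_neq0.
  - exact: oner_neq0.
  - exact: r0.
  - by move=> x _; rewrite mulr1.
  - by move=> x _; rewrite mulr1.
  - move=> x xs xr.
    have hx : hsol B s (fun y => 1 *: h y) x.
      by apply: (hsol_near (Y := h) ltr01) (hh x xs xr) => y _; rewrite scale1r.
    by [].
  apply: (@kernel_rank _ _ (pulled G (fun=> 1) h x)).
    by rewrite mulmxBl mul1mx e divr1 scale1r subrr.
  by rewrite (pulled_rank FG)// ?oner_neq0// hr.
- by move=> i; have [mu [_ h /same<-]] := inf i.
Qed.
End JumpsSpec.

(** * The monodromy group *)

Section Paths.
Context {R : realType}.
Implicit Types (x y z p q : CC R) (g : R -> CC R).

Definition pathcont g := forall t, in01 t -> forall e : R, 0 < e ->
  exists2 d : R, 0 < d & forall u, in01 u -> `|u - t| < d -> cmod (g u - g t) < e.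

Lemma pathcontP g : {within `[0%R, 1%R], continuous g} <-> pathcont g.
Proof.
have I01 t : (`[0%R, 1%R]%classic : set R) t <-> in01 t by rewrite /in01 /= in_itv.
split.
  move=> /subspace_continuousP h t t01 e e0.
  have /h/cvgrPdist_lt/(_ (rc e)) : (`[0%R, 1%R]%classic : set R) t by apply/I01.
  rewrite ltcR => /(_ e0); rewrite near_withinE => /rnearP[d d0 hd].
  by exists d => // u u01 /hd /(_ ((I01 u).2 u01)); rewrite normE ltcR cmodB.
move=> h; apply/subspace_continuousP => t /I01 t01; apply/cvgrPdist_lt => e e0.
have eE : e = rc (cre e).
  by apply/ceqP; split=> //; rewrite cim_rc; exact: (ger0_Im (ltW e0)).
move: e0; rewrite eE ltcR => /(h t t01)[d d0 hd].
rewrite near_withinE; apply/rnearP; exists d => // u ut /I01 u01.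
by rewrite normE ltcR cmodB; exact: hd.
Qed.

Definition germ_eq T (Z Z' : CC R -> T) x := exists2 r : R, 0 < r &
  forall y, cmod (y - x) < r -> Z y = Z' y.

Lemma germ_eq_refl T (Z : CC R -> T) x : germ_eq Z Z x.
Proof. by exists 1. Qed.

Lemma germ_eq_sym T (Z Z' : CC R -> T) x : germ_eq Z Z' x -> germ_eq Z' Z x.
Proof. by move=> [r r0 h]; exists r => // y /h. Qed.

Lemma germ_eq_trans T (Z Z' Z'' : CC R -> T) x :
  germ_eq Z Z' x -> germ_eq Z' Z'' x -> germ_eq Z Z'' x.
Proof.
move=> [r r0 h] [r' r'0 h']; exists (Num.min r r'); first by rewrite lt_min r0.
by move=> y; rewrite lt_min => /andP[/h -> /h' ->].
Qed.

Lemma germ_eq_at T (Z Z' : CC R -> T) x : germ_eq Z Z' x -> Z x = Z' x.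
Proof. by move=> [r r0 h]; apply: h; rewrite subrr cmod0. Qed.

Lemma germ_eq_near T (Z Z' : CC R -> T) x : germ_eq Z Z' x ->
  exists2 r : R, 0 < r & forall y, cmod (y - x) < r -> germ_eq Z Z' y.
Proof.
move=> [r r0 h]; exists r => // y yx; exists (r - cmod (y - x)); first by rewrite subr_gt0.
by move=> z zy; apply: h; have := cmod_tri z y x; lra.
Qed.

Section Reach.
Variables (n : nat) (B : 'M[CC R]_n) (s : 'I_n -> CC R).
Implicit Types (Z : CC R -> 'M[CC R]_n).

Definition transport m g (Zt : R -> CC R -> 'M[CC R]_(n, m)) :=
  (forall t, in01 t -> exists2 r : R, 0 < r &
     forall y, cmod (y - g t) < r -> hsol B s (Zt t) y) /\
  (forall t, in01 t -> exists2 d : R, 0 < d & forall u, in01 u -> `|u - t| < d ->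
     germ_eq (Zt u) (Zt t) (g u)).

Definition reach p Z q Z' := exists g (Zt : R -> CC R -> 'M[CC R]_n),
  [/\ pathcont g, g 0 = p /\ g 1 = q, forall t, in01 t -> forall j, g t != s j,
   transport g Zt & germ_eq (Zt 0) Z p /\ germ_eq (Zt 1) Z' q].

Lemma in01_0 : in01 (0 : R). Proof. by rewrite /in01 lexx ler01. Qed.
Lemma in01_1 : in01 (1 : R). Proof. by rewrite /in01 lexx ler01. Qed.

Lemma reach_germ p Z q Z' Z1 Z1' : reach p Z q Z' -> germ_eq Z Z1 p -> germ_eq Z' Z1' q ->
  reach p Z1 q Z1'.
Proof.
move=> [g [Zt [h1 h2 h3 h4 [e1 e2]]]] k1 k2; exists g, Zt; split=> //.
by split; [apply: germ_eq_trans e1 k1 | apply: germ_eq_trans e2 k2].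
Qed.

Lemma reach_segment (O : CC R -> Prop) Z p q :
  copen O -> (forall x, O x -> hsol B s Z x) -> (forall x, O x -> forall j, x != s j) ->
  (forall t, in01 t -> O (seg p q t)) -> reach p Z q Z.
Proof.
move=> Oo hZ Os hO; exists (seg p q), (fun=> Z); split=> //.
- move=> t t01 e e0; have m0 := cmod_ge0 (q - p).
  exists (e / (1 + cmod (q - p))); first by rewrite divr_gt0//; lra.
  move=> u u01; rewrite ltr_pdivlMr; last lra.
  have -> : seg p q u - seg p q t = rc (u - t) * (q - p) by rewrite /seg rcB; ring.
  rewrite cmodM cmod_rc; have := normr_ge0 (u - t); nra.
- by rewrite seg0 seg1.
- by move=> t t01; apply: Os; exact: hO.
- split=> t t01; last by exists 1 => // u _ _; exact: germ_eq_refl.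
  by have [r r0 h] := Oo _ (hO t t01); exists r => // y /h; exact: hZ.
- by split; exact: germ_eq_refl.
Qed.

Lemma reach_trans p Z q Z' r Z'' : reach p Z q Z' -> reach q Z' r Z'' -> reach p Z r Z''.
Proof.
move=> [g [Zt [c1 [g0 g1] a1 [t1 t1'] [e1 e2]]]] [g' [Zt' [c2 [g'0 g'1] a2 [t2 t2'] [e3 e4]]]].
have mid : germ_eq (Zt 1) (Zt' 0) (g 1).
  by rewrite g1; apply: germ_eq_trans e2 (germ_eq_sym e3).
have gg : g 1 = g' 0 by rewrite g1 g'0.
pose h t := if t <= 1 / 2 then g (2 * t) else g' (2 * t - 1).
pose Zh t := if t <= 1 / 2 then Zt (2 * t) else Zt' (2 * t - 1).
have lo (t : R) : in01 t -> t <= 1 / 2 -> in01 (2 * t).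
  by move=> /andP[? ?] ?; apply/andP; split; lra.
have hi (t : R) : in01 t -> 1 / 2 <= t -> in01 (2 * t - 1).
  by move=> /andP[? ?] ?; apply/andP; split; lra.
have hh : h (1 / 2) = g 1 by rewrite /h lexx; congr g; lra.
have Zhh : Zh (1 / 2) = Zt 1 by rewrite /Zh lexx; congr Zt; lra.
exists h, Zh; split.
- move=> t t01 e e0.
  have [tl|tg|te] := ltgtP t (1 / 2).
  + have [d d0 hd] := c1 _ (lo t t01 (ltW tl)) e e0.
    exists (Num.min (d / 2) (1 / 2 - t)); first by rewrite lt_min divr_gt0//; lra.
    move=> u u01; rewrite lt_min => /andP[h1 h2].
    have ul : u <= 1 / 2 by move: h2; rewrite ltr_norml; lra.
    rewrite /h ul (ltW tl); apply: hd; first exact: lo.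
    by rewrite -mulrBr normrM ger0_norm//; lra.
  + have [d d0 hd] := c2 _ (hi t t01 (ltW tg)) e e0.
    exists (Num.min (d / 2) (t - 1 / 2)); first by rewrite lt_min divr_gt0//; lra.
    move=> u u01; rewrite lt_min => /andP[h1 h2].
    have ul : 1 / 2 < u by move: h2; rewrite ltr_norml; lra.
    rewrite /h !leNgt ul tg /=; apply: hd; first exact/hi/ltW.
    have -> : 2 * u - 1 - (2 * t - 1) = 2 * (u - t) by ring.
    by rewrite normrM ger0_norm//; lra.
  + have [d d0 hd] := c1 1 in01_1 e e0; have [d' d'0 hd'] := c2 0 in01_0 e e0.
    exists (Num.min (d / 2) (d' / 2)); first by rewrite lt_min !divr_gt0.
    move=> u u01; rewrite lt_min te => /andP[h1 h2]; rewrite hh /h.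
    case: (leP u (1 / 2)) => ul.
      apply: hd; first exact: lo.
      have -> : 2 * u - 1 = 2 * (u - 1 / 2) by field.
      by rewrite normrM ger0_norm//; lra.
    rewrite gg; apply: hd'; first exact/hi/ltW.
    have -> : 2 * u - 1 - 0 = 2 * (u - 1 / 2) by field.
    by rewrite normrM ger0_norm//; lra.
- split; rewrite /h.
    by rewrite ifT; [rewrite mulr0 | lra].
  by rewrite ifF; [rewrite mulr1 -g'1; congr g'; lra | apply/negbTE; rewrite -ltNge; lra].
- move=> t t01 j; rewrite /h; case: (leP t (1 / 2)) => tl; first exact/a1/lo.
  exact/a2/hi/ltW.
- split=> t t01.
    rewrite /h /Zh; case: (leP t (1 / 2)) => tl; first exact/t1/lo.
    exact/t2/hi/ltW.
  have [tl|tg|te] := ltgtP t (1 / 2).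
  + have [d d0 hd] := t1' _ (lo t t01 (ltW tl)).
    exists (Num.min (d / 2) (1 / 2 - t)); first by rewrite lt_min divr_gt0//; lra.
    move=> u u01; rewrite lt_min => /andP[h1 h2].
    have ul : u <= 1 / 2 by move: h2; rewrite ltr_norml; lra.
    rewrite /h /Zh ul (ltW tl); apply: hd; first exact: lo.
    by rewrite -mulrBr normrM ger0_norm//; lra.
  + have [d d0 hd] := t2' _ (hi t t01 (ltW tg)).
    exists (Num.min (d / 2) (t - 1 / 2)); first by rewrite lt_min divr_gt0//; lra.
    move=> u u01; rewrite lt_min => /andP[h1 h2].
    have ul : 1 / 2 < u by move: h2; rewrite ltr_norml; lra.
    rewrite /h /Zh !leNgt ul tg /=; apply: hd; first exact/hi/ltW.
    have -> : 2 * u - 1 - (2 * t - 1) = 2 * (u - t) by ring.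
    by rewrite normrM ger0_norm//; lra.
  + have [d d0 hd] := t1' 1 in01_1; have [d' d'0 hd'] := t2' 0 in01_0.
    (* Just after the midpoint two comparisons are chained: with the initial germ of the second
       path, and from there with the final germ of the first. The latter holds on a neighbourhood of
       the junction, in which the second path must still lie. *)
    have [e ee0 he] := germ_eq_near mid; have [d3 d30 hd3] := c2 0 in01_0 e ee0.
    exists (Num.min (d / 2) (Num.min (d' / 2) (d3 / 2))).
      by rewrite !lt_min !divr_gt0.
    move=> u u01; rewrite !lt_min te => /and3P[h1 h2 h3]; rewrite Zhh /h /Zh.
    case: (leP u (1 / 2)) => ul.
      apply: hd; first exact: lo.
      have -> : 2 * u - 1 = 2 * (u - 1 / 2) by field.
      by rewrite normrM ger0_norm//; lra.
    have E : `|2 * u - 1 - 0| = 2 * `|u - 1 / 2|.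
      have -> : 2 * u - 1 - 0 = 2 * (u - 1 / 2) by field.
      by rewrite normrM ger0_norm.
    apply: germ_eq_trans (hd' _ _ _) _; first exact/hi/ltW.
      by rewrite E; lra.
    apply/germ_eq_sym/he; rewrite gg; apply: hd3; first exact/hi/ltW.
    by rewrite E; lra.
- split; first by rewrite /Zh ifT; [rewrite mulr0 | lra].
  rewrite /Zh ifF; last by apply/negbTE; rewrite -ltNge; lra.
  by rewrite mulr1 [2 - 1](_ : _ = 1); [| lra].
Qed.

Lemma reach_star (O : CC R -> Prop) c Z p q :
  copen O -> star O c -> (forall x, O x -> hsol B s Z x) ->
  (forall x, O x -> forall j, x != s j) -> O p -> O q -> reach p Z q Z.
Proof.
move=> Oo [Oc st] hZ Os Op Oq; apply: (@reach_trans _ _ c Z).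
  apply: (reach_segment Oo) => // t /andP[t0 t1].
  have -> : seg p c t = seg c p (1 - t) by rewrite /seg rcB rc1; ring.
  by apply: st => //; apply/andP; split; lra.
by apply: (reach_segment Oo) => // t t01; exact: st.
Qed.

End Reach.
End Paths.

(** * Continuation along loops and the group generated by the jumps *)

Section MonodromyGroup.
Context {R : realType}.
Implicit Types (x y z p q : CC R).
Variables (m : nat).
Local Notation n := m.+1.
Variables (B : 'M[CC R]_n) (s : 'I_n -> CC R) (c : CC R) (de : R).
Hypothesis Y0 : forall j, 0 < py c (s j).
Hypothesis de0 : 0 < de.
Hypothesis rN : forall i j, i != j -> de <= `|rho s c i - rho s c j|.
Variables (F G : CC R -> 'M[CC R]_n) (F' G' : 'I_n -> CC R -> 'M[CC R]_n).
Variables (Cp Cm : 'I_n -> 'M[CC R]_n).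
Hypothesis Fc : F c = 1%:M.
Hypothesis FG : fund B s (slits s c) F G.
Hypothesis FG' : forall i, fund B s (cosector s c de i) (F' i) (G' i).
Hypothesis uC : forall i, Cp i \in unitmx /\ Cm i \in unitmx.
Hypothesis hF : forall i x, (rside s c de i x -> F x = F' i x *m Cp i) /\
  (lside s c de i x -> F x = F' i x *m Cm i).
Local Notation M := (jump Cp Cm).
Definition jumps : set 'M[CC R]_n := [set A | exists i, A = M i].
Let Gam := generated jumps.

Lemma jump_unit i : M i \in unitmx.
Proof. by have [u1 u2] := uC i; rewrite unitmx_mul unitmx_inv u2. Qed.

Lemma generated_unit k (T : set 'M[CC R]_k) A : (forall A, T A -> A \in unitmx) ->
  generated T A -> A \in unitmx.
Proof.
move=> h; elim=> {A} [A /h //||A C _ uA _ uC'|A _ uA].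
- exact: unitmx1.
- by rewrite unitmx_mul uA.
- by rewrite unitmx_inv.
Qed.

Lemma Gam_unit A : Gam A -> A \in unitmx.
Proof. by apply: generated_unit => _ [i ->]; exact: jump_unit. Qed.

Lemma fund_unit O (K L : CC R -> 'M[CC R]_n) x : fund B s O K L -> O x -> K x \in unitmx.
Proof. by move=> h /h[_ _ /mulmx1_unit[]]. Qed.

(* the analytic continuations of [F] used as reference germs, one for each chart *)
Inductive canon x : (CC R -> 'M[CC R]_n) -> Prop :=
| canon_slits : slits s c x -> canon x F
| canon_cosector i : cosector s c de i x -> canon x (fun y => F' i y *m Cp i).

Lemma canon_chart x K : canon x K -> exists O L c',
  [/\ copen O, star O c', O x & forall y, O y -> canon y K] /\
  [/\ fund B s O K L & forall y, O y -> forall j, y != s j].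
Proof.
case=> [sx|i cx].
  exists (slits s c), G, c; split; split=> //.
  - exact: slits_open.
  - exact: slits_star.
  - by move=> y sy; exact: canon_slits.
  - by move=> y sy j; exact: (slit_avoid Y0 (sy j)).
have [c' st] := cosector_star Y0 de0 i.
exists (cosector s c de i), (fun y => invmx (Cp i) *m G' i y), c'; split; split=> //.
- exact: cosector_open.
- by move=> y; exact: canon_cosector.
- move=> y cy; have [h1 h2 h3] := FG' cy; split.
  + exact: hsolM.
  + exact: dsolM.
  + by rewrite mulmxA -(mulmxA (invmx _)) h3 mulmx1 mulVmx//; case: (uC i).
- by move=> y cy j; exact: (cosector_avoid Y0 rN j cy).
Qed.

Lemma canon_ex x : (forall j, x != s j) -> exists K, canon x K.
Proof.
move=> /(charts_cover Y0 de0)[sx|[i cx]]; first by exists F; exact: canon_slits.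
by exists (fun y => F' i y *m Cp i); exact: canon_cosector cx.
Qed.

Lemma canon_unit x K : canon x K -> K x \in unitmx.
Proof. by move=> /canon_chart[D [L [c' [[_ _ Ox _] [h _]]]]]; exact: (fund_unit h Ox). Qed.

Lemma side_open i x : cosector s c de i x ->
  (rside s c de i x -> exists2 r : R, 0 < r & forall y, cmod (y - x) < r -> rside s c de i y) /\
  (lside s c de i x -> exists2 r : R, 0 < r & forall y, cmod (y - x) < r -> lside s c de i y).
Proof.
move=> cx; have [r r0 h] := cosector_open cx.
split=> [[_ hx]|[_ hx]].
  have [r' r'0 h'] := copen_gt0 (rcont_sl s c i) hx.
  exists (Num.min r r'); first by rewrite lt_min r0.
  by move=> y; rewrite lt_min => /andP[/h[sy _] /h' ?].
have rc' : rcont (fun y => - sl s c i y).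
  by apply: rcont_eq (rcont_lin c (-1) (rho s c i) 0) => y; rewrite /sl; ring.
have [r' r'0 h'] := copen_gt0 rc' hx.
exists (Num.min r r'); first by rewrite lt_min r0.
by move=> y; rewrite lt_min => /andP[/h[sy _] /h' ?].
Qed.

(** In the overlap of the two charts no point of the ray is left. On its right side the reference
    germs coincide, on its left side they differ by the jump. *)
Lemma canon_rel_cosector x i : cosector s c de i x -> slits s c x ->
  (germ_eq F (fun y => F' i y *m Cp i) x) \/
  (germ_eq (fun y => F' i y *m Cp i) (fun y => F y *m M i) x).
Proof.
move=> cx sx; have [so1 so2] := side_open cx.
have [u1 u2] := uC i.
have sec := cx.1.
have [x0|x0|x0] := ltgtP (sl s c i x) 0.
- right; have lx : lside s c de i x by split=> //; rewrite oppr_gt0.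
  have [r r0 h] := so2 lx; exists r => // y /h /(hF i y).2 ->.
  by rewrite /jump mulmxA mulmxK.
- left; have rx : rside s c de i x by split.
  by have [r r0 h] := so1 rx; exists r => // y /h /(hF i y).1 ->.
- case: cx => _ [|h]; first by rewrite x0 eqxx.
  by case: (sx i) => [|h']; [rewrite x0 eqxx | lra].
Qed.

Lemma canon_rel x K K' : canon x K -> canon x K' ->
  exists2 g, Gam g & germ_eq K (fun y => K' y *m g) x.
Proof.
have g1 : Gam 1%:M by exact: generated_one.
have gM i : Gam (M i) by apply: generated_gen; exists i.
have one (Z : CC R -> 'M[CC R]_n) : germ_eq Z (fun y => Z y *m 1%:M) x.
  by exists 1 => // y _; rewrite mulmx1.
have slitcase i : cosector s c de i x -> slits s c x ->
  (exists2 g, Gam g & germ_eq F (fun y => F' i y *m Cp i *m g) x) /\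
  (exists2 g, Gam g & germ_eq (fun y => F' i y *m Cp i) (fun y => F y *m g) x).
  move=> cx sx; have [e|e] := canon_rel_cosector cx sx.
    split; exists 1%:M => //; first exact: germ_eq_trans e (one _).
    exact: germ_eq_trans (germ_eq_sym e) (one _).
  split; last by exists (M i).
  exists (invmx (M i)); first exact: (generated_inv (gM i)).
  have [r r0 h] := e; exists r => // y /h ->.
  by rewrite mulmxK// jump_unit.
case=> [sx|i cx]; case=> [sx'|j cx'].
- by exists 1%:M.
- by have [] := slitcase j cx' sx.
- by have [] := slitcase i cx sx'.
have [e|ij] := eqVneq i j; first by rewrite -e; exists 1%:M.
(* A point in two different cosectors is off the cuts, as the sector of one ray misses the other
   ray; so the two germs can be compared through [F]. *)
have sx : slits s c x.
  apply: (cosector_slits rN cx); apply/eqP => s0.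
  have [|h] := sector_slit rN ij cx'.1; first by rewrite s0 eqxx.
  by case: cx => _ [|h2]; [rewrite s0 eqxx | lra].
have [_ [g Gg e1]] := slitcase i cx sx.
have [[g' Gg' e2] _] := slitcase j cx' sx.
exists (g' *m g); first exact: generated_mul.
apply: germ_eq_trans e1 _; have [r r0 h] := e2; exists r => // y /h ->.
by rewrite mulmxA.
Qed.

Lemma reach_slits x y C : slits s c x -> slits s c y ->
  reach B s x (fun z => F z *m C) y (fun z => F z *m C).
Proof.
move=> sx sy; apply: (reach_star (@slits_open _ _ s c) (slits_star Y0) _ _ sx sy).
  by move=> z /FG[h _ _]; exact: hsolM.
by move=> z sz j; exact: (slit_avoid Y0 (sz j)).
Qed.

Lemma reach_cosector i x y C : cosector s c de i x -> cosector s c de i y ->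
  reach B s x (fun z => F' i z *m C) y (fun z => F' i z *m C).
Proof.
move=> sx sy; have [c' st] := cosector_star Y0 de0 i.
apply: (reach_star (@cosector_open _ _ s c de i) st _ _ sx sy).
  by move=> z /FG'[h _ _]; exact: hsolM.
by move=> z sz j; exact: (cosector_avoid Y0 rN j sz).
Qed.

Lemma rside_germ i x (C : 'M[CC R]_n) : rside s c de i x ->
  germ_eq (fun z => F z *m C) (fun z => F' i z *m (Cp i *m C)) x.
Proof.
move=> rx; have [h _] := side_open (rside_cosector rx); have [r r0 hr] := h rx.
by exists r => // y /hr /(hF i y).1 ->; rewrite mulmxA.
Qed.

Lemma lside_germ i x (C : 'M[CC R]_n) : lside s c de i x ->
  germ_eq (fun z => F z *m C) (fun z => F' i z *m (Cm i *m C)) x.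
Proof.
move=> rx; have [_ h] := side_open (lside_cosector rx); have [r r0 hr] := h rx.
by exists r => // y /hr /(hF i y).2 ->; rewrite mulmxA.
Qed.

Lemma slits_c : slits s c c. Proof. by case: (slits_star Y0). Qed.

Lemma reach_jump i C :
  reach B s c (fun z => F z *m C) c (fun z => F z *m (M i *m C)) /\
  reach B s c (fun z => F z *m C) c (fun z => F z *m (invmx (M i) *m C)).
Proof.
have [u1 u2] := uC i.
have [x rx] := rside_ex s c de0 i; have [y ly] := lside_ex s c de0 i.
have sx := rside_slits rN rx; have sy := lside_slits rN ly.
have cx := rside_cosector rx; have cy := lside_cosector ly.
split.
  apply: reach_trans (reach_slits C slits_c sx) _.
  apply: reach_trans _ (reach_slits (M i *m C) sy slits_c).
  apply: (reach_germ (reach_cosector (Cp i *m C) cx cy)).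
    exact/germ_eq_sym/rside_germ.
  apply: germ_eq_trans _ (germ_eq_sym (lside_germ (M i *m C) ly)).
  by rewrite /jump !mulmxA mulmxV// mul1mx; exact: germ_eq_refl.
apply: reach_trans (reach_slits C slits_c sy) _.
apply: reach_trans _ (reach_slits (invmx (M i) *m C) sx slits_c).
apply: (reach_germ (reach_cosector (Cm i *m C) cy cx)).
  exact/germ_eq_sym/lside_germ.
apply: germ_eq_trans _ (germ_eq_sym (rside_germ (invmx (M i) *m C) rx)).
have -> : Cp i *m (invmx (M i) *m C) = Cm i *m C; last exact: germ_eq_refl.
apply: (canRL (mulKVmx u2)); rewrite !mulmxA -[invmx (Cm i) *m Cp i]/(M i).
by rewrite mulmxV ?jump_unit// mul1mx.
Qed.

Lemma reach_Gam g C : Gam g ->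
  reach B s c (fun z => F z *m C) c (fun z => F z *m (g *m C)).
Proof.
(* The statement for the inverse is proved alongside, since the induction must pass through
   [generated_inv]. *)
move=> Gg; suff [] : (forall C, reach B s c (fun z => F z *m C) c (fun z => F z *m (g *m C))) /\
  (forall C, reach B s c (fun z => F z *m C) c (fun z => F z *m (invmx g *m C))) by [].
elim: Gg => {g C} [_ [i ->]||A A' GA [h1 h2] GA' [h3 h4]|A GA [h1 h2]].
- by split=> C; have [] := reach_jump i C.
- by split=> C; rewrite ?invmx1 mul1mx; exact: (reach_slits _ slits_c slits_c).
- split=> C; first by rewrite -mulmxA; exact: (reach_trans (h3 C) (h1 _)).
  rewrite (_ : invmx (A *m A') = invmx A' *m invmx A).
    by rewrite -mulmxA; exact: (reach_trans (h2 C) (h4 _)).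
  have uA := Gam_unit GA; have uA' := Gam_unit GA'.
  have uAA : A *m A' \in unitmx by rewrite unitmx_mul uA.
  apply: (can_inj (mulKmx uAA)).
  by rewrite mulmxV// mulmxA -(mulmxA A) mulmxV// mulmx1 mulmxV.
- by rewrite invmxK; exact: (conj h2 h1).
Qed.

Lemma canon_reach x K C : canon x K ->
  reach B s c (fun z => F z *m C) x (fun z => K z *m C) /\
  reach B s x (fun z => K z *m C) c (fun z => F z *m C).
Proof.
case=> [sx|i cx]; first by split; apply: reach_slits => //; exact: slits_c.
have [y ry] := rside_ex s c de0 i.
have sy := rside_slits rN ry; have cy := rside_cosector ry.
have e : germ_eq (fun z => F z *m C) (fun z => F' i z *m Cp i *m C) y.
  have [r r0 h] := rside_germ C ry; exists r => // z /h ->.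
  by rewrite mulmxA.
have hr u v : cosector s c de i u -> cosector s c de i v ->
  reach B s u (fun z => F' i z *m Cp i *m C) v (fun z => F' i z *m Cp i *m C).
  move=> cu cv; apply: (reach_germ (reach_cosector (Cp i *m C) cu cv));
    by exists 1 => // z _; rewrite mulmxA.
split.
  apply: reach_trans (reach_slits C slits_c sy) _.
  by apply: reach_germ (hr y x cy cx) (germ_eq_sym e) _; exact: germ_eq_refl.
apply: reach_trans _ (reach_slits C sy slits_c).
by apply: reach_germ (hr x y cx cy) _ (germ_eq_sym e); exact: germ_eq_refl.
Qed.

Lemma horizontal_hsol (Om : CC R -> 'M[CC R]_n) (Z : CC R -> 'cV[CC R]_n) x :
  Om x = okubo B s x -> horizontal_at Om Z x <-> hsol B s Z x.
Proof.
move=> Ox; split=> h i.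
  by move=> j; rewrite ord1 -Ox mxE; apply/cderP; exact: h.
by have := h i 0; rewrite -Ox mxE => /cderP.
Qed.

(** The conjugating matrix is the value at [b] of a reference germ. For a given loop, the continued
    germ is at each parameter a reference germ times an element of the jump group; conversely each
    such element is realised by going to [c], following jumps there, and coming back. *)
Theorem monodromy_group_jumps (S : seq (CC R)) (Om : CC R -> 'M[CC R]_n) b :
  (forall x, reflect (exists j, x = s j) (x \in S)) ->
  (forall x, Om x = okubo B s x) -> b \notin S ->
  GL_conjugate (monodromy_group S Om b) Gam.
Proof.
move=> SP OmE bS.
have notS x : x \notin S <-> forall j, x != s j.
  split=> [xS j|h]; first by apply: contraNneq xS => xj; apply/SP; exists j.
  by apply/negP => /SP[j xj]; have := h j; rewrite xj eqxx.
have [K cK] := canon_ex ((notS b).1 bS).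
have uK := canon_unit cK; set P := K b in uK.
exists P => //; apply/seteqP; split=> [A [g [gc g0 g1 gS] mono]|_ [g Gg <-]].
  have gc' := (pathcontP g).1 gc.
  have gs t : in01 t -> forall j, g t != s j by move=> t01; apply/(notS _).1/gS.
  have /choice[Z hZ] j := mono (delta_mx j 0).
  (* The continuations of the basis vectors become the columns of one matrix solution with value 1
     at [b]. *)
  pose Zt t x : 'M[CC R]_n := \matrix_(i, j) Z j t x i 0.
  have Zhsol t : in01 t -> exists2 r : R, 0 < r &
      forall y, cmod (y - g t) < r -> hsol B s (Zt t) y.
    move=> t01; have h j : exists r : R, 0 < r /\
        forall y, cmod (y - g t) < r -> hsol B s (Z j t) y.
      have [[h _] _ _] := hZ j; have /cnearP[r r0 hr] := h t t01.
      by exists r; split=> // y /hr /(horizontal_hsol _ (OmE y)).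
    have /choice[r hr] := h.
    have [d d0 hd] := @finite_min R n r (fun j => (hr j).1).
    exists d => // y yd i j.
    have := (hr j).2 y (lt_le_trans yd (hd j)) i 0.
    rewrite mxE => hij; rewrite mxE.
    have -> : (okubo B s y *m Zt t y) i j = (okubo B s y *m Z j t y) i 0.
      by rewrite !mxE; apply: eq_bigr => l _; rewrite !mxE.
    by apply: cder_ext hij => z; rewrite mxE.
  have Zgerm t : in01 t -> exists2 d : R, 0 < d & forall u, in01 u -> `|u - t| < d ->
      germ_eq (Zt u) (Zt t) (g u).
    move=> t01; have h j : exists d : R, 0 < d /\ forall u, in01 u -> `|u - t| < d ->
        germ_eq (Z j u) (Z j t) (g u).
      have [[_ h] _ _] := hZ j; have /rnearP[d d0 hd] := h t t01.
      by exists d; split=> // u u01 /hd /(_ u01) /cnearP.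
    have /choice[r hr] := h.
    have [d d0 hd] := @finite_min R n r (fun j => (hr j).1).
    exists d => // u u01 ud.
    have h2 j : exists r : R, 0 < r /\ forall y, cmod (y - g u) < r -> Z j u y = Z j t y.
      by have [e e0 he] := (hr j).2 u u01 (lt_le_trans ud (hd j)); exists e.
    have /choice[e he] := h2.
    have [d' d'0 hd'] := @finite_min R n e (fun j => (he j).1).
    exists d' => // y yd; apply/matrixP => i j; rewrite !mxE.
    by rewrite (he j).2//; exact: lt_le_trans yd (hd' j).
  have Z0 : Zt 0 b = 1%:M.
    by apply/matrixP => i j; rewrite mxE; have [_ -> _] := hZ j; rewrite !mxE eqxx andbT.
  have Z1 : Zt 1 b = A.
    apply/matrixP => i j; rewrite mxE; have [_ _ ->] := hZ j.
    by rewrite -colE mxE.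
  (* Near a point of the path the continued solution is a reference germ times a constant matrix,
     because pairing it with the dual solution gives a constant on a small disc. *)
  have local t : in01 t -> forall L, canon (g t) L -> exists C r, 0 < r /\
      forall y, cmod (y - g t) < r -> Zt t y = L y *m C /\ canon y L.
    move=> t01 L cL; have [r r0 hr] := Zhsol t t01.
    have [D [L' [c' [[Dop _ Dx Dc] [LL' _]]]]] := canon_chart cL.
    have [r' r'0 hr'] := Dop _ Dx.
    exists (L' (g t) *m Zt t (g t)), (Num.min r r'); rewrite lt_min r0; split=> // y yr.
    have near w : in01 w -> cmod (seg (g t) y w - g t) < r /\ cmod (seg (g t) y w - g t) < r'.
      move=> /andP[w0 w1]; rewrite /seg addrAC subrr add0r cmodM cmod_rc ger0_norm//.
      have : w * cmod (y - g t) <= cmod (y - g t) by rewrite ler_piMl ?cmod_ge0.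
      by move: yr; rewrite lt_min => /andP[? ?] ?; split; lra.
    have Dy : D y by apply: hr'; move: yr; rewrite lt_min => /andP[].
    split; last exact: Dc.
    rewrite (@pair_segment _ _ B s _ _ L' (Zt t) (g t) y).
    - by rewrite mulmxA (fundC LL')// mul1mx.
    - by move=> w /near[_ /hr'] /LL'[].
    - by move=> w /near[/hr].
  (* The invariant of the induction along the loop. The factor [invmx P] normalises the initial
     value, so only [h] changes, by the transition elements of [canon_rel]. *)
  pose Pr t := exists L h, [/\ canon (g t) L, Gam h &
    germ_eq (Zt t) (fun y => L y *m (h *m invmx P)) (g t)].
  have Pr0 : Pr 0.
    exists K, 1%:M; rewrite g0; split=> //; first exact: generated_one.
    have cK0 : canon (g 0) K by rewrite g0.
    have [C [r [r0 hr]]] := local 0 in01_0 K cK0; rewrite g0 in hr.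
    have CE : C = invmx P.
      have [|e _] := hr b; first by rewrite subrr cmod0.
      by apply: (can_inj (mulKmx uK)); rewrite -/P -e Z0 mulmxV.
    by exists r => // y /hr[-> _]; rewrite CE mul1mx.
  have : Pr 1.
    apply: unit_interval_induction Pr0 _ => t t01.
    have [L cL] := canon_ex (gs t t01).
    have [C [r [r0 hr]]] := local t t01 L cL.
    have [d d0 hd] := gc' t t01 r r0.
    have [d' d'0 hd'] := Zgerm t t01.
    exists (Num.min d d'); first by rewrite lt_min d0.
    move=> u v /andP[u0 ut] /andP[tv v1]; rewrite !lt_min => /andP[a1 a2] /andP[a3 a4].
    have /andP[t0 t1] := t01.
    have u01 : in01 u by apply/andP; split; lra.
    have v01 : in01 v by apply/andP; split; lra.
    have close w : in01 w -> `|w - t| < d -> `|w - t| < d' ->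
        canon (g w) L /\ germ_eq (Zt w) (fun y => L y *m C) (g w).
      move=> w01 wd wd'; have gw := hd w w01 wd; have [_ cw] := hr _ gw.
      split=> //; apply: germ_eq_trans (hd' w w01 wd') _.
      exists (r - cmod (g w - g t)); first by rewrite subr_gt0.
      by move=> y yw; have [|-> _//] := hr y; have := cmod_tri y (g w) (g t); lra.
    have [cu Eu] : canon (g u) L /\ germ_eq (Zt u) (fun y => L y *m C) (g u).
      by apply: close => //; rewrite distrC ger0_norm ?subr_ge0.
    have [cv Ev] : canon (g v) L /\ germ_eq (Zt v) (fun y => L y *m C) (g v).
      by apply: close => //; rewrite ger0_norm ?subr_ge0.
    move=> [L1 [h1 [c1 G1 E1]]].
    have [h2 G2 E2] := canon_rel c1 cu.
    exists L, (h2 *m h1); split=> //; first exact: generated_mul.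
    have -> : h2 *m h1 *m invmx P = C; last exact: Ev.
    apply: (can_inj (mulKmx (canon_unit cu))).
    rewrite -(germ_eq_at Eu) (germ_eq_at E1) (germ_eq_at E2).
    by rewrite !mulmxA.
  move=> [L [h [cL Gh E]]]; rewrite g1 in cL E.
  have [h' Gh' E'] := canon_rel cL cK.
  exists (h' *m h); first exact: generated_mul.
  by rewrite -Z1 (germ_eq_at E) (germ_eq_at E') -/P !mulmxA.
have [_ r1] := canon_reach (invmx P) cK.
have [r3 _] := canon_reach (g *m invmx P) cK.
have [ga [Zt [h1 [h2 h3] h4 [t1 t2] [e1 e2]]]] :=
  reach_trans r1 (reach_trans (reach_Gam (invmx P) Gg) r3).
exists ga.
  split=> //; first exact/pathcontP.
  by move=> t t01; apply/notS => j; exact: h4.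
move=> v; exists (fun t x => Zt t x *m v); split.
- split=> t t01.
    have [r r0 hr] := t1 t t01; apply/cnearP; exists r => // y /hr hy.
    by apply/(horizontal_hsol _ (OmE y)); exact: hsolM.
  have [d d0 hd] := t2 t t01; apply/rnearP; exists d => // u ut u01.
  have [r r0 hr] := hd u u01 ut; apply/cnearP; exists r => // y /hr ->.
  by [].
- by rewrite (germ_eq_at e1) -/P mulmxV// mul1mx.
- by rewrite (germ_eq_at e2) -/P !mulmxA.
Qed.

End MonodromyGroup.

Lemma reflection_tuples_conj (K : fieldType) m (zeta : K) (M N : 'I_m.+1 -> 'M[K]_m.+1) :
  zeta ^+ 2 - zeta + 1 = 0 -> zeta ^+ 2 != 1 -> std_gram m zeta \in unitmx ->
  reflection_tuple zeta M -> reflection_tuple zeta N ->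
  GL_conjugate (generated [set A | exists i, A = M i]) (generated [set A | exists i, A = N i]).
Proof.
move=> z6 z2 gu /(reflection_tuple_std z6 z2 gu)[T uT MT] /(reflection_tuple_std z6 z2 gu)[T' uT' NT].
suff h (X : 'M[K]_m.+1) L : X \in unitmx -> (forall i, L i = X *m std_tuple zeta i *m invmx X) ->
    [set A | exists i, A = L i] = [set X *m g *m invmx X | g in range (std_tuple (m := m) zeta)].
  have eM := h _ _ uT MT; have eN : range (std_tuple (m := m) zeta) =
      [set invmx T' *m g *m T' | g in [set A | exists i, A = N i]].
    apply/seteqP; split=> A.
      move=> [i _ <-]; exists (N i); first by exists i.
      by rewrite NT !mulmxA mulVmx// mul1mx mulmxKV.
    by move=> [_ [i ->] <-]; exists i => //; rewrite NT !mulmxA mulVmx// mul1mx mulmxKV.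
  rewrite eM; apply: GL_conjugate_trans (GL_conjugate_generated _ uT) _.
  rewrite eN -{2}[T']invmxK; apply: GL_conjugate_generated; by rewrite unitmx_inv.
move=> uX LX; apply/seteqP; split=> A.
  by move=> [i ->]; exists (std_tuple zeta i) => //; exists i.
by move=> [_ [i _ <-] <-]; exists i.
Qed.

(** * The Shephard-Todd groups *)

Section Groups.
Context {K : fieldType}.
Hypothesis K3 : 3%:R != 0 :> K.
Variable o : K.
Hypothesis oo : o ^+ 2 = - 1 - o.

Lemma primitive_cases (w : K) : w ^+ 2 = - 1 - w -> w = o \/ w = o ^+ 2.
Proof.
move=> ww; have : (w - o) * (w - o ^+ 2) = 0 by ring: ww oo.
by move/eqP; rewrite mulf_eq0 !subr_eq0 => /orP[]/eqP; [left|right].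
Qed.

Lemma generated_crefl n (p : 'cV[K]_n) S (w w' : K) : anisotropic p ->
  (w = o \/ w = o ^+ 2) -> (w' = o \/ w' = o ^+ 2) ->
  generated S (crefl p w) -> generated S (crefl p w').
Proof.
move=> p0 hw hw' Gw; suff [->//|->] : w' = w \/ w' = w * w.
  by rewrite -creflM//; exact: generated_mul.
have o4 : o = o ^+ 2 * o ^+ 2 by ring: oo.
by case: hw => ->; case: hw' => ->; (by left) || (by right).
Qed.

(** The displayed generators of both groups mix the two primitive cube roots of unity. Each root is
    the square of the other, so a reflection generates its counterpart, and a single root can be
    used throughout. *)
Lemma generated_crefl_mixed n (L : seq ('cV[K]_n * K)) w : w = o \/ w = o ^+ 2 ->
  (forall x, x \in L -> anisotropic x.1 /\ (x.2 = o \/ x.2 = o ^+ 2)) ->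
  generated [set A | A \in [seq crefl x.1 x.2 | x <- L]] =
  generated [set crefl p w | p in [set p | p \in [seq x.1 | x <- L]]].
Proof.
move=> hw h; apply/seteqP; split; apply: generated_sub => A.
  move=> /= /mapP[x xL ->]; have [p0 hx] := h x xL; apply: (generated_crefl p0 hw hx).
  by apply: generated_gen; exists x.1 => //=; exact: map_f.
move=> [_ /= /mapP[x xL ->] <-]; have [p0 hx] := h x xL; apply: (generated_crefl p0 hx hw).
by apply: generated_gen; apply/mapP; exists x.
Qed.

Lemma generated_roots3 w : w = o \/ w = o ^+ 2 ->
  generated [set A | A \in [::
    diag_of_seq 3 [:: 1; 1; o ^+ 2];
    ((o ^+ 2 - o) / 3) *: mx_of_rows 3
      [:: [:: o; o ^+ 2; o ^+ 2]; [:: o ^+ 2; o; o ^+ 2]; [:: o ^+ 2; o ^+ 2; o]];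
    diag_of_seq 3 [:: 1; o ^+ 2; 1]]] = generated [set crefl p w | p in [set p | p \in roots3]].
Proof.
move=> hw; have [e1 e2 e3] := crefl3E K3 (o ^+ 2); have [_ _ e4] := crefl3E K3 o.
have g1 : diag_of_seq 3 [:: 1; 1; o ^+ 2] = crefl (vec 3 [:: 0; 0; 1]) (o ^+ 2).
  rewrite e2; apply/matrixP => i j; rewrite !mxE.
  by case: i => [[|[|[|//]]] hi]; case: j => [[|[|[|//]]] hj]; rewrite /= ?mulr1n ?mulr0n.
have g3 : diag_of_seq 3 [:: 1; o ^+ 2; 1] = crefl (vec 3 [:: 0; 1; 0]) (o ^+ 2).
  rewrite e1; apply/matrixP => i j; rewrite !mxE.
  by case: i => [[|[|[|//]]] hi]; case: j => [[|[|[|//]]] hj]; rewrite /= ?mulr1n ?mulr0n.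
have g2 : ((o ^+ 2 - o) / 3) *: mx_of_rows 3
    [:: [:: o; o ^+ 2; o ^+ 2]; [:: o ^+ 2; o; o ^+ 2]; [:: o ^+ 2; o ^+ 2; o]]
   = crefl (vec 3 [:: 1; 1; 1]) o.
  rewrite e4; apply/matrixP => i j; rewrite !mxE.
  by case: i => [[|[|[|//]]] hi]; case: j => [[|[|[|//]]] hj]; rewrite /=; field: oo.
pose L : seq ('cV[K]_3 * K) := [:: (vec 3 [:: 0; 1; 0], o ^+ 2); (vec 3 [:: 1; 1; 1], o);
  (vec 3 [:: 0; 0; 1], o ^+ 2)].
have hL x : x \in L -> anisotropic x.1 /\ (x.2 = o \/ x.2 = o ^+ 2).
  move=> xL; split; first by apply: (roots3_anisotropic K3); exact: (map_f fst xL).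
  by move: xL; rewrite !inE => /or3P[]/eqP ->; [right|left|right].
rewrite g1 g2 g3 -[roots3]/[seq x.1 | x <- L] -(generated_crefl_mixed hw hL).
congr generated; apply/funext => A; rewrite /= !inE; congr is_true.
by do 3 case: (A == _).
Qed.

Lemma generated_roots4 w : w = o \/ w = o ^+ 2 ->
  generated [set A | A \in [::
    diag_of_seq 4 [:: 1; 1; o ^+ 2; 1];
    diag_of_seq 4 [:: 1; o ^+ 2; 1; 1];
    ((o ^+ 2 - o) / 3) *: mx_of_rows 4
      [:: [:: o; o ^+ 2; o ^+ 2; 0]; [:: o ^+ 2; o; o ^+ 2; 0];
          [:: o ^+ 2; o ^+ 2; o; 0]; [:: 0; 0; 0; o - o ^+ 2]];
    ((o ^+ 2 - o) / 3) *: mx_of_rows 4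
      [:: [:: o; - o ^+ 2; 0; - o ^+ 2]; [:: - o ^+ 2; o; 0; o ^+ 2];
          [:: 0; 0; o - o ^+ 2; 0]; [:: - o ^+ 2; o ^+ 2; 0; o]]]] =
  generated [set crefl p w | p in [set p | p \in roots4]].
Proof.
move=> hw; have [e1 e2 _ _] := crefl4E K3 (o ^+ 2); have [_ _ e3 e4] := crefl4E K3 o.
have g1 : diag_of_seq 4 [:: 1; 1; o ^+ 2; 1] = crefl (vec 4 [:: 0; 0; 1; 0]) (o ^+ 2).
  rewrite e2; apply/matrixP => i j; rewrite !mxE.
  by case: i => [[|[|[|[|//]]]] hi]; case: j => [[|[|[|[|//]]]] hj]; rewrite /= ?mulr1n ?mulr0n.
have g2 : diag_of_seq 4 [:: 1; o ^+ 2; 1; 1] = crefl (vec 4 [:: 0; 1; 0; 0]) (o ^+ 2).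
  rewrite e1; apply/matrixP => i j; rewrite !mxE.
  by case: i => [[|[|[|[|//]]]] hi]; case: j => [[|[|[|[|//]]]] hj]; rewrite /= ?mulr1n ?mulr0n.
have g3 : ((o ^+ 2 - o) / 3) *: mx_of_rows 4
    [:: [:: o; o ^+ 2; o ^+ 2; 0]; [:: o ^+ 2; o; o ^+ 2; 0]; [:: o ^+ 2; o ^+ 2; o; 0];
        [:: 0; 0; 0; o - o ^+ 2]] = crefl (vec 4 [:: 1; 1; 1; 0]) o.
  rewrite e3; apply/matrixP => i j; rewrite !mxE.
  by case: i => [[|[|[|[|//]]]] hi]; case: j => [[|[|[|[|//]]]] hj]; rewrite /=; field: oo.
have g4 : ((o ^+ 2 - o) / 3) *: mx_of_rows 4
    [:: [:: o; - o ^+ 2; 0; - o ^+ 2]; [:: - o ^+ 2; o; 0; o ^+ 2]; [:: 0; 0; o - o ^+ 2; 0];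
        [:: - o ^+ 2; o ^+ 2; 0; o]] = crefl (vec 4 [:: 1; -1; 0; -1]) o.
  rewrite e4; apply/matrixP => i j; rewrite !mxE.
  by case: i => [[|[|[|[|//]]]] hi]; case: j => [[|[|[|[|//]]]] hj]; rewrite /=; field: oo.
pose L : seq ('cV[K]_4 * K) := [:: (vec 4 [:: 1; -1; 0; -1], o); (vec 4 [:: 0; 1; 0; 0], o ^+ 2);
  (vec 4 [:: 1; 1; 1; 0], o); (vec 4 [:: 0; 0; 1; 0], o ^+ 2)].
have hL x : x \in L -> anisotropic x.1 /\ (x.2 = o \/ x.2 = o ^+ 2).
  move=> xL; split; first by apply: (roots4_anisotropic K3); exact: (map_f fst xL).
  by move: xL; rewrite !inE => /or4P[]/eqP ->; [left|right|left|right].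
rewrite g1 g2 g3 g4 -[roots4]/[seq x.1 | x <- L] -(generated_crefl_mixed hw hL).
congr generated; apply/funext => A; rewrite /= !inE; congr is_true.
by do 4 case: (A == _).
Qed.

Lemma generated_nth n k (s : seq 'M[K]_n) : size s = k ->
  generated [set A | exists i : 'I_k, A = nth 1%:M s i] = generated [set A | A \in s].
Proof.
move=> sk; congr generated; apply/seteqP; split=> A /=.
  by move=> [i ->]; rewrite mem_nth// sk.
move=> As; have h : (index A s < k)%N by rewrite -sk index_mem.
by exists (Ordinal h); rewrite nth_index.
Qed.

Theorem reflection_tuple_crefl m (ps : seq 'cV[K]_m.+1) (zeta : K) (M : 'I_m.+1 -> 'M[K]_m.+1) :
  zeta ^+ 2 - zeta + 1 = 0 -> size ps = m.+1 -> {in ps, forall p, anisotropic p} ->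
  std_gram m zeta \in unitmx ->
  (\rank (coxprod (zeta ^+ 2) ps - zeta%:M)%R <= 1)%N ->
  reflection_tuple zeta M ->
  GL_conjugate (generated [set A | exists i, A = M i])
    (generated [set crefl p (zeta ^+ 2) | p in [set p | p \in ps]]).
Proof.
move=> z6 sps hp gu rk hM; have w3 : (zeta ^+ 2) ^+ 3 = 1.
  apply/eqP; rewrite -subr_eq0; apply/eqP.
  transitivity ((zeta ^+ 2 - zeta + 1) * ((zeta + 1) * (zeta ^+ 3 - 1))); [ring|by rewrite z6 mul0r].
rewrite -(generated_chain w3 hp) -(@generated_nth _ m.+1) ?size_chain//.
apply: (reflection_tuples_conj z6 _ gu hM (chain_reflection_tuple z6 sps hp rk)).
(* If [zeta ^+ 2 = 1], the quadratic equation gives [zeta = 2], and then [4 = 1], against the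
   assumption on 3. *)
apply: contraTneq K3 => z1; rewrite negbK; apply/eqP.
have z2 : zeta = 2%:R by rewrite -[LHS]addr0 -z6 z1; ring.
have : zeta ^+ 2 = 1 := z1; rewrite z2 => e4.
transitivity (2%:R ^+ 2 - 1 : K); [ring|by rewrite e4 subrr].
Qed.

End Groups.

Section OmegaGroups.
Variable R : realType.
Let o : CC R := omega R.

Lemma omega2 : o ^+ 2 = - 1 - o.
Proof.
have [h3 hi] := @omega_props R.
have o1 : o - 1 != 0.
  rewrite subr_eq0; apply: contraNneq hi; rewrite -/o => ->; by rewrite creE.
apply: (mulfI o1); have : o ^+ 3 - 1 = 0 by rewrite h3 subrr.
move=> h; apply/eqP; rewrite -subr_eq0 -h; apply/eqP; ring.
Qed.

Lemma CC3 : 3%:R != 0 :> CC R.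
Proof. by rewrite pnatr_eq0. Qed.

Lemma G25_crefl (w : CC R) : w ^+ 2 = - 1 - w ->
  @G25 R = generated [set crefl p w | p in [set p | p \in roots3]].
Proof. by move/(primitive_cases omega2)/(generated_roots3 CC3 omega2). Qed.

Lemma G32_crefl (w : CC R) : w ^+ 2 = - 1 - w ->
  @G32 R = generated [set crefl p w | p in [set p | p \in roots4]].
Proof. by move/(primitive_cases omega2)/(generated_roots4 CC3 omega2). Qed.
End OmegaGroups.

(** * Base point and conclusion *)

Section Gauge.
Context {R : realType} {n : nat}.
Implicit Types (Om : CC R -> 'M[CC R]_n).

Lemma horizontal_mder Om (Z : CC R -> 'cV[CC R]_n) x :
  horizontal_at Om Z x <-> mder Z x (- (Om x *m Z x)).
Proof.
split=> h i; first by move=> j; rewrite ord1 mxE; apply/cderP; exact: h.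
by have := h i 0; rewrite mxE => /cderP.
Qed.

Lemma monodromy_group_gauge S Om b P A : P \in unitmx -> monodromy_group S Om b A ->
  monodromy_group S (fun x => P *m Om x *m invmx P) b (P *m A *m invmx P).
Proof.
move=> uP [g lg hA]; exists g => // v; have [Z [[hor glue] Z0 Z1]] := hA (invmx P *m v).
exists (fun t x => P *m Z t x); split; last 2 first.
- by rewrite Z0 mulKVmx.
- by rewrite Z1 !mulmxA.
split=> t t01.
  apply: filterS (hor t t01) => x /horizontal_mder h; apply/horizontal_mder.
  rewrite mulmxA mulmxKV// -mulmxA.
  apply: mder_eq (mderM (mder_cst P x) h) _.
  by rewrite mul0mx add0r mulmxN.
apply: filterS (glue t t01) => u h u01.
by apply: filterS (h u01) => x ->.
Qed.

(** Needed for a permutation matrix: the poles have to be renumbered by the directions of their rays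
    from the base point. *)
Lemma GL_conjugate_gauge S Om Om' b P : P \in unitmx ->
  (forall x, Om' x = P *m Om x *m invmx P) ->
  GL_conjugate (monodromy_group S Om b) (monodromy_group S Om' b).
Proof.
move=> uP OmP; have uP' : invmx P \in unitmx by rewrite unitmx_inv.
have eO : Om' = fun x => P *m Om x *m invmx P by apply/funext.
have eO' : Om = fun x => invmx P *m Om' x *m invmx (invmx P).
  by apply/funext => x; rewrite OmP invmxK !mulmxA mulVmx// mul1mx mulmxKV.
exists (invmx P) => //; apply/seteqP; split=> A.
  move=> /(monodromy_group_gauge uP); rewrite -eO => h; exists (P *m A *m invmx P) => //.
  by rewrite invmxK !mulmxA mulVmx// mul1mx mulmxKV.
by move=> [B /(monodromy_group_gauge uP') + <-]; rewrite -eO'.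
Qed.
End Gauge.

Section BasePoint.
Context {R : realType} {m : nat}.
Local Notation n := m.+1.
Variable s : 'I_n -> CC R.

(** The number [q i j] is the abscissa at which the line through two poles meets the horizontal line
    at height [b], below all poles. A point further right lies on none of these lines, so all rays
    have different slopes; poles of equal height are treated apart. *)
Lemma generic_base_point : injective s -> exists c : CC R,
  (forall j, 0 < py c (s j)) /\ injective (rho s c).
Proof.
move=> sinj; pose b : R := - (\sum_j `|cim (s j)|) - 1.
pose Y j := cim (s j) - b; pose X j := cre (s j).
pose q i j := (X i * Y j - X j * Y i) / (Y j - Y i).
pose a := \sum_i \sum_j `|q i j| + 1.
have le1 k (f : 'I_k -> R) j : `|f j| <= \sum_j `|f j|.
  by rewrite (bigD1 j)//= lerDl; apply: sumr_ge0.
have Y0 j : 0 < Y j.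
  have := le1 _ (cim \o s) j; rewrite /Y /b /= ler_norml; lra.
have qa i j : q i j < a.
  have h1 : q i j <= \sum_j `|q i j| by exact: le_trans (ler_norm _) (le1 _ (q i) j).
  have h2 : \sum_j `|q i j| <= \sum_i \sum_j `|q i j|.
    rewrite [leRHS](bigD1 i)//= lerDl; apply: sumr_ge0 => ? _; exact: sumr_ge0.
  by rewrite /a; lra.
have pyE j : py (mkc a b) (s j) = Y j by rewrite /py creE.
have pxE j : px (mkc a b) (s j) = X j - a by rewrite /px creE.
exists (mkc a b); split=> [j|i j]; first by rewrite pyE.
rewrite /rho !pyE !pxE => /eqP.
rewrite eqr_div ?lt0r_neq0// => /eqP e.
have e' : a * (Y j - Y i) = X i * Y j - X j * Y i by move: e; lra.
have [YY|YY] := eqVneq (Y j) (Y i).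
  apply: sinj; apply/ceqP; split; last by move: YY; rewrite /Y; lra.
  move: e; rewrite YY => /mulIf -/(_ (lt0r_neq0 (Y0 i))); rewrite /X; lra.
have := qa i j; rewrite /q -e' mulfK ?ltxx//; by rewrite subr_eq0.
Qed.

Lemma decreasing_perm (f : 'I_n -> R) : injective f ->
  exists p : {perm 'I_n}, forall i j : 'I_n, (i < j)%N -> f (p j) < f (p i).
Proof.
move=> finj; pose le i j := f j <= f i.
pose t := sort le (enum 'I_n).
have st : size t = n by rewrite size_sort size_enum_ord.
have ut : uniq t by rewrite sort_uniq enum_uniq.
have pinj : injective (fun i : 'I_n => nth ord0 t i).
  by move=> i j /eqP; rewrite nth_uniq ?st ?ltn_ord// => /eqP/val_inj.
exists (perm pinj) => i j ij; rewrite !permE lt_neqAle; apply/andP; split.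
  rewrite (inj_eq finj) nth_uniq ?st ?ltn_ord//; move: ij; lia.
have letr : transitive le by move=> y x z; rewrite /le => h1 h2; exact: le_trans h2 h1.
apply: (sorted_leq_nth letr (fun _ => lexx _) ord0); rewrite ?inE ?st ?ltn_ord//; last exact: ltnW.
by apply: sort_sorted => x y; exact: le_total.
Qed.
End BasePoint.

(** Which primitive sixth root of unity occurs is never computed: the hypothesis on [ps] covers
    both, and the conclusion leaves [w] existential. *)
Theorem okubo_monodromy (R : realType) m (ka : R) (s : 'I_m.+1 -> CC R) (S : seq (CC R)) Om b
    (ps : seq 'cV[CC R]_m.+1) :
  (2 <= m <= 4)%N -> ka = 6^-1 \/ ka = - 6^-1 -> injective s ->
  (forall x, reflect (exists j, x = s j) (x \in S)) ->
  (forall x, Om x = okubo (resB m.+1 ka) s x) -> b \notin S ->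
  size ps = m.+1 -> {in ps, forall p, anisotropic p} ->
  (forall zeta : CC R, zeta ^+ 2 - zeta + 1 = 0 -> std_gram m zeta \in unitmx /\
     (\rank (coxprod (zeta ^+ 2) ps - zeta%:M)%R <= 1)%N) ->
  exists2 w : CC R, w ^+ 2 = - 1 - w &
    GL_conjugate (monodromy_group S Om b)
      (generated [set crefl p w | p in [set p | p \in ps]]).
Proof.
move=> m24 ka6 sinj SP OmE bS sps hp hz.
have [c [Y0 rinj]] := generic_base_point sinj.
have [p hpd] := decreasing_perm rinj.
pose s' i := s (p i).
have s'inj : injective s' by move=> i j /sinj/perm_inj.
have Y0' j : 0 < py c (s' j) by exact: Y0.
have [de de0 hde] : exists2 de : R, 0 < de &
    forall i j : 'I_m.+1, (i < j)%N -> rho s' c j + de <= rho s' c i.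
  have gap (i j : 'I_m.+1) : (i < j)%N -> 0 < rho s' c i - rho s' c j.
    by move=> ij; have := hpd i j ij; rewrite -/(rho s' c i) -/(rho s' c j) subr_gt0.
  pose f (i j : 'I_m.+1) := if (i < j)%N then rho s' c i - rho s' c j else 1.
  have f0 i j : 0 < f i j by rewrite /f; case: ifP => [/gap|].
  have /choice[d hd] i : exists d : R, 0 < d /\ forall j, d <= f i j.
    by have [d d0 h] := finite_min (f0 i); exists d.
  have [de de0 h] := finite_min (fun i => (hd i).1).
  exists de => // i j ij; have := le_trans (h i) ((hd i).2 j); rewrite /f ij.
  by rewrite lerBrDl.
have [F [G [F' [G' [Cp [Cm [zeta [[Fc FG FG' uC hF] z6 r1 rk pr]]]]]]]] :=
  jumps_spec m24 ka6 s'inj Y0' de0 hde.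
have z2 : zeta ^+ 2 = zeta - 1 by apply/eqP; rewrite -subr_eq0 -z6; apply/eqP; ring.
exists (zeta ^+ 2); first by ring: z2.
have up : (perm_mx p : 'M[CC R]_m.+1) \in unitmx by exact: unitmx_perm.
(* Renumbering the poles amounts to conjugation by a permutation matrix, because [resB] is invariant
   under simultaneous permutations of rows and columns. *)
pose Om' x := perm_mx p *m Om x *m invmx (perm_mx p).
have Om'E x : Om' x = okubo (resB m.+1 ka) s' x.
  rewrite /Om'; have -> : invmx (perm_mx p) = perm_mx p^-1 :> 'M[CC R]_m.+1.
    by rewrite -[RHS]mul1mx -(mulVmx up) -mulmxA -perm_mxM mulgV perm_mx1 mulmx1.
  rewrite -row_permE -col_permE OmE /okubo !mul_mx_diag; apply/matrixP => i j.
  by rewrite !mxE (inj_eq perm_inj).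
apply: GL_conjugate_trans (GL_conjugate_gauge S b up (fun x => erefl (Om' x))) _.
have SP' x : reflect (exists j, x = s' j) (x \in S).
  apply: (iffP (SP x)) => [[j ->]|[j ->]]; last by exists (p j).
  by exists ((p^-1)%g j); rewrite /s' permKV.
have mono := monodromy_group_jumps Y0' de0 (rhoN hde) FG FG' uC hF SP' Om'E bS.
apply: GL_conjugate_trans mono _.
have [gu rkc] := hz zeta z6.
have M : reflection_tuple zeta (jump Cp Cm) by [].
exact: (reflection_tuple_crefl (@CC3 R) z6 sps hp gu rkc M).
Qed.

Lemma mem_nth_ord (T : eqType) (x0 : T) (S : seq T) n : size S = n ->
  forall x, reflect (exists j : 'I_n, x = nth x0 S j) (x \in S).
Proof.
move=> sS x; apply: (iffP idP) => [xS|[j ->]]; last by rewrite mem_nth// sS.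
by have h : (index x S < n)%N; [rewrite -sS index_mem|exists (Ordinal h); rewrite nth_index].
Qed.

Lemma nth_ord_inj (T : eqType) (x0 : T) (S : seq T) n : size S = n -> uniq S ->
  injective (fun j : 'I_n => nth x0 S j).
Proof. by move=> sS uS i j /eqP; rewrite nth_uniq ?sS ?ltn_ord// => /eqP/val_inj. Qed.

Lemma sixth_root_sqr (K : comNzRingType) (zeta : K) : zeta ^+ 2 - zeta + 1 = 0 ->
  (zeta ^+ 2) ^+ 2 = - 1 - zeta ^+ 2 /\ zeta = zeta ^+ 2 + 1.
Proof.
move=> z6; have z2 : zeta ^+ 2 = zeta - 1 by apply/eqP; rewrite -subr_eq0 -z6; apply/eqP; ring.
split; ring: z2.
Qed.

Lemma rank_col_row (K : fieldType) n (A : 'M[K]_n) (u : 'cV[K]_n) (f : 'rV[K]_n) :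
  A = u *m f -> (\rank A <= 1)%N.
Proof. by move=> ->; apply: leq_trans (mxrankM_maxl _ _) (rank_leq_col _). Qed.

Lemma uniq_skip (T : eqType) (x y : T) (S : seq T) :
  uniq [:: x, y & S] -> uniq (x :: S).
Proof. by rewrite /= inE negb_or => /and3P[/andP[_ ->] _ ->]. Qed.

Lemma rc_sixth (R : realType) (sgn : CC R) : sgn = 1 \/ sgn = -1 ->
  exists2 ka : R, ka = 6^-1 \/ ka = - 6^-1 & rc ka = sgn / 6.
Proof.
have e6 : rc (6^-1 : R) = 6^-1 by rewrite /rc fmorphV rmorph_nat.
case=> ->; [exists 6^-1; first by left|exists (- 6^-1); first by right].
  by rewrite e6 mul1r.
by rewrite rcN e6 mulN1r.
Qed.

Section Forms.
Variable K : numFieldType.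
Implicit Types (x e : K).

Lemma residues3 (s1 x e : K) :
  e *: ((x - s1)^-1 *: mx_of_rows 3 [:: [:: 1/3; 0; 0]; [:: 1/6; 0; 0]; [:: 1/6; 0; 0]]
  + x^-1 *: mx_of_rows 3 [:: [:: 0; 1/6; 0]; [:: 0; 1/3; 0]; [:: 0; 1/6; 0]]
  + (x - 1)^-1 *: mx_of_rows 3 [:: [:: 0; 0; 1/6]; [:: 0; 0; 1/6]; [:: 0; 0; 1/3]]) =
  (e / 6 *: (const_mx 1 + 1%:M)) *m diag_mx (\row_j (x - nth 0 [:: s1; 0; 1] j)^-1).
Proof.
rewrite mul_mx_diag; apply/matrixP => i j; rewrite !mxE.
case: i => [[|[|[|//]]] hi]; case: j => [[|[|[|//]]] hj];
  rewrite /= ?subr0; move: (x - s1)^-1 x^-1 (x - 1)^-1 => a b c; by field.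
Qed.

Lemma residues4 (s1 s2 x e : K) :
  e *: ((x - s1)^-1 *: mx_of_rows 4
      [:: [:: 1/3; 0; 0; 0]; [:: 1/6; 0; 0; 0]; [:: 1/6; 0; 0; 0]; [:: 1/6; 0; 0; 0]]
  + (x - s2)^-1 *: mx_of_rows 4
      [:: [:: 0; 1/6; 0; 0]; [:: 0; 1/3; 0; 0]; [:: 0; 1/6; 0; 0]; [:: 0; 1/6; 0; 0]]
  + x^-1 *: mx_of_rows 4
      [:: [:: 0; 0; 1/6; 0]; [:: 0; 0; 1/6; 0]; [:: 0; 0; 1/3; 0]; [:: 0; 0; 1/6; 0]]
  + (x - 1)^-1 *: mx_of_rows 4
      [:: [:: 0; 0; 0; 1/6]; [:: 0; 0; 0; 1/6]; [:: 0; 0; 0; 1/6]; [:: 0; 0; 0; 1/3]]) =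
  (e / 6 *: (const_mx 1 + 1%:M)) *m diag_mx (\row_j (x - nth 0 [:: s1; s2; 0; 1] j)^-1).
Proof.
rewrite mul_mx_diag; apply/matrixP => i j; rewrite !mxE.
case: i => [[|[|[|[|//]]]] hi]; case: j => [[|[|[|[|//]]]] hj];
  rewrite /= ?subr0; move: (x - s1)^-1 (x - s2)^-1 x^-1 (x - 1)^-1 => a b c d; by field.
Qed.

End Forms.

Lemma form3_okubo (R : realType) (s1 sgn : CC R) (ka : R) x : rc ka = sgn / 6 ->
  sgn *: form3 s1 x = okubo (resB 3 ka) (fun j => nth 0 [:: s1; 0; 1] j) x.
Proof. by move=> hka; rewrite /okubo /resB hka; exact: residues3. Qed.

Lemma form4_okubo (R : realType) (s1 s2 sgn : CC R) (ka : R) x : rc ka = sgn / 6 ->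
  sgn *: form4 s1 s2 x = okubo (resB 4 ka) (fun j => nth 0 [:: s1; s2; 0; 1] j) x.
Proof. by move=> hka; rewrite /okubo /resB hka; exact: residues4. Qed.

Theorem corollary6p2p3 (R : realType) (s1 s2 : CC R)
    (hdistinct : uniq [:: s1; s2; 0; 1])
    (sgn : CC R) (hsgn : sgn = 1 \/ sgn = -1) :
  (forall b : CC R, b \notin [:: s1; 0; 1] ->
     GL_conjugate
       (monodromy_group [:: s1; 0; 1] (fun x => sgn *: form3 s1 x) b)
       (@G25 R))
  /\
  (forall b : CC R, b \notin [:: s1; s2; 0; 1] ->
     GL_conjugate
       (monodromy_group [:: s1; s2; 0; 1] (fun x => sgn *: form4 s1 s2 x) b)
       (@G32 R)).
Proof.
have [ka ka6 kaE] := rc_sixth hsgn.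
have u3 := uniq_skip hdistinct.
split=> b bS.
  have [//|w ww] := okubo_monodromy (ps := roots3) (isT : (2 <= 2 <= 4)%N) ka6
      (nth_ord_inj (x0 := 0) (S := [:: s1; 0; 1]) (n := 3) erefl u3)
      (mem_nth_ord 0 (S := [:: s1; 0; 1]) erefl)
      (fun x => form3_okubo s1 x kaE) bS erefl (roots3_anisotropic (@CC3 R)).
    move=> zeta /sixth_root_sqr[zz ze].
    split; first exact: (std_gram3_unit (@CC3 R) zz erefl).
    by apply: rank_col_row; rewrite {2}ze; exact: (coxprod_roots3 (@CC3 R) zz).
  by rewrite (G25_crefl ww).
have [//|w ww] := okubo_monodromy (ps := roots4) (isT : (2 <= 3 <= 4)%N) ka6
    (nth_ord_inj (x0 := 0) (S := [:: s1; s2; 0; 1]) (n := 4) erefl hdistinct)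
    (mem_nth_ord 0 (S := [:: s1; s2; 0; 1]) erefl)
    (fun x => form4_okubo s1 s2 x kaE) bS erefl (roots4_anisotropic (@CC3 R)).
  move=> zeta /sixth_root_sqr[zz ze].
  split; first exact: (std_gram4_unit zz erefl).
  by apply: rank_col_row; rewrite {2}ze; exact: (coxprod_roots4 (@CC3 R) zz).
by rewrite (G32_crefl ww).
Qed.
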